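(* Let $\mathcal{M}=(M,\nabla)$ be a connected symmetric affine surface whose torsion tensor $T$ is non-vanishing and parallel ($T\ne 0$, $\nabla T=0$). Then $\mathcal{M}$ is modeled on one of the following affine structures on $\mathbb{R}^2$ with coordinates $(x^1,x^2)$, where all Christoffel symbols which are not listed are zero: \begin{enumerate} \item $\Gamma_{11}{}^1=1$, $\Gamma_{12}{}^1=2$; for this structure $\rho=0$. \item $\Gamma_{11}{}^1=1$, $\Gamma_{12}{}^1=2u$ for some real $u>0$, $\Gamma_{22}{}^1=\pm1$; for this structure $\rho=\pm\,dx^2\otimes dx^2$ (same choice of sign as in $\Gamma_{22}{}^1$). \end{enumerate} Moreover, all the geometries in this list (the one in (1), together with those in (2) for all choices of $u>0$ and of the sign) are homogeneous and are pairwise inequivalent affine structures.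
   Context: An affine surface is a pair $\mathcal{M}=(M,\nabla)$ where $M$ is a smooth 2-dimensional manifold and $\nabla$ is a connection on the tangent bundle of $M$; the torsion is permitted to be non-zero. The torsion tensor is $T(X,Y):=\frac12(\nabla_XY-\nabla_YX-[X,Y])$. The curvature operator is $R(X,Y):=\nabla_X\nabla_Y-\nabla_Y\nabla_X-\nabla_{[X,Y]}$ and the Ricci tensor is $\rho(X,Y):=\operatorname{Trace}(Z\mapsto R(Z,X)Y)$. $\mathcal{M}$ is a symmetric affine surface if $\nabla R=0$, or equivalently (in dimension 2) if $\nabla\rho=0$. In local coordinates the Christoffel symbols are defined by $\nabla_{\partial_{x^i}}\partial_{x^j}=\Gamma_{ij}{}^k\partial_{x^k}$ (in general $\Gamma_{ij}{}^k\ne\Gamma_{ji}{}^k$). An affine diffeomorphism is a diffeomorphism which preserves the connection. Two affine structures are equivalent if there is an affine diffeomorphism between them. $\mathcal{M}$ is (affine) homogeneous if its group of affine diffeomorphisms acts transitively. An affine surface $\mathcal{M}_1=(M_1,\nabla_1)$ is modeled on an affine surface $\mathcal{M}=(M,\nabla)$ if $\mathcal{M}$ is homogeneous and if there is a cover of $M_1$ by open sets which are affine isomorphic to open subsets of $M$. *)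

(* Defs.v *)
From HB Require Import structures.
From mathcomp Require Import all_boot all_order all_algebra.
From mathcomp Require Import all_classical all_reals all_analysis.

Set Implicit Arguments.
Unset Strict Implicit.
Unset Printing Implicit Defensive.

Import Order.TTheory GRing.Theory Num.Theory.
Import numFieldNormedType.Exports.

Local Open Scope classical_set_scope.
Local Open Scope ring_scope.

(* The coordinates x^1, x^2 and all tensor indices 1, 2 are numbered by
   0, 1 : 'I_2. *)
Notation plane R := ('rV[R]_2).

Section LocalCalculus.
Context {R : realType}.
Implicit Types (U W : set (plane R)) (F : plane R -> plane R).

Definition coord_vec (i : 'I_2) : plane R := delta_mx 0 i.

(* All partial derivatives of order at most n exist and are continuous on U.
   U is meant to be open: the conditions at x \in U use full neighbourhoods
   of x in the plane. *)
Fixpoint Ck_on (n : nat) U (V : normedModType R) (f : plane R -> V) : Prop :=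
  (forall x, U x -> {for x, continuous f}) /\
  (if n is m.+1 then
     forall i, (forall x, U x -> derivable f x (coord_vec i)) /\
               Ck_on m U ('D_(coord_vec i) f)
   else True).

Definition smooth_on U (V : normedModType R) (f : plane R -> V) : Prop :=
  forall n, Ck_on n U f.

(* Vector fields on an open subset of the plane: functions giving the
   components in the coordinate frame. *)
Definition field := plane R -> plane R.

(* G i j k is Gamma_{ij}^k. *)
Definition christoffel := 'I_2 -> 'I_2 -> 'I_2 -> plane R -> R.

Definition bracket (X Y : field) : field :=
  fun x => 'D_(X x) Y x - 'D_(Y x) X x.

Section Connection.
Variable G : christoffel.

(* nabla_X Y for the connection with
   nabla_{d_i} d_j = \sum_k Gamma_{ij}^k d_k *)
Definition cov (X Y : field) : field := fun x =>
  'D_(X x) Y x +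
  \row_k \sum_i \sum_j G i j k x * X x 0 i * Y x 0 j.

Definition torsion (X Y : field) : field := fun x =>
  2^-1 *: (cov X Y x - cov Y X x - bracket X Y x).

Definition curvature (X Y Z : field) : field := fun x =>
  cov X (cov Y Z) x - cov Y (cov X Z) x - cov (bracket X Y) Z x.

(* The trace of the endomorphism z |-> R(z, X) Y of the tangent space at x;
   since R is tensorial, z may be extended to a constant field. *)
Definition ricci (X Y : field) : plane R -> R := fun x =>
  \tr (lin1_mx (fun z : plane R => curvature (cst z) X Y x)).

(* (nabla_Z T)(X, Y) *)
Definition cov_torsion (Z X Y : field) : field := fun x =>
  cov Z (torsion X Y) x - torsion (cov Z X) Y x - torsion X (cov Z Y) x.

(* (nabla_V R)(X, Y) Z *)
Definition cov_curvature (V X Y Z : field) : field := fun x =>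
  cov V (curvature X Y Z) x - curvature (cov V X) Y Z x
  - curvature X (cov V Y) Z x - curvature X Y (cov V Z) x.
End Connection.

Definition related W F (X X' : field) : Prop :=
  forall x, W x -> X' (F x) = 'D_(X x) F x.

(* F_*(nabla_X Y) = nabla'_{F_* X} (F_* Y) over W. This is the intended notion
   only when F is a diffeomorphism of the open set W onto the open set
   F @` W, which is the case in every use below. *)
Definition preserves_connection W (G G' : christoffel) F : Prop :=
  forall X Y X' Y' : field,
    smooth_on W X -> smooth_on W Y ->
    smooth_on (F @` W) X' -> smooth_on (F @` W) Y' ->
    related W F X X' -> related W F Y Y' ->
    related W F (cov G X Y) (cov G' X' Y').

End LocalCalculus.
Arguments field R : clear implicits.
Arguments christoffel R : clear implicits.

(* Charts are represented by total functions, which are meaningful only on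
   chart_dom and chart_cod. *)
Record chart (R : realType) (T : topologicalType) := Chart {
  chart_dom : set T;
  chart_cod : set (plane R);
  chart_map : T -> plane R;
  chart_inv : plane R -> T;
  chart_dom_open : open chart_dom;
  chart_cod_open : open chart_cod;
  chart_mapP : forall p, chart_dom p -> chart_cod (chart_map p);
  chart_invP : forall x, chart_cod x -> chart_dom (chart_inv x);
  chart_mapK : forall p, chart_dom p -> chart_inv (chart_map p) = p;
  chart_invK : forall x, chart_cod x -> chart_map (chart_inv x) = x;
  chart_map_continuous : forall p, chart_dom p -> {for p, continuous chart_map};
  chart_inv_continuous : forall x, chart_cod x -> {for x, continuous chart_inv}
}.

Section LocalExpression.
Context {R : realType} {S T : topologicalType}.
Variables (a : chart R S) (b : chart R T) (U : set S) (f : S -> T).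

(* The expression of the restriction of f to U in the charts a and b. *)
Definition expr_dom : set (plane R) :=
  [set x | chart_cod a x /\ U (chart_inv a x) /\
           chart_dom b (f (chart_inv a x))].

Definition expr : plane R -> plane R :=
  fun x => chart_map b (f (chart_inv a x)).
End LocalExpression.

Record smooth_surface (R : realType) := SmoothSurface {
  point :> topologicalType;
  point_hausdorff : hausdorff_space point;
  point_second_countable : @second_countable point;
  atlas_index : Type;
  atlas : atlas_index -> chart R point;
  atlas_cover : forall p : point, exists a, chart_dom (atlas a) p;
  atlas_smooth : forall a b,
    smooth_on (expr_dom (atlas a) (atlas b) setT id)
              (expr (atlas a) (atlas b) id)
}.

(* A connection on the tangent bundle, given by its Christoffel symbols in the
   charts of the atlas; the coordinate changes intertwine the local covariant
   derivatives. *)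
Record connection (R : realType) (M : smooth_surface R) := Connection {
  symbols : atlas_index M -> christoffel R;
  symbols_smooth : forall a i j k,
    smooth_on (chart_cod (atlas a)) (symbols a i j k : plane R -> R);
  symbols_compat : forall a b,
    preserves_connection (expr_dom (atlas a) (atlas b) setT id)
      (symbols a) (symbols b) (expr (atlas a) (atlas b) id)
}.

Record affine_surface (R : realType) := AffineSurface {
  surface :> smooth_surface R;
  nabla : connection surface
}.

Section AffineSurfaces.
Context {R : realType}.

Definition chart_symbols (M : affine_surface R) (a : atlas_index M) :
  christoffel R := symbols (nabla M) a.

Definition chart_field (M : affine_surface R) (a : atlas_index M)
  (X : field R) : Prop := smooth_on (chart_cod (atlas a)) X.

Definition torsion_nonzero (M : affine_surface R) : Prop :=
  exists (a : atlas_index M) (X Y : field R) (x : plane R),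
    [/\ chart_field a X, chart_field a Y, chart_cod (atlas a) x &
        torsion (chart_symbols a) X Y x != 0].

Definition torsion_parallel (M : affine_surface R) : Prop :=
  forall (a : atlas_index M) (Z X Y : field R),
    chart_field a Z -> chart_field a X -> chart_field a Y ->
    forall x, chart_cod (atlas a) x ->
      cov_torsion (chart_symbols a) Z X Y x = 0.

Definition symmetric_surface (M : affine_surface R) : Prop :=
  forall (a : atlas_index M) (V X Y Z : field R),
    chart_field a V -> chart_field a X -> chart_field a Y -> chart_field a Z ->
    forall x, chart_cod (atlas a) x ->
      cov_curvature (chart_symbols a) V X Y Z x = 0.

Definition smooth_map_on (M N : affine_surface R) (U : set M) (f : M -> N) :=
  (forall p, U p -> {for p, continuous f}) /\
  forall (a : atlas_index M) (b : atlas_index N),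
    smooth_on (expr_dom (atlas a) (atlas b) U f) (expr (atlas a) (atlas b) f).

(* f restricts to an affine diffeomorphism of the open set U of M onto the
   open set V of N, with inverse the restriction of g to V. *)
Definition affine_iso (M N : affine_surface R) (U : set M) (V : set N)
    (f : M -> N) (g : N -> M) : Prop :=
  [/\ open U /\ open V,
      (forall p, U p -> V (f p) /\ g (f p) = p),
      (forall q, V q -> U (g q) /\ f (g q) = q),
      smooth_map_on U f /\ smooth_map_on V g &
      forall (a : atlas_index M) (b : atlas_index N),
        preserves_connection (expr_dom (atlas a) (atlas b) U f)
          (chart_symbols a) (chart_symbols b) (expr (atlas a) (atlas b) f)].

Definition affine_diffeo (M N : affine_surface R) (f : M -> N) : Prop :=
  exists g : N -> M, affine_iso setT setT f g.

Definition equivalent (M N : affine_surface R) : Prop :=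
  exists f : M -> N, affine_diffeo f.

Definition homogeneous (M : affine_surface R) : Prop :=
  forall p q : M, exists f : M -> M, affine_diffeo f /\ f p = q.

Definition modeled_on (M1 M : affine_surface R) : Prop :=
  homogeneous M /\
  forall p : M1, exists (U : set M1) (V : set M) (f : M1 -> M) (g : M -> M1),
    U p /\ affine_iso U V f g.

End AffineSurfaces.

Section PlaneModels.
Context {R : realType}.
Local Notation plane := (plane R).

Lemma plane_second_countable : @second_countable plane.
Proof.
pose c (t : rat * rat * rat) : set plane :=
  ball (\row_j (if j == 0 then ratr t.1.1 else ratr t.1.2) : plane)
       (ratr t.2 : R).
exists (c @` [set t | 0 < t.2]).
  exact: (card_le_trans (card_image_le _ _) (countableP _)).
split=> [_ [t /= _ <-]|x A /nbhs_ballP[e /= e0 eA]]; first exact: ball_open.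
have [r] : exists r : rat, 0 < (ratr r : R) < e / 2.
  have [r] := rat_in_itvoo (divr_gt0 e0 (ltr0Sn R 1)).
  by rewrite in_itv /= => H; exists r.
move=> /andP[r0 re].
have q (y : R) : exists s : rat, `|y - ratr s| < ratr r.
  have /rat_in_itvoo[s] : y - ratr r < y + ratr r.
    by rewrite ltrBlDr -addrA ltrDl addr_gt0.
  rewrite in_itv /= => /andP[s1 s2]; exists s.
  by rewrite distrC ltr_distl s1 s2.
have [s0 hs0] := q (x 0 0); have [s1 hs1] := q (x 0 1).
have cx : c (s0, s1, r) x.
  rewrite /c /ball /= /mx_ball; split=> // i j; rewrite !mxE ord1 /ball /=.
  rewrite distrC; case: (eqVneq j 0) => [->//|].
  by case: j => [[|[|]]]//= ? _; rewrite (_ : Ordinal _ = 1) //; exact/val_inj.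
exists (c (s0, s1, r)) => /=.
  by split=> //; exists (s0, s1, r) => //=; rewrite -(ltr0q R).
move=> y cy; apply: eA; rewrite (splitr e).
apply: (@le_ball _ _ _ (ratr r + ratr r)); first by rewrite ltW// ltrD.
by apply: ball_triangle cy; exact: ball_sym.
Qed.

Definition plane_chart : chart R plane.
Proof.
refine (@Chart R plane setT setT id id openT openT _ _ _ _ _ _) => //.
- by move=> p _; apply: cvg_id.
- by move=> p _; apply: cvg_id.
Defined.

Lemma smooth_cst (U : set plane) (V : normedModType R) (v : V) :
  smooth_on U (cst v).
Proof.
move=> n; elim: n v => [|n IH] v; split=> //.
- by move=> x _; exact: cst_continuous.
- by move=> x _; exact: cst_continuous.
- move=> i; split=> [x _|]; first exact: derivable_cst.
  rewrite (_ : 'D_(coord_vec i) (cst v) = cst 0) //.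
  by apply/funext => x; rewrite derive_cst.
Qed.

Lemma smooth_id (U : set plane) : smooth_on U (id : plane -> plane).
Proof.
case=> [|n]; split=> //.
- by move=> x _; apply: cvg_id.
- by move=> x _; apply: cvg_id.
- move=> i; split=> [x _|]; first exact: derivable_id.
  rewrite (_ : 'D_(coord_vec i) id = cst (coord_vec i)); first exact: smooth_cst.
  by apply/funext => x; rewrite derive_id.
Qed.

Definition plane_surface : smooth_surface R.
Proof.
refine (@SmoothSurface R plane (@norm_hausdorff _ _) plane_second_countable
  unit (fun _ => plane_chart) _ _).
- by move=> p; exists tt.
- by move=> a b; exact: smooth_id.
Defined.

Definition const_connection (c : 'I_2 -> 'I_2 -> 'I_2 -> R) :
  connection plane_surface.
Proof.
refine (@Connection R plane_surface (fun _ i j k _ => c i j k) _ _).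
- by move=> a i j k; exact: smooth_cst.
- move=> a b X Y X' Y' _ _ _ _ XX' YY'.
  have id_related (Z Z' : field R) :
    related (expr_dom plane_chart plane_chart setT id)
      (expr plane_chart plane_chart id) Z Z' -> Z' = Z.
    by move=> ZZ'; apply/funext => x; rewrite (ZZ' x) // derive_id.
  by move=> x _; rewrite (id_related _ _ XX') (id_related _ _ YY') derive_id.
Defined.

(* The connection on the plane with Gamma_11^1 = a, Gamma_12^1 = b,
   Gamma_22^1 = c and all other Christoffel symbols zero. *)
Definition plane_model (a b c : R) : affine_surface R :=
  @AffineSurface R plane_surface (const_connection (fun i j k =>
    match val i, val j, val k with
    | 0%N, 0%N, 0%N => a
    | 0%N, 1%N, 0%N => b
    | 1%N, 1%N, 0%N => c
    | _, _, _ => 0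
    end)).

Definition model1 : affine_surface R := plane_model 1 2 0.

(* The sign of Gamma_22^1 is (-1) ^+ s. *)
Definition model2 (u : R) (s : bool) : affine_surface R :=
  plane_model 1 (2 * u) ((-1) ^+ s).

End PlaneModels.
Arguments model1 R : clear implicits.

(* Main.v *)
Require Import Defs.
From HB Require Import structures.
From mathcomp Require Import all_boot all_order all_algebra.
From mathcomp Require Import all_classical all_reals all_analysis.
From mathcomp Require Import ring lra.

Set Implicit Arguments.
Unset Strict Implicit.
Unset Printing Implicit Defensive.

Import Order.TTheory GRing.Theory Num.Theory.
Import numFieldNormedType.Exports.

Local Open Scope classical_set_scope.
Local Open Scope ring_scope.

(* Contract torsion and curvature with d_1 ^ d_2 to a vector density t and an
   endomorphism density r. If both are parallel, equality of the mixed partial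
   derivatives of t and r gives r t = (tr r) t and (tr r) r = 0, so that
   tr r = 0 and r t = 0. Where t != 0 this means r = b t (x) tau with
   tau = t_1 dx^2 - t_2 dx^1, and b is locally constant. A parallel t that vanishes
   at a point vanishes near it, and b is invariant under affine maps, so on a
   connected surface t vanishes nowhere and b is a constant.
   Take u > 0 with b u^2 in {-1, 0, 1}, and u = 1 if b = 0. The form tau is closed;
   let dy = tau / u. An affine map to the model has the form (ln g, y) with
   Hess g = - 2 u dg (x) dy - b u^2 g dy (x) dy. This system is integrable, and a
   solution with g > 0 and dg ^ dy != 0 is obtained by quadratures from a positive
   solution w(y) of w'' + 2 u w' + b u^2 w = 0. By the inverse function theorem
   (ln g, y) is a local affine isomorphism.
   The models are homogeneous under translations, and b = +- 1 / u^2 or 0 tells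
   them apart. *)

(** * Calculus in the plane *)

(** The obstacle is integrability. The system for an affine map to the model is overdetermined, and
    nothing stronger than the Poincare lemma is used to integrate it, so each step is arranged to be
    a closed 1-form. As tr r = 0, the trace of the connection is closed and yields a parallel area
    form; t divided by that density is a parallel vector field xi with dy(xi) = 0. Every 1-form s
    with s(xi) = 1 then satisfies nabla s = c (x) dy for some c, and the ansatz dg = s + n dy turns
    the Hessian equation into a linear first-order system for (g, n). A solution w(y) of the
    homogeneous equation lowers it to two quadratures by reduction of order, and w is elementary
    because its equation has constant coefficients. The exponential of the first coordinate appears
    because Gamma_11^1 = 1 in the models: it absorbs the quadratic term and makes the equation
    linear. In a model with Gamma_12^1 = 2 u and Gamma_22^1 = e, t = u d_1 and r maps d_2 to e d_1,
    so b = e / u^2; this is the origin of the condition b u^2 = e. *)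

Section PlaneCoordinates.
Context {R : realType}.
Implicit Types (x y v w : plane R).

Lemma sum_I2 (V : nmodType) (F : 'I_2 -> V) : \sum_i F i = F 0 + F 1.
Proof. by rewrite !big_ord_recl big_ord0 addr0; congr (_ + F _); exact/val_inj. Qed.

Lemma forall_I2 (P : 'I_2 -> Prop) : P 0 -> P 1 -> forall i, P i.
Proof.
move=> P0 P1 [[|[|//]] h].
- by rewrite (_ : Ordinal h = 0)//; exact/val_inj.
- by rewrite (_ : Ordinal h = 1)//; exact/val_inj.
Qed.

Lemma plane_eq x y : x 0 0 = y 0 0 -> x 0 1 = y 0 1 -> x = y.
Proof. by move=> e0 e1; apply/rowP; exact: forall_I2. Qed.

Lemma coord_vecE i j : (coord_vec i : plane R) 0 j = (j == i)%:R.
Proof. by rewrite mxE eqxx. Qed.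

Lemma plane_decomp v : v = v 0 0 *: coord_vec 0 + v 0 1 *: coord_vec 1.
Proof. by apply: plane_eq; rewrite !mxE /= ?mulr1 ?mulr0 ?addr0 ?add0r. Qed.

Lemma le_coord_norm x i : `|x 0 i| <= `|x|.
Proof.
by rewrite [leRHS]/Num.Def.normr/= mx_normrE; exact: (le_bigmax _ _ (0, i)).
Qed.

Lemma norm_plane_le x e : 0 <= e -> `|x 0 0| <= e -> `|x 0 1| <= e -> `|x| <= e.
Proof.
move=> e0 h0 h1; rewrite /Num.Def.normr/= mx_normrE; apply: bigmax_le => // -[i j] _.
by rewrite ord1; move: j; exact: forall_I2.
Qed.

Lemma norm_coord_vec i : `|coord_vec i : plane R| <= 1.
Proof. by apply: norm_plane_le; rewrite // coord_vecE; case: (_ == _); rewrite ?normr0 ?normr1. Qed.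

End PlaneCoordinates.

Section MeanValue.
Context {R : realType} {V : normedModType R}.

Lemma is_derive_line (W : normedModType R) (f : V -> W) x v (s : R) :
  derivable f (x + s *: v) v ->
  is_derive s 1 (fun s => f (x + s *: v)) ('D_v f (x + s *: v)).
Proof.
have E : (fun h : R => h^-1 *: (f (x + (h *: 1 + s) *: v) - f (x + s *: v))) =
  (fun h => h^-1 *: ((f \o shift (x + s *: v)) (h *: v) - f (x + s *: v))).
  apply/funext => h; congr (_ *: (f _ - _)).
  by rewrite /= [h *: 1]mulr1 scalerDl addrCA.
by move=> d; split; rewrite ?/derivable ?/derive E.
Qed.

(** The step [h] may be negative, so both orders of the segment are allowed. The intermediate point
    stays on the segment itself, since later staircase arguments control the function only there. *)
Lemma mvt_line_between (f : V -> R) x v (h : R) :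
  (forall s : R, (0 <= s <= h) || (h <= s <= 0) -> derivable f (x + s *: v) v) ->
  exists2 s : R, (0 <= s <= h) || (h <= s <= 0) &
    f (x + h *: v) - f x = h * 'D_v f (x + s *: v).
Proof.
move=> df; pose g (s : R) : R := f (x + s *: v); pose dg (s : R) : R := 'D_v f (x + s *: v).
have dgE s : (0 <= s <= h) || (h <= s <= 0) -> is_derive s (1 : R) g (dg s).
  by move=> sh; apply: is_derive_line; exact: df.
have cg s : (0 <= s <= h) || (h <= s <= 0) -> {for s, continuous g}.
  by move=> /dgE dgs; exact/differentiable_continuous/derivable1_diffP.
have g0 : g 0 = f x by rewrite /g scale0r addr0.
have cw a b : (forall s, a <= s <= b -> (0 <= s <= h) || (h <= s <= 0)) ->
    {within `[a, b], continuous g}.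
  move=> ab; apply: continuous_in_subspaceT => s; rewrite inE/= in_itv/= => sab.
  by apply: cg; exact: ab.
have [h0|h0] := leP 0 h.
- have hh s : 0 <= s <= h -> (0 <= s <= h) || (h <= s <= 0) by move=> ->.
  have [||c] := @MVT_segment _ g dg 0 h h0.
  + by move=> s; rewrite in_itv/= => /andP[s0 sh]; apply/dgE/hh; rewrite !ltW.
  + exact: cw.
  rewrite in_itv/= => /hh ch E; exists c => //.
  by rewrite -g0 -/(g h) E subr0 mulrC.
- have hh s : h <= s <= 0 -> (0 <= s <= h) || (h <= s <= 0) by move=> ->; rewrite orbT.
  have [||c] := @MVT_segment _ g dg h 0 (ltW h0).
  + by move=> s; rewrite in_itv/= => /andP[s0 sh]; apply/dgE/hh; rewrite !ltW.
  + exact: cw.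
  rewrite in_itv/= => /hh ch E; exists c => //.
  by rewrite -g0 -/(g h) -opprB E sub0r mulrN opprK mulrC.
Qed.

Lemma norm_between (s h : R) : (0 <= s <= h) || (h <= s <= 0) -> `|s| <= `|h|.
Proof.
case/orP => /andP[a b]; first by rewrite !ger0_norm// (le_trans a).
by rewrite !ler0_norm ?lerN2// (le_trans a).
Qed.

Lemma mvt_line (f : V -> R) x v (h : R) :
  (forall s : R, `|s| <= `|h| -> derivable f (x + s *: v) v) ->
  exists2 s : R, `|s| <= `|h| & f (x + h *: v) - f x = h * 'D_v f (x + s *: v).
Proof.
move=> df; have [s /norm_between sh|s /norm_between sh E] := @mvt_line_between f x v h.
  exact: df.
by exists s.
Qed.

End MeanValue.

Lemma small_littleo (K : numFieldType) (V W : normedModType K) (f g : V -> W) :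
  (forall e : K, 0 < e -> \forall h \near (0 : V), `|f h - g h| <= e * `|h|) ->
  f = g +o_ (0 : V) id.
Proof. by move=> fg; apply/eqaddoP => e e0; exact: fg. Qed.

Lemma small_sum (R : realFieldType) (a b p q s t n e : R) :
  `|a| <= n -> `|b| <= n -> `|p - q| < e / 2 -> `|s - t| < e / 2 ->
  `|a * q - a * p + (b * t - b * s)| <= e * n.
Proof.
move=> an bn; rewrite distrC [`|s - t|]distrC => /ltW pq /ltW st.
rewrite -!mulrBr (le_trans (ler_normD _ _))// !normrM (splitr e) mulrDl.
by apply: lerD; rewrite mulrC ler_pM.
Qed.

Section TotalDerivative.
Context {R : realType}.
Implicit Types (x y v w : plane R) (f : plane R -> R).

Lemma nbhs_plane x (P : set (plane R)) :
  nbhs x P <-> exists2 r : R, 0 < r & forall h, `|h| < r -> P (x + h).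
Proof.
split=> [/nbhs_ballP[r /= r0 rP]|[r r0 rP]].
  exists r => // h hr; apply: rP; rewrite -ball_normE/= opprD addNKr normrN//.
apply/nbhs_ballP; exists r => //= y; rewrite -ball_normE/= => yr.
by rewrite -(subrK x y) addrC; apply: rP; rewrite distrC.
Qed.

Section LinearForm.
Variables a b : R.
Definition linear_form (h : plane R) : R := h 0 0 * a + h 0 1 * b.

Fact linear_form_is_linear : linear linear_form.
Proof.
by move=> k u v; rewrite /linear_form !mxE /GRing.scale/=; ring.
Qed.
HB.instance Definition _ := GRing.isLinear.Build R (plane R) R _ linear_form
  linear_form_is_linear.

Lemma continuous_linear_form : continuous linear_form.
Proof.
move=> x; apply: differentiable_continuous.
by apply: differentiableD; apply: differentiableM => //; exact: differentiable_coord.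
Qed.
End LinearForm.

(** The increment is split at the corner [x1] of a staircase with one leg along each axis. The mean
    value theorem on each leg produces a partial derivative at a nearby point, and continuity of the
    partial derivatives at [x] bounds the error by [e * |h|]. *)
Lemma differentiable_C1 (U : set (plane R)) f x : open U -> U x ->
  (forall i y, U y -> derivable f y (coord_vec i)) ->
  (forall i, {for x, continuous ('D_(coord_vec i) f)}) ->
  differentiable f x /\
  forall v, 'D_v f x = v 0 0 * 'D_(coord_vec 0) f x + v 0 1 * 'D_(coord_vec 1) f x.
Proof.
move=> oU Ux df cf.
pose L := linear_form ('D_(coord_vec 0) f x) ('D_(coord_vec 1) f x).
have E : (f \o shift x : plane R -> R) = cst (f x) + (L : plane R -> R) +o_ (0 : plane R) id.
  apply: small_littleo => _/posnumP[e].
  have e20 : 0 < e%:num / 2 by [].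
  have /nbhs_plane[r0 r00 Ur] : nbhs x U by apply: open_nbhs_nbhs.
  have /cvgrPdist_lt/(_ _ e20)/nbhs_plane[r1 r10 d0] := cf 0.
  have /cvgrPdist_lt/(_ _ e20)/nbhs_plane[r2 r20 d1] := cf 1.
  pose r := Num.min r0 (Num.min r1 r2).
  have r_gt0 : 0 < r by rewrite !lt_min r00 r10 r20.
  apply/nbhs_plane; exists r => // h hr; rewrite add0r.
  rewrite /L /linear_form /=.
  pose x1 := x + h 0 1 *: coord_vec 1.
  have hE : h + x = x1 + h 0 0 *: coord_vec 0.
    by rewrite addrC {1}[h]plane_decomp [X in x + X]addrC addrA.
  have small1 s : `|s| <= `|h 0 1| -> `|s *: coord_vec 1 : plane R| < r.
    move=> sh; apply: le_lt_trans hr; rewrite normrZ.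
    apply: (le_trans (ler_wpM2l _ (norm_coord_vec 1))) => //.
    by rewrite mulr1 (le_trans sh)// le_coord_norm.
  have small0 s : `|s| <= `|h 0 0| -> `|h 0 1 *: coord_vec 1 + s *: coord_vec 0 : plane R| < r.
    move=> sh; apply: le_lt_trans hr; apply: norm_plane_le => //; rewrite !mxE/=.
      by rewrite mulr0 mulr1 add0r (le_trans sh)// le_coord_norm.
    by rewrite mulr0 mulr1 addr0 le_coord_norm.
  have [|s1 s1h E1] := @mvt_line _ _ f x (coord_vec 1) (h 0 1).
    by move=> s /small1 sr; apply/df/Ur/(lt_le_trans sr); rewrite ge_min lexx.
  have [|s0 s0h E0] := @mvt_line _ _ f x1 (coord_vec 0) (h 0 0).
    move=> s /small0 sr; apply: df; rewrite /x1 -addrA; apply: Ur.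
    by apply: (lt_le_trans sr); rewrite ge_min lexx.
  have {}d1 : `|'D_(coord_vec 1) f x - 'D_(coord_vec 1) f (x + s1 *: coord_vec 1)| < e%:num / 2.
    by apply/d1/(lt_le_trans (small1 _ s1h)); rewrite !ge_min lexx !orbT.
  have {}d0 : `|'D_(coord_vec 0) f x - 'D_(coord_vec 0) f (x1 + s0 *: coord_vec 0)| < e%:num / 2.
    by rewrite /x1 -addrA; apply/d0/(lt_le_trans (small0 _ s0h)); rewrite !ge_min lexx !orbT.
  rewrite hE addrfctE /cst /= (_ : _ - _ =
    f (x1 + h 0 0 *: coord_vec 0) - f x1 - h 0 0 * 'D_(coord_vec 0) f x +
    (f (x + h 0 1 *: coord_vec 1) - f x - h 0 1 * 'D_(coord_vec 1) f x)); last first.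
    by rewrite -/x1; move: (f _) (f _) (f x) => ? ? ?; ring.
  rewrite E0 E1; apply: small_sum d0 d1; exact: le_coord_norm.
have dE : 'd f x = L :> (plane R -> R) by apply: diff_unique => //; exact: continuous_linear_form.
have dif : differentiable f x.
  by apply/diff_locallyP; rewrite dE; split => //; exact: continuous_linear_form.
by split => // v; rewrite deriveE// dE.
Qed.

End TotalDerivative.

Notation pd i f := ('D_(coord_vec i) f).

(** * The classes C^k and their closure properties *)

Section DifferentiabilityClasses.
Context {R : realType}.
Implicit Types (U W : set (plane R)) (x : plane R) (n : nat) (i : 'I_2).

Section NormedTarget.
Context {V : normedModType R}.
Implicit Types f g : plane R -> V.

Lemma Ck_on_sub n U W f : W `<=` U -> Ck_on n U f -> Ck_on n W f.
Proof.
elim: n f => [|n IH] f WU [cf df]; split=> //; first by move=> x /WU /cf.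
  by move=> x /WU /cf.
move=> i; have [df1 df2] := df i; split; last exact: IH.
by move=> x /WU /df1.
Qed.

Lemma eq_on_near U f g x : open U -> (forall y, U y -> f y = g y) -> U x ->
  \near x, f x = g x.
Proof.
by move=> oU fg Ux; have : \near x, U x by [exact: open_nbhs_nbhs]; apply: filterS.
Qed.

Lemma eq_on_derivable U f g v x : open U -> (forall y, U y -> f y = g y) -> U x ->
  derivable f x v -> derivable g x v.
Proof. by move=> oU fg Ux; exact: near_eq_derivable (eq_on_near oU fg Ux). Qed.

Lemma eq_on_derive U f g v x : open U -> (forall y, U y -> f y = g y) -> U x ->
  'D_v f x = 'D_v g x.
Proof. by move=> oU fg Ux; exact: near_eq_derive (eq_on_near oU fg Ux). Qed.

Lemma eq_on_continuous U f g x : open U -> (forall y, U y -> f y = g y) -> U x ->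
  {for x, continuous f} -> {for x, continuous g}.
Proof.
move=> oU fg Ux cf; rewrite /prop_for /continuous_at -(fg _ Ux).
by exact: (cvg_trans (near_eq_cvg (eq_on_near oU fg Ux)) cf).
Qed.

Lemma eq_Ck_on n U f g : open U -> (forall y, U y -> f y = g y) ->
  Ck_on n U f -> Ck_on n U g.
Proof.
move=> oU; elim: n f g => [|n IH] f g fg [cf df]; split=> //.
- by move=> x Ux; apply: (eq_on_continuous oU fg Ux); exact: cf.
- by move=> x Ux; apply: (eq_on_continuous oU fg Ux); exact: cf.
move=> i; have [df1 df2] := df i; split.
  by move=> x Ux; apply: (eq_on_derivable oU fg Ux); exact: df1.
by apply: IH df2 => x Ux; exact: eq_on_derive fg Ux.
Qed.

(** The way the closure properties climb one order: the candidates [F] need to be the partial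
    derivatives on [U] only, whereas [Ck_on] speaks of the total functions [pd i f], whose values
    off [U] are arbitrary. *)
Lemma Ck_onS n U f (F : 'I_2 -> plane R -> V) : open U ->
  (forall x, U x -> {for x, continuous f}) ->
  (forall i x, U x -> is_derive x (coord_vec i) f (F i x)) ->
  (forall i, Ck_on n U (F i)) -> Ck_on n.+1 U f.
Proof.
move=> oU cf dF CF; split=> // i; split=> [x Ux|].
  by have [] := dF i x Ux.
by apply: eq_Ck_on (CF i) => // x Ux; have [_ ->] := dF i x Ux.
Qed.

Lemma Ck_onW n U f : Ck_on n.+1 U f -> Ck_on n U f.
Proof.
elim: n f => [|n IH] f [cf df]; split=> // i; have [df1 df2] := df i.
by split=> //; exact: IH.
Qed.

Lemma Ck_on_le n m U f : (n <= m)%N -> Ck_on m U f -> Ck_on n U f.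
Proof.
elim: m => [|m IH]; first by rewrite leqn0 => /eqP ->.
by rewrite leq_eqVlt ltnS => /orP[/eqP ->//|nm /Ck_onW]; exact: IH.
Qed.

Lemma smooth_on_sub U W f : W `<=` U -> smooth_on U f -> smooth_on W f.
Proof. by move=> WU sf n; exact: Ck_on_sub (sf n). Qed.

Lemma eq_smooth_on U f g : open U -> (forall y, U y -> f y = g y) ->
  smooth_on U f -> smooth_on U g.
Proof. by move=> oU fg sf n; exact: eq_Ck_on fg (sf n). Qed.

Lemma smooth_on_pd U f i : smooth_on U f -> smooth_on U (pd i f).
Proof. by move=> sf n; have [_ /(_ i)[]] := sf n.+1. Qed.

Lemma smooth_on_derivable U f i x : smooth_on U f -> U x ->
  derivable f x (coord_vec i).
Proof. by move=> sf; have [_ /(_ i)[+ _]] := sf 1; exact. Qed.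

Lemma smooth_on_continuous U f x : smooth_on U f -> U x -> {for x, continuous f}.
Proof. by move=> sf; have [+ _] := sf 0; exact. Qed.

End NormedTarget.

Section Scalar.
Implicit Types f g : plane R -> R.

Lemma Ck_on_differentiable n U f x : open U -> Ck_on n.+1 U f -> U x ->
  differentiable f x.
Proof.
move=> oU Cf Ux; have [_ df] := Ck_on_le (ltn0Sn n) Cf.
apply: (differentiable_C1 oU Ux _ _).1 => i; first by have [] := df i.
by have [_ [+ _]] := df i; exact.
Qed.

Lemma Ck_on_deriveE n U f v x : open U -> Ck_on n.+1 U f -> U x ->
  'D_v f x = v 0 0 * pd 0 f x + v 0 1 * pd 1 f x.
Proof.
move=> oU Cf Ux; have [_ df] := Ck_on_le (ltn0Sn n) Cf.
apply: (differentiable_C1 oU Ux _ _).2 => i; first by have [] := df i.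
by have [_ [+ _]] := df i; exact.
Qed.

Lemma Ck_on_is_derive n U f i x : Ck_on n.+1 U f -> U x ->
  is_derive x (coord_vec i) f (pd i f x).
Proof. by move=> [_ /(_ i)[df _]] Ux; apply: derivableP; exact: df. Qed.

Lemma Ck_onD n U f g : open U -> Ck_on n U f -> Ck_on n U g ->
  Ck_on n U (fun x => f x + g x).
Proof.
move=> oU; elim: n f g => [|n IH] f g Cf Cg.
  by split=> // x Ux; exact: continuousD (Cf.1 x Ux) (Cg.1 x Ux).
apply: (Ck_onS (F := fun i x => pd i f x + pd i g x)) => //.
- by move=> x Ux; exact: continuousD (Cf.1 x Ux) (Cg.1 x Ux).
- by move=> i x Ux; apply: is_deriveD; [exact: Ck_on_is_derive Cf Ux|exact: Ck_on_is_derive Cg Ux].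
- by move=> i; apply: IH; [have [] := Cf.2 i|have [] := Cg.2 i].
Qed.

Lemma Ck_onM n U f g : open U -> Ck_on n U f -> Ck_on n U g ->
  Ck_on n U (fun x => f x * g x).
Proof.
move=> oU; elim: n f g => [|n IH] f g Cf Cg.
  by split=> // x Ux; exact: continuousM (Cf.1 x Ux) (Cg.1 x Ux).
apply: (Ck_onS (F := fun i x => f x *: pd i g x + g x *: pd i f x)) => //.
- by move=> x Ux; exact: continuousM (Cf.1 x Ux) (Cg.1 x Ux).
- by move=> i x Ux; apply: is_deriveM; [exact: Ck_on_is_derive Cf Ux|exact: Ck_on_is_derive Cg Ux].
- move=> i; apply: Ck_onD => //; apply: IH.
  + exact: Ck_onW.
  + by have [] := Cg.2 i.
  + exact: Ck_onW.
  + by have [] := Cf.2 i.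
Qed.

Lemma Ck_onZ n U (c : R) f : open U -> Ck_on n U f -> Ck_on n U (fun x => c * f x).
Proof. by move=> oU; apply: Ck_onM => //; exact: smooth_cst. Qed.

Lemma Ck_onN n U f : open U -> Ck_on n U f -> Ck_on n U (fun x => - f x).
Proof.
move=> oU Cf; rewrite (_ : (fun _ => _) = fun x => -1 * f x); first exact: Ck_onZ.
by apply/funext => x; rewrite mulN1r.
Qed.

Lemma Ck_onB n U f g : open U -> Ck_on n U f -> Ck_on n U g ->
  Ck_on n U (fun x => f x - g x).
Proof. by move=> oU Cf Cg; apply: Ck_onD => //; exact: Ck_onN. Qed.

(** Restriction to the line [x + s *: v] reduces this to the chain rule in one variable, so [f] has
    to be derivable only along [v]. *)
Lemma is_derive_scalar_comp (V : normedModType R) (h : R -> R) (f : V -> R) (x v : V) (dh df : R) :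
  is_derive (f x) 1 h dh -> is_derive x v f df ->
  is_derive x v (fun y => h (f y)) (dh * df).
Proof.
move=> Hh Hf.
have H := is_derive_line (f := f) (x := x) (v := v) (s := 0).
rewrite scale0r addr0 in H; have {}H := H (@ex_derive _ _ _ _ _ _ _ Hf).
rewrite (@derive_val _ _ _ _ _ _ _ Hf) in H.
have Hh' : is_derive (f (x + 0 *: v)) (1 : R) h dh by rewrite scale0r addr0.
have H2 := @is_derive1_comp _ h (fun s : R => f (x + s *: v)) 0 dh df Hh' H.
have E : (fun t : R => t^-1 *: ((h \o (fun s : R => f (x + s *: v))) (t *: 1 + 0) -
     (h \o (fun s : R => f (x + s *: v))) 0)) =
     (fun t : R => t^-1 *: (((fun y => h (f y)) \o shift x) (t *: v) - h (f x))).
  apply/funext => t; rewrite /= scale0r !addr0 [t *: 1]mulr1.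
  by rewrite [x + _]addrC.
by have [d1 d2] := H2; split; [rewrite /derivable -E|rewrite /derive -E].
Qed.

Lemma Ck_onV n U f : open U -> (forall x, U x -> f x != 0) -> Ck_on n U f ->
  Ck_on n U (fun x => (f x)^-1).
Proof.
move=> oU f0; elim: n f f0 => [|n IH] f f0 Cf.
  by split=> // x Ux; exact: continuousV (f0 x Ux) (Cf.1 x Ux).
apply: (Ck_onS (F := fun i x => - ((f x)^-1 * (f x)^-1) * pd i f x)) => //.
- by move=> x Ux; exact: continuousV (f0 x Ux) (Cf.1 x Ux).
- move=> i x Ux.
  have [d df] := Ck_on_is_derive i Cf Ux; split; first exact: derivableV (f0 x Ux) d.
  by rewrite (deriveV (f0 x Ux) d) -exprVn expr2.
- move=> i; apply: Ck_onM => //; last by have [] := Cf.2 i.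
  by apply: Ck_onN => //; apply: Ck_onM => //; apply: IH => //; exact: Ck_onW.
Qed.

Lemma Ck_on_expR n U f : open U -> Ck_on n U f -> Ck_on n U (fun x => expR (f x)).
Proof.
have c y (Cf : {for y, continuous f}) : {for y, continuous (fun x => expR (f x))}.
  by apply: (@continuous_comp _ _ _ f (@expR R) _ Cf); exact: continuous_expR.
move=> oU; elim: n => [|n IH] Cf; first by split=> // x Ux; exact: c (Cf.1 x Ux).
apply: (Ck_onS (F := fun i x => expR (f x) * pd i f x)) => //.
- by move=> x Ux; exact: c (Cf.1 x Ux).
- by move=> i x Ux; apply: is_derive_scalar_comp; exact: Ck_on_is_derive Cf Ux.
- by move=> i; apply: Ck_onM => //; [apply: IH; exact: Ck_onW|have [] := Cf.2 i].
Qed.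

Lemma Ck_on_ln n U f : open U -> (forall x, U x -> 0 < f x) -> Ck_on n U f ->
  Ck_on n U (fun x => ln (f x)).
Proof.
move=> oU f0 Cf.
have c x : U x -> {for x, continuous (fun x => ln (f x))}.
  have {}Cf := Ck_on_le (leq0n n) Cf.
  move=> Ux; apply: (@continuous_comp _ _ _ f (@ln R) _ (Cf.1 x Ux)).
  exact/continuous_ln/f0.
case: n Cf => [|n] Cf; first by split.
apply: (Ck_onS (F := fun i x => (f x)^-1 * pd i f x)) => //.
- move=> i x Ux; apply: is_derive_scalar_comp; last exact: Ck_on_is_derive Cf Ux.
  exact/is_derive1_ln/f0.
- move=> i; apply: Ck_onM => //; last by have [] := Cf.2 i.
  by apply: Ck_onV (Ck_onW Cf) => // x Ux; rewrite gt_eqF// f0.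
Qed.

End Scalar.
End DifferentiabilityClasses.

Section ChainRule.
Context {R : realType}.

(** Only the outer map is differentiated totally: [h] is restricted to a line, which gives a
    differentiable curve [c], and the chain rule is applied to [g \o c] at 0. *)
Lemma is_derive_comp_diff (V W Z : normedModType R) (g : W -> Z) (h : V -> W) (x v : V) :
  differentiable g (h x) -> derivable h x v ->
  is_derive x v (fun y => g (h y)) ('D_('D_v h x) g (h x)).
Proof.
move=> dg dh; pose c (s : R) := h (x + s *: v).
have c0 : c 0 = h x by rewrite /c scale0r addr0.
have dc : is_derive (0 : R) (1 : R) c ('D_v h x).
  have := @is_derive_line _ _ _ h x v 0; rewrite scale0r addr0; exact.
have dfc : differentiable c (0 : R) by apply/derivable1_diffP; case: dc.
have dfgc : differentiable (g \o c) (0 : R) by apply: differentiable_comp; rewrite ?c0.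
have E : (fun t : R => t^-1 *: ((g \o c) (t *: 1 + 0) - (g \o c) 0)) =
     (fun t : R => t^-1 *: (((fun y => g (h y)) \o shift x) (t *: v) - g (h x))).
  apply/funext => t; rewrite /= c0 addr0 /c [t *: 1]mulr1.
  by rewrite [x + _]addrC.
have d1 : derivable (g \o c) (0 : R) 1 by exact/derivable1_diffP.
have d2 : 'D_1 (g \o c) (0 : R) = 'D_('D_v h x) g (h x).
  rewrite deriveE// diff_comp//=; last by rewrite c0.
  have dcE : 'd c (0 : R) 1 = 'D_v h x by rewrite -deriveE//; case: dc.
  by rewrite dcE c0 (deriveE _ dg).
by split; [rewrite /derivable -E|rewrite /derive -E].
Qed.

End ChainRule.

Section PlaneValued.
Context {R : realType}.
Implicit Types (U W : set (plane R)) (x y v : plane R) (F H : plane R -> plane R)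
  (f g : plane R -> R) (n : nat) (i k : 'I_2).

Lemma continuous_coordP F x :
  {for x, continuous F} <-> forall k, {for x, continuous (fun y => F y 0 k)}.
Proof.
split=> [cF k|cF].
  exact: (@continuous_comp _ _ _ F (fun y : plane R => y 0 k) x cF (@coord_continuous _ _ _ 0 k _)).
apply: (@cvgrPdist_lt _ _ _ (nbhs x) _ F (F x)).2 => e e0.
have e20 : 0 < e / 2 by rewrite divr_gt0.
have /cvgrPdist_lt/(_ _ e20)/nbhs_plane[r0 r00 h0] := cF 0.
have /cvgrPdist_lt/(_ _ e20)/nbhs_plane[r1 r10 h1] := cF 1.
apply/nbhs_plane; exists (Num.min r0 r1); first by rewrite lt_min r00.
move=> h; rewrite lt_min => /andP[hr0 hr1].
apply: (@le_lt_trans _ _ (e / 2)); last by rewrite ltr_pdivrMr// mulr_natr mulr2n ltrDl.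
apply: norm_plane_le; first exact: ltW.
- by rewrite !mxE ltW//; exact: h0.
- by rewrite !mxE ltW//; exact: h1.
Qed.

Lemma derivable_coordP F x v :
  derivable F x v <-> forall k, derivable (fun y => F y 0 k) x v.
Proof.
split=> [/derivable_mxP d k|d]; first exact: d.
by apply/derivable_mxP => i j; rewrite ord1.
Qed.

Lemma derive_coord F x v k : derivable F x v ->
  ('D_v F x) 0 k = 'D_v (fun y => F y 0 k) x.
Proof. by move=> d; rewrite derive_mx// mxE. Qed.

Lemma Ck_on_coordP n U F : open U ->
  Ck_on n U F <-> forall k, Ck_on n U (fun x => F x 0 k).
Proof.
move=> oU; elim: n F => [|n IH] F.
  split=> [CF k|CF]; split=> // x Ux; first exact: ((continuous_coordP F x).1 (CF.1 x Ux) k).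
  by apply/continuous_coordP => k; exact: (CF k).1 x Ux.
split=> [CF k|CF].
  apply: (Ck_onS (F := fun i x => (pd i F x) 0 k)) => //.
  - by move=> x Ux; exact: ((continuous_coordP F x).1 (CF.1 x Ux) k).
  - move=> i x Ux; have d := (CF.2 i).1 x Ux.
    by split; [exact: ((derivable_coordP F x _).1 d k)|rewrite derive_coord].
  - by move=> i; apply: ((IH _).1 _ k); exact: (CF.2 i).2.
split.
  by move=> x Ux; apply/continuous_coordP => k; exact: (CF k).1 x Ux.
move=> i; have d x : U x -> derivable F x (coord_vec i).
  by move=> Ux; apply/derivable_coordP => k; exact: ((CF k).2 i).1.
split=> //; apply/IH => k.
apply: (eq_Ck_on (f := pd i (fun x => F x 0 k))) => //; last exact: ((CF k).2 i).2.
by move=> x Ux; rewrite derive_coord//; exact: d.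
Qed.

Lemma smooth_on_coordP U F : open U ->
  smooth_on U F <-> forall k, smooth_on U (fun x => F x 0 k).
Proof.
move=> oU; split=> [sF k n|sF n]; first by move: k; apply/Ck_on_coordP.
by apply/Ck_on_coordP => // k; exact: sF.
Qed.

Lemma Ck_on_is_derive_comp n U W g H i x : open U -> open W ->
  Ck_on n.+1 W g -> Ck_on n.+1 U H -> (forall y, U y -> W (H y)) -> U x ->
  is_derive x (coord_vec i) (fun y => g (H y))
    (pd i (fun y => H y 0 0) x * pd 0 g (H x) + pd i (fun y => H y 0 1) x * pd 1 g (H x)).
Proof.
move=> oU oW Cg CH HUW Ux; have dH := (CH.2 i).1 x Ux.
rewrite -!derive_coord// -(Ck_on_deriveE _ oW Cg (HUW x Ux)).
exact: is_derive_comp_diff (Ck_on_differentiable oW Cg (HUW x Ux)) dH.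
Qed.

Lemma continuous_on_comp (V : normedModType R) U W (g : plane R -> V) H x :
  (forall y, W y -> {for y, continuous g}) -> {for x, continuous H} -> W (H x) ->
  {for x, continuous (fun y => g (H y))}.
Proof. by move=> cg cH WHx; exact: (@continuous_comp _ _ _ H g x cH (cg _ WHx)). Qed.

Lemma Ck_on_comp n U W g H : open U -> open W ->
  Ck_on n W g -> Ck_on n U H -> (forall y, U y -> W (H y)) ->
  Ck_on n U (fun y => g (H y)).
Proof.
move=> oU oW; elim: n g => [|n IH] g Cg CH HUW.
  by split=> // x Ux; exact: continuous_on_comp Cg.1 (CH.1 x Ux) (HUW x Ux).
apply: (Ck_onS (F := fun i x => pd i (fun y => H y 0 0) x * pd 0 g (H x) +
    pd i (fun y => H y 0 1) x * pd 1 g (H x))) => //.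
- by move=> x Ux; exact: continuous_on_comp Cg.1 (CH.1 x Ux) (HUW x Ux).
- by move=> i x Ux; exact: (Ck_on_is_derive_comp i oU oW Cg CH HUW Ux).
- have C1 k i : Ck_on n U (pd i (fun y => H y 0 k)).
    have := (Ck_on_coordP n.+1 H oU).1 CH k; by case=> _ /(_ i)[].
  have IHg k : Ck_on n U (fun y => pd k g (H y)).
    by apply: (IH (pd k g)) => //; [exact: (Cg.2 k).2|exact: Ck_onW].
  by move=> i; exact: Ck_onD oU (Ck_onM oU (C1 0 i) (IHg 0)) (Ck_onM oU (C1 1 i) (IHg 1)).
Qed.

Lemma smooth_on_comp U W g H : open U -> open W ->
  smooth_on W g -> smooth_on U H -> (forall y, U y -> W (H y)) ->
  smooth_on U (fun y => g (H y)).
Proof. by move=> oU oW sg sH HUW n; exact: Ck_on_comp (sg n) (sH n) HUW. Qed.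

Lemma smooth_on_comp_plane U W F H : open U -> open W ->
  smooth_on W F -> smooth_on U H -> (forall y, U y -> W (H y)) ->
  smooth_on U (fun y => F (H y)).
Proof.
move=> oU oW sF sH HUW; apply/smooth_on_coordP => // k.
have sFk := (smooth_on_coordP F oW).1 sF k.
exact: (smooth_on_comp oU oW sFk sH HUW).
Qed.

End PlaneValued.

Section Schwarz.
Context {R : realType}.
Implicit Types (U : set (plane R)) (x : plane R) (f : plane R -> R) (i j : 'I_2).

(** The mean value theorem is used twice: on [y |-> f (y + h e_j) - f y] along e_i, then on [pd i f]
    along e_j. *)
Lemma second_difference U f x i j (r h : R) : Ck_on 2 U f ->
  (forall y : plane R, `|y| < r -> U (x + y)) -> `|h| + `|h| < r ->
  exists s t : R, [/\ `|s| <= `|h|, `|t| <= `|h| &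
   (f (x + h *: coord_vec i + h *: coord_vec j) - f (x + h *: coord_vec i)) -
   (f (x + h *: coord_vec j) - f x) =
   h * (h * pd j (pd i f) (x + s *: coord_vec i + t *: coord_vec j))].
Proof.
move=> Cf Ur hr.
have Us (s t : R) : `|s| <= `|h| -> `|t| <= `|h| ->
    U (x + s *: coord_vec i + t *: coord_vec j).
  move=> sh th; rewrite -addrA; apply/Ur/(le_lt_trans _ hr).
  rewrite (le_trans (ler_normD _ _))// !normrZ lerD//.
  - by rewrite (le_trans _ sh)// ler_piMr// norm_coord_vec.
  - by rewrite (le_trans _ th)// ler_piMr// norm_coord_vec.
have h0 : `|0 : R| <= `|h| by rewrite normr0.
have Us0 (s : R) : `|s| <= `|h| -> U (x + s *: coord_vec i).
  by move=> sh; have := Us s 0 sh h0; rewrite scale0r addr0.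
pose e : plane R := h *: coord_vec j.
have shiftE (y : plane R) : derivable f (y + e) (coord_vec i) ->
    is_derive y (coord_vec i) (fun z => f (z + e)) (pd i f (y + e)).
  have E : (fun t : R => t^-1 *: (((fun z => f (z + e)) \o shift y) (t *: coord_vec i) - f (y + e))) =
           (fun t : R => t^-1 *: ((f \o shift (y + e)) (t *: coord_vec i) - f (y + e))).
    by apply/funext => t /=; rewrite addrA.
  by move=> d; split; rewrite ?/derivable ?/derive E.
have dF (s : R) : `|s| <= `|h| -> is_derive (x + s *: coord_vec i) (coord_vec i)
    (fun y => f (y + e) - f y) (pd i f (x + s *: coord_vec i + e) - pd i f (x + s *: coord_vec i)).
  move=> sh; apply: is_deriveB.
    by apply: shiftE; apply: (Cf.2 i).1; exact: Us.
  by apply: derivableP; apply: (Cf.2 i).1; exact: Us0.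
have [|s sh E1] := @mvt_line _ _ (fun y => f (y + e) - f y) x (coord_vec i) h.
  by move=> s /dF[].
have [|t th E2] := @mvt_line _ _ (pd i f) (x + s *: coord_vec i) (coord_vec j) h.
  by move=> t th; apply: ((Cf.2 i).2.2 j).1; exact: Us.
exists s, t; split=> //; rewrite -E2 -[in RHS]/e.
by have [_ <-] := dF s sh; rewrite -E1.
Qed.

Lemma sub_sub_swap (a b c d : R) : a - b - (c - d) = a - c - (b - d).
Proof. by ring. Qed.

Lemma third_add_third (r : R) : 0 < r -> r / 3 + r / 3 < r.
Proof. by lra. Qed.

Lemma dist_close (p q a b e : R) :
  a = b -> `|p - a| < e / 2 -> `|q - b| < e / 2 -> `|p - q| <= e.
Proof. by move=> <-; have := ler_distD a p q; rewrite [`|a - q|]distrC; lra. Qed.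

(** The second difference is symmetric in the two directions, so the two mixed derivatives take a
    common value at two points near [x]. Continuity at [x] brings them within any [e] of each
    other. *)
Lemma schwarz U f x : open U -> Ck_on 2 U f -> U x ->
  pd 0 (pd 1 f) x = pd 1 (pd 0 f) x.
Proof.
move=> oU Cf Ux; apply/eqP; rewrite -subr_eq0 -normr_le0; apply/ler_addgt0Pr => e e0.
rewrite add0r.
have e20 : 0 < e / 2 by rewrite divr_gt0.
have /nbhs_plane[r0 r00 Ur] : nbhs x U by exact: open_nbhs_nbhs.
have c01 : {for x, continuous (pd 0 (pd 1 f))} by exact: ((Cf.2 1).2.2 0).2.1.
have c10 : {for x, continuous (pd 1 (pd 0 f))} by exact: ((Cf.2 0).2.2 1).2.1.
have /cvgrPdist_lt/(_ _ e20)/nbhs_plane[r1 r10 d01] := c01.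
have /cvgrPdist_lt/(_ _ e20)/nbhs_plane[r2 r20 d10] := c10.
pose r := Num.min r0 (Num.min r1 r2).
have r_gt0 : 0 < r by rewrite !lt_min r00 r10 r20.
(* Two steps of length [h] still fit strictly inside the radius [r]. *)
pose h := r / 3.
have h0 : 0 < h by rewrite divr_gt0.
have nh : `|h| = h by rewrite gtr0_norm.
have hhr : h + h < r by exact: third_add_third.
have [r_r0 r_r1 r_r2] : [/\ r <= r0, r <= r1 & r <= r2].
  by rewrite !ge_min !lexx !orbT.
have hr0 : `|h| + `|h| < r0 by rewrite nh (lt_le_trans hhr).
have [s [t [sh th E]]] := second_difference 1 0 Cf Ur hr0.
have [s' [t' [sh' th' E']]] := second_difference 0 1 Cf Ur hr0.
have small (i j : 'I_2) (a b : R) : `|a| <= `|h| -> `|b| <= `|h| ->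
    `|a *: coord_vec i + b *: coord_vec j : plane R| < r.
  rewrite nh => ah bh; apply: le_lt_trans hhr.
  rewrite (le_trans (ler_normD _ _))// !normrZ lerD//.
  - by rewrite (le_trans _ ah)// ler_piMr// norm_coord_vec.
  - by rewrite (le_trans _ bh)// ler_piMr// norm_coord_vec.
have EE : pd 0 (pd 1 f) (x + s *: coord_vec 1 + t *: coord_vec 0) =
          pd 1 (pd 0 f) (x + s' *: coord_vec 0 + t' *: coord_vec 1).
  have hn0 : h != 0 by rewrite gt_eqF.
  have C : x + h *: coord_vec 1 + h *: coord_vec 0 = x + h *: coord_vec 0 + h *: coord_vec 1.
    by rewrite -!addrA [h *: coord_vec 1 + _]addrC.
  by move: E'; rewrite -C sub_sub_swap E => /(mulfI hn0)/(mulfI hn0).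
have d1 := d01 _ (lt_le_trans (small 1 0 s t sh th) r_r1).
have d2 := d10 _ (lt_le_trans (small 0 1 s' t' sh' th') r_r2).
rewrite !addrA in d1 d2.
exact: dist_close EE d1 d2.
Qed.

End Schwarz.

(** * One-variable integration and the Poincare lemma *)

Section OneVariable.
Context {R : realType}.

Lemma is_derive_of_line (V W : normedModType R) (f : V -> W) (x v : V) (d : W) :
  is_derive (0 : R) (1 : R) (fun s : R => f (x + s *: v)) d -> is_derive x v f d.
Proof.
have E : (fun h : R => h^-1 *: (f (x + (h *: 1 + 0 : R) *: v) - f (x + (0 : R) *: v))) =
  (fun h => h^-1 *: ((f \o shift x) (h *: v) - f x)).
  apply/funext => h; rewrite scale0r !addr0 [h *: 1]mulr1 /=.
  by rewrite [x + _]addrC.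
by case=> d1 d2; split; [rewrite /derivable -E|rewrite /derive -E].
Qed.

Lemma is_derive_quadratic (f : R -> R) (C r : R) : 0 < r ->
  (forall h, `|h| < r -> `|f h| <= C * (h * h)) -> is_derive (0 : R) (1 : R) f 0.
Proof.
move=> r0 fC.
have f0 : f 0 = 0.
  by apply/eqP; rewrite -normr_le0 (le_trans (fC _ _)) ?normr0 ?mulr0.
have C0 : 0 <= C.
  have h2 : 0 < r / 2 by rewrite divr_gt0.
  have := fC (r / 2); rewrite gtr0_norm// ltr_pdivrMr// ltr_pMr// ltr1n => /(_ isT).
  by move=> /(le_trans (normr_ge0 _)); rewrite pmulr_lge0// mulr_gt0.
have lim : h^-1 *: (f (h *: 1 + 0) - f 0) @[h --> (0 : R)^'] --> (0 : R).
  apply/cvgrPdist_le => e e0.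
  near=> h; rewrite f0 subr0 addr0 [h *: 1]mulr1 sub0r normrN normrZ normfV.
  have h0 : h != 0 by near: h; exact: nbhs_dnbhs_neq.
  have hp : 0 < `|h| by rewrite normr_gt0.
  rewrite ler_pdivrMl// (le_trans (fC _ _))//.
    by near: h; exact: dnbhs0_lt.
  rewrite -expr2 -real_normK ?num_real// expr2 mulrA mulrC ler_pM2l//.
  have hC : `|h| <= e / (C + 1).
    by near: h; apply: dnbhs0_le; rewrite divr_gt0// ltr_wpDl.
  rewrite (le_trans (ler_wpM2l C0 hC))// mulrA ler_pdivrMr ?ltr_wpDl//.
  by rewrite mulrC ler_pM2l// lerDl.
by split; [apply/cvg_ex; exists 0|apply/cvg_lim].
Unshelve. all: by end_near. Qed.

Lemma antiderivative (h : R -> R) (r : R) : 0 < r ->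
  (forall s, `|s| <= r -> {for s, continuous h}) ->
  exists H : R -> R, H 0 = 0 /\ forall s, `|s| < r -> is_derive s (1 : R) H (h s).
Proof.
move=> r0 ch.
(* The integral starts at [- r] rather than at 0, so that one application of the fundamental theorem
   covers both signs of [s]; the value at 0 is subtracted at the end. *)
pose F (x : R) : R := (\int[lebesgue_measure]_(t in `[- r, x]) h t)%R.
have dF s : `|s| < r -> is_derive s (1 : R) F (h s).
  rewrite ltr_norml => /andP[rs sr].
  have [||d1 d2] := @continuous_FTC1_closed R h (- r) s r sr _ rs.
  - apply: continuous_compact_integrable; first exact: segment_compact.
    apply: continuous_in_subspaceT => t; rewrite inE/= in_itv/= => rt.
    by apply: ch; rewrite ler_norml.
  - by apply: ch; rewrite ler_norml !ltW.
  - by split; [exact: d1|move: d2; rewrite derive1E].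
exists (fun x => F x - F 0); split; first by rewrite subrr.
move=> s /dF [d1 d2]; rewrite -[h s]subr0.
exact: is_deriveB.
Qed.

Lemma is_derive_of_line_eq (V W : normedModType R) (f : V -> W) (g : R -> W) (x v : V) (d : W) :
  is_derive (0 : R) (1 : R) g d -> (forall s, f (x + s *: v) = g s) -> is_derive x v f d.
Proof.
move=> dg fg; have E : g = (fun s => f (x + s *: v)) by apply/funext => s; rewrite fg.
by rewrite E in dg; exact: is_derive_of_line dg.
Qed.

Lemma is_derive_mulr_cst (x k : R) : is_derive x (1 : R) (fun h => h * k) k.
Proof.
split; first exact: derivableM.
rewrite [LHS]deriveM// derive_id.
by have -> : 'D_1 (fun=> k) x = 0; [exact: derive_cst|rewrite scaler0 add0r [_ *: 1]mulr1].
Qed.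

Lemma is_derive_mulB (g : R -> R) (t d h c : R) :
  is_derive t (1 : R) g d -> is_derive t (1 : R) (fun s => h * (g s - c)) (h * d).
Proof.
move=> dg; have H := is_deriveZ h (is_deriveB dg (is_derive_cst c t (1 : R))).
by rewrite subr0 in H.
Qed.

Lemma is_derive_shift0 (g : R -> R) (t d : R) :
  is_derive t (1 : R) g d -> is_derive (0 : R) (1 : R) (fun h => g (t + h)) d.
Proof.
case=> d1 d2; have H := @is_derive_line _ _ _ g t 1 0.
rewrite scale0r addr0 in H; have := H d1; rewrite d2.
by congr is_derive; apply/funext => h; rewrite [h *: _]mulr1.
Qed.

Lemma mvt_bound (f df : R -> R) (r C t : R) :
  (forall s, `|s| < r -> is_derive s (1 : R) f (df s)) ->
  (forall s, `|s| < r -> `|df s| <= C) -> `|t| < r -> f 0 = 0 -> `|f t| <= C * r.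
Proof.
move=> dfE dfC tr f0.
have [|s st] := @mvt_line _ _ f (0 : R) 1 t.
  move=> s st; rewrite add0r [s *: 1]mulr1.
  by have [] := dfE s (le_lt_trans st tr).
rewrite !add0r f0 subr0 [t *: 1]mulr1 [s *: 1]mulr1 => ->.
have [_ ->] := dfE s (le_lt_trans st tr).
by rewrite normrM mulrC ler_pM// ?dfC ?(le_lt_trans st)// ltW.
Qed.

End OneVariable.

Section Poincare.
Context {R : realType}.

Lemma plane_shift_coord (z y : plane R) (s t : R) :
  y = z + s *: coord_vec 0 + t *: coord_vec 1 ->
  y 0 0 - z 0 0 = s /\ y 0 1 - z 0 1 = t.
Proof.
by move=> ->; rewrite !mxE/= !mulr1 !mulr0 !addr0 addrAC subrr add0r addrAC subrr add0r.
Qed.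

Lemma plane_shiftE (z y : plane R) :
  y = z + (y 0 0 - z 0 0) *: coord_vec 0 + (y 0 1 - z 0 1) *: coord_vec 1.
Proof. by apply: plane_eq; rewrite !mxE/= !mulr1 !mulr0 !addr0 addrC subrK. Qed.

Lemma norm_plane_coord (s t r : R) : `|s| < r -> `|t| < r ->
  `|s *: coord_vec 0 + t *: coord_vec 1 : plane R| < r.
Proof.
move=> sr tr; apply: (@le_lt_trans _ _ (Num.max `|s| `|t|)); last by rewrite gt_max sr.
apply: norm_plane_le; first by rewrite le_max normr_ge0.
- by rewrite !mxE/= mulr1 mulr0 addr0 le_max lexx.
- by rewrite !mxE/= mulr1 mulr0 add0r le_max lexx orbT.
Qed.

Lemma is_derive_smooth (W : set (plane R)) (f : plane R -> R) (P : 'I_2 -> plane R -> R) :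
  open W -> (forall i, smooth_on W (P i)) ->
  (forall i x, W x -> is_derive x (coord_vec i) f (P i x)) -> smooth_on W f.
Proof.
move=> oW sP df; have C n : Ck_on n.+1 W f.
  apply: (Ck_onS (F := P)) => // [x Wx|i]; last exact: sP.
  apply: differentiable_continuous; apply: (differentiable_C1 oW Wx _ _).1 => i.
    by move=> y Wy; case: (df i y Wy).
  apply: (@eq_on_continuous _ _ W (P i)) => //; last exact: smooth_on_continuous Wx.
  by move=> y Wy; case: (df i y Wy).
by move=> n; exact: Ck_onW.
Qed.

Lemma poincare_split (c a b b' k : R) :
  c + a + b = c + b' + a + k + (b - b' - k).
Proof. by ring. Qed.

Lemma norm_mul3_le (h k q K : R) : `|k| <= `|h| -> `|q| <= K ->
  `|h * (k * q)| <= K * (h * h).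
Proof.
move=> kh qK; rewrite mulrC -[h * h]expr2 -real_normK ?num_real// expr2 !normrM.
by rewrite mulrA ler_wpM2r// mulrC ler_pM.
Qed.

(** The potential is c + A(s) + B(s, t), where A integrates P_0 along the first axis and B
    integrates P_1 vertically above s. Its derivative in t is immediate. For the derivative in s,
    differentiation under the integral is replaced by an estimate: the error e(h, t) of the linear
    approximation vanishes at t = 0, and by closedness its t-derivative is the first-order Taylor
    remainder of P_1 in s, hence O(h^2) uniformly in t. *)
Lemma poincare (U : set (plane R)) (P : 'I_2 -> plane R -> R) (z : plane R) (c : R) :
  open U -> U z -> (forall i, smooth_on U (P i)) ->
  (forall x, U x -> pd 0 (P 1) x = pd 1 (P 0) x) ->
  exists (W : set (plane R)) (f : plane R -> R),
    [/\ open W, W z, W `<=` U, f z = c &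
        smooth_on W f /\ forall i x, W x -> is_derive x (coord_vec i) f (P i x)].
Proof.
move=> oU Uz sP closedP.
pose Q := pd 0 (pd 0 (P 1)).
(* By continuity [K] bounds [Q], the second derivative in the Taylor remainder, near [z]. *)
pose K := `|Q z| + 1.
have sQ : smooth_on U Q by do 2 apply: smooth_on_pd.
have /nbhs_plane[r1 r10 Ur1] : nbhs z U by exact: open_nbhs_nbhs.
have /cvgrPdist_lt/(_ _ ltr01)/nbhs_plane[r2 r20 Qr2] := smooth_on_continuous sQ Uz.
pose r := Num.min r1 r2 / 2.
have r_gt0 : 0 < r by rewrite divr_gt0// lt_min r10.
have r_lt (s : R) : `|s| <= r -> `|s| < r1 /\ `|s| < r2.
  move=> sr; have : `|s| < Num.min r1 r2.
    by rewrite (le_lt_trans sr)// /r ltr_pdivrMr// ltr_pMr ?ltr1n// lt_min r10.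
  by rewrite lt_min => /andP.
pose p (s t : R) : plane R := z + s *: coord_vec 0 + t *: coord_vec 1.
have pU (s t : R) : `|s| <= r -> `|t| <= r -> U (p s t).
  move=> /r_lt[s1 _] /r_lt[t1 _]; rewrite /p -addrA; apply: Ur1.
  exact: norm_plane_coord.
have pQ (s t : R) : `|s| <= r -> `|t| <= r -> `|Q (p s t)| <= K.
  move=> /r_lt[_ s1] /r_lt[_ t1]; have := Qr2 _ (norm_plane_coord s1 t1).
  rewrite addrA -/(p s t) /K => Qz.
  have := ler_normB (Q z) (Q z - Q (p s t)); rewrite opprB addrC subrK.
  by move/le_trans; apply; rewrite lerD2l ltW.
have p0 (s t h : R) : p s t + h *: coord_vec 0 = p (s + h) t.
  by rewrite /p scalerDl -!addrA; congr (_ + (_ + _)); rewrite addrC.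
have p1 (s t h : R) : p s t + h *: coord_vec 1 = p s (t + h).
  by rewrite /p scalerDl -!addrA.
have cP i (s t : R) : `|s| <= r -> `|t| <= r -> {for p s t, continuous (P i)}.
  by move=> sr tr; exact: (smooth_on_continuous (sP i) (pU _ _ sr tr)).
have line0 (f : plane R -> R) (s t : R) : smooth_on U f -> `|s| <= r -> `|t| <= r ->
    is_derive s (1 : R) (fun s => f (p s t)) (pd 0 f (p s t)).
  move=> sf sr tr; have E (s' : R) : p s' t = p 0 t + s' *: coord_vec 0 by rewrite p0 add0r.
  rewrite (_ : (fun _ => _) = (fun s' => f (p 0 t + s' *: coord_vec 0))); last first.
    by apply/funext => s'; rewrite -E.
  rewrite (E s); apply: is_derive_line; rewrite -E.
  exact: (smooth_on_derivable sf (pU _ _ sr tr)).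
have line1 (f : plane R -> R) (s t : R) : smooth_on U f -> `|s| <= r -> `|t| <= r ->
    is_derive t (1 : R) (fun t => f (p s t)) (pd 1 f (p s t)).
  move=> sf sr tr; have E (t' : R) : p s t' = p s 0 + t' *: coord_vec 1 by rewrite p1 add0r.
  rewrite (_ : (fun _ => _) = (fun t' => f (p s 0 + t' *: coord_vec 1))); last first.
    by apply/funext => t'; rewrite -E.
  rewrite (E t); apply: is_derive_line; rewrite -E.
  exact: (smooth_on_derivable sf (pU _ _ sr tr)).
have contR (f : R -> R) (s d : R) : is_derive s (1 : R) f d -> {for s, continuous f}.
  by case=> d1 _; exact/differentiable_continuous/derivable1_diffP.
have r0r : `|0 : R| <= r by rewrite normr0 ltW.
have [A [A0 dA]] : exists A : R -> R, A 0 = 0 /\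
    forall s, `|s| < r -> is_derive s (1 : R) A (P 0 (p s 0)).
  apply: antiderivative => // s sr; exact: contR (line0 _ _ _ (sP 0) sr r0r).
(* One antiderivative in t for each s, selected by choice; when [|s| >= r] the function is a
   dummy. *)
have /choice[B dB] : forall s : R, exists B : R -> R, `|s| < r -> B 0 = 0 /\
    forall t, `|t| < r -> is_derive t (1 : R) B (P 1 (p s t)).
  move=> s; have [sr|] := boolP (`|s| < r); last by exists id.
  have [|B [B0 dB]] := @antiderivative R (fun t => P 1 (p s t)) r r_gt0.
    by move=> t tr; apply: contR (line1 _ _ _ (sP 1) (ltW sr) tr).
  by exists B.
pose F (s t : R) := c + A s + B s t.
pose f (x : plane R) := F (x 0 0 - z 0 0) (x 0 1 - z 0 1).
have fp (s t : R) : f (p s t) = F s t.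
  by rewrite /f; have [-> ->] := @plane_shift_coord z (p s t) s t erefl.
pose W : set (plane R) := ball z r.
have WE x : W x -> exists s t, [/\ `|s| < r, `|t| < r & x = p s t].
  rewrite /W -ball_normE /= distrC => xr; exists (x 0 0 - z 0 0), (x 0 1 - z 0 1).
  split; last exact: plane_shiftE.
    by apply: le_lt_trans xr; have := le_coord_norm (x - z) 0; rewrite !mxE.
  by apply: le_lt_trans xr; have := le_coord_norm (x - z) 1; rewrite !mxE.
have df1 (s t : R) : `|s| < r -> `|t| < r ->
    is_derive (p s t) (coord_vec 1) f (P 1 (p s t)).
  move=> sr tr; have [_ {}dB] := dB s sr.
  have H := is_deriveD (is_derive_cst (c + A s) (0 : R) (1 : R)) (is_derive_shift0 (dB t tr)).
  rewrite add0r in H; refine (is_derive_of_line_eq H _) => h.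
  by rewrite p1 fp.
have df0 (s t : R) : `|s| < r -> `|t| < r ->
    is_derive (p s t) (coord_vec 0) f (P 0 (p s t)).
  move=> sr tr; pose k := P 0 (p s t) - P 0 (p s 0).
  pose e (h t : R) := B (s + h) t - B s t - h * (P 0 (p s t) - P 0 (p s 0)).
  suff He : is_derive (0 : R) (1 : R) (e^~ t) 0.
    have Hk : is_derive (0 : R) (1 : R) (fun h => h * k) k by exact: is_derive_mulr_cst.
    have H := is_deriveD (is_deriveD (is_deriveD (is_derive_cst (c + B s t) (0 : R) (1 : R))
      (is_derive_shift0 (dA s sr))) Hk) He.
    have E : 0 + P 0 (p s 0) + k + 0 = P 0 (p s t) by rewrite add0r addr0 /k addrC subrK.
    rewrite E in H; refine (is_derive_of_line_eq H _) => h.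
    by rewrite p0 fp; exact: poincare_split.
  have {k} rs0 : 0 < r - `|s| by rewrite subr_gt0.
  apply: (@is_derive_quadratic _ _ (K * r) _ rs0) => h hrs.
  have shr (k : R) : `|k| <= `|h| -> `|s + k| < r.
    move=> kh; rewrite (le_lt_trans (ler_normD _ _))// -ltrBrDl.
    exact: le_lt_trans hrs.
  have {}shr1 : `|s + h| < r by exact: shr.
  have [Bs0 dBs] := dB s sr; have [Bh0 dBh] := dB _ shr1.
  have -> : K * r * (h * h) = K * (h * h) * r by rewrite mulrAC.
  apply: (@mvt_bound _ (e h) (fun t => P 1 (p (s + h) t) - P 1 (p s t) - h * pd 1 (P 0) (p s t))) tr _.
  - move=> t' tr'; apply: is_deriveB; first exact: is_deriveB (dBh _ tr') (dBs _ tr').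
    exact: (is_derive_mulB h _ (line1 _ _ _ (sP 0) (ltW sr) (ltW tr'))).
  (* Two mean value steps write the Taylor remainder as h k Q at an intermediate point, with
     [|k| <= |h|]. *)
  - move=> t' tr'; rewrite -closedP; last by apply: pU; exact: ltW.
    have [|k kh E1] := @mvt_line _ _ (P 1) (p s t') (coord_vec 0) h.
      move=> k kh; rewrite p0; apply: smooth_on_derivable (sP 1) _.
      by apply: pU; rewrite ltW// shr.
    have [|l lk E2] := @mvt_line _ _ (pd 0 (P 1)) (p s t') (coord_vec 0) k.
      move=> l lk; rewrite p0; apply: (@smooth_on_derivable _ _ U); first exact: smooth_on_pd.
      by apply: pU; rewrite ltW// shr// (le_trans lk).
    rewrite -[p (s + h) t']p0 E1 -mulrBr E2 -/Q p0; apply: norm_mul3_le => //.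
    by apply: pQ; rewrite ltW// shr// (le_trans lk).
  - by rewrite /e Bh0 Bs0 !subrr mulr0 subrr.
exists W, f; split.
- exact: ball_open.
- exact: ballxx.
- by move=> x /WE[s [t [sr tr ->]]]; apply: pU; exact: ltW.
- have := fp 0 0; rewrite /p !scale0r !addr0 => ->; rewrite /F A0.
  have n0 : `|0 : R| < r by rewrite normr0.
  by have [-> _] := dB 0 n0; rewrite !addr0.
have dfW i x : W x -> is_derive x (coord_vec i) f (P i x).
  move=> /WE[s [t [sr tr ->]]]; move: i; apply: forall_I2; [exact: df0|exact: df1].
split=> //; apply: is_derive_smooth dfW; first exact: ball_open.
move=> i; apply: smooth_on_sub (sP i) => x /WE[s [t [sr tr ->]]].
by apply: pU; exact: ltW.
Qed.

End Poincare.

(** * The inverse function theorem *)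

Section LinearMap.
Context {R : realType}.
Implicit Types (a b c d : R) (v w : plane R).

Definition mat2_apply a b c d v : plane R :=
  (a * v 0 0 + b * v 0 1) *: coord_vec 0 + (c * v 0 0 + d * v 0 1) *: coord_vec 1.

Lemma mat2_apply0 a b c d v : mat2_apply a b c d v 0 0 = a * v 0 0 + b * v 0 1.
Proof. by rewrite !mxE/= mulr1 mulr0 addr0. Qed.

Lemma mat2_apply1 a b c d v : mat2_apply a b c d v 0 1 = c * v 0 0 + d * v 0 1.
Proof. by rewrite !mxE/= mulr1 mulr0 add0r. Qed.

Lemma mat2_applyB a b c d v w :
  mat2_apply a b c d (v - w) = mat2_apply a b c d v - mat2_apply a b c d w.
Proof.
have mxB (u u' : plane R) i : (u - u') 0 i = u 0 i - u' 0 i by rewrite !mxE.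
by apply: plane_eq; rewrite mxB !(mat2_apply0, mat2_apply1) !mxB; ring.
Qed.

Lemma norm_mat2_apply a b c d v :
  `|mat2_apply a b c d v| <= (`|a| + `|b| + `|c| + `|d|) * `|v|.
Proof.
apply: norm_plane_le; first by rewrite mulr_ge0 ?addr_ge0.
- rewrite mat2_apply0 (le_trans (ler_normD _ _))// !normrM.
  have -> : (`|a| + `|b| + `|c| + `|d|) * `|v| = `|a| * `|v| + `|b| * `|v| + (`|c| + `|d|) * `|v| by ring.
  apply: ler_wpDr; first by rewrite mulr_ge0 ?addr_ge0.
  by rewrite lerD// ler_wpM2l// le_coord_norm.
- rewrite mat2_apply1 (le_trans (ler_normD _ _))// !normrM.
  have -> : (`|a| + `|b| + `|c| + `|d|) * `|v| = `|c| * `|v| + `|d| * `|v| + (`|a| + `|b|) * `|v| by ring.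
  apply: ler_wpDr; first by rewrite mulr_ge0 ?addr_ge0.
  by rewrite lerD// ler_wpM2l// le_coord_norm.
Qed.

Lemma mat2_apply_eq0 a b c d v : a * d - b * c != 0 -> mat2_apply a b c d v = 0 -> v = 0.
Proof.
move=> D0 E.
have E0 : a * v 0 0 + b * v 0 1 = 0 by rewrite -(mat2_apply0 a b c d) E mxE.
have E1 : c * v 0 0 + d * v 0 1 = 0 by rewrite -(mat2_apply1 a b c d) E mxE.
apply: plane_eq; rewrite mxE; apply: (mulfI D0); rewrite mulr0.
- have -> : (a * d - b * c) * v 0 0 = d * (a * v 0 0 + b * v 0 1) - b * (c * v 0 0 + d * v 0 1) by ring.
  by rewrite E0 E1 !mulr0 subrr.
- have -> : (a * d - b * c) * v 0 1 = a * (c * v 0 0 + d * v 0 1) - c * (a * v 0 0 + b * v 0 1) by ring.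
  by rewrite E0 E1 !mulr0 subrr.
Qed.

End LinearMap.

Section Lipschitz.
Context {R : realType}.

Lemma between_ball (z x y : plane R) (r s : R) (i : 'I_2) : ball z r x -> ball z r y ->
  (0 <= s <= y 0 i - x 0 i) || (y 0 i - x 0 i <= s <= 0) ->
  `|x 0 i + s - z 0 i| < r.
Proof.
rewrite -!ball_normE/= => xr yr.
have := le_lt_trans (le_coord_norm (z - x) i) xr.
have := le_lt_trans (le_coord_norm (z - y) i) yr.
rewrite !mxE; move: (z 0 i) (x 0 i) (y 0 i) => a b c; clear.
by rewrite !ltr_norml => /andP[h1 h2] /andP[h3 h4] /orP[]/andP[h5 h6]; apply/andP; split; lra.
Qed.

(** Balls of the sup norm are squares, so an axis-parallel staircase between two points of a ball
    never leaves it. *)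
Lemma ball_path (z x y : plane R) (r : R) : ball z r x -> ball z r y ->
  let m := x + (y 0 0 - x 0 0) *: coord_vec 0 in
  [/\ y = m + (y 0 1 - x 0 1) *: coord_vec 1,
     (forall s : R, (0 <= s <= y 0 0 - x 0 0) || (y 0 0 - x 0 0 <= s <= 0) ->
        ball z r (x + s *: coord_vec 0)) &
     (forall s : R, (0 <= s <= y 0 1 - x 0 1) || (y 0 1 - x 0 1 <= s <= 0) ->
        ball z r (m + s *: coord_vec 1))].
Proof.
move=> xr yr m.
have in_ball (w : plane R) : `|w 0 0 - z 0 0| < r -> `|w 0 1 - z 0 1| < r -> ball z r w.
  move=> h0 h1; rewrite -ball_normE /= distrC.
  rewrite {1}(plane_shiftE z w) -[z + _ + _]addrA [z + (_ + _)]addrC addrK.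
  exact: norm_plane_coord.
have crd (w : plane R) i : ball z r w -> `|w 0 i - z 0 i| < r.
  rewrite -ball_normE /= distrC => wr; apply: le_lt_trans wr.
  by have := le_coord_norm (w - z) i; rewrite !mxE.
split; first exact: plane_shiftE.
- move=> s sb; apply: in_ball; rewrite !mxE/= ?mulr1 ?mulr0 ?addr0; last exact: crd.
  exact: between_ball sb.
- move=> s sb; apply: in_ball; rewrite !mxE/= ?mulr1 ?mulr0 ?addr0.
    by rewrite addrCA subrr addr0; exact: crd.
  exact: between_ball sb.
Qed.

Lemma lipschitz_ball (f : plane R -> R) (z x y : plane R) (r C : R) :
  (forall i w, ball z r w -> derivable f w (coord_vec i)) ->
  (forall i w, ball z r w -> `|pd i f w| <= C) ->
  ball z r x -> ball z r y -> `|f y - f x| <= (C + C) * `|y - x|.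
Proof.
move=> df dC xr yr; have [] := ball_path xr yr; set m := x + _ => yE b0 b1.
have [s /b0 sb|s /b0 sb E0] := @mvt_line_between _ _ f x (coord_vec 0) (y 0 0 - x 0 0).
  exact: df.
have [t /b1 tb|t /b1 tb E1] := @mvt_line_between _ _ f m (coord_vec 1) (y 0 1 - x 0 1).
  exact: df.
rewrite -(subrK (f m) (f y)) -addrA {1}yE E1 E0 [leRHS]mulrDl (le_trans (ler_normD _ _))//.
have leyx i : `|y 0 i - x 0 i| <= `|y - x| by have := le_coord_norm (y - x) i; rewrite !mxE.
have dC0 := dC 0 _ sb; have dC1 := dC 1 _ tb.
by rewrite !normrM lerD// mulrC ler_pM.
Qed.

Lemma differentiable_near (f : plane R -> R) (x : plane R) (e : R) :
  differentiable f x -> 0 < e ->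
  exists2 r : R, 0 < r & forall h, `|h| < r -> `|f (x + h) - f x - 'D_h f x| <= e * `|h|.
Proof.
move=> df e0; have /diff_locallyP[_ /eqaddoP/(_ e e0)/nbhs_plane[r r0 H]] := df.
exists r => // h hr; have := H h hr.
by rewrite !addrfctE /= add0r [h + x]addrC deriveE// opprD addrA.
Qed.

End Lipschitz.

Section InverseFunction.
Context {R : realType}.
Implicit Types (U V W : set (plane R)) (F H : plane R -> plane R) (x y z : plane R).

Definition jac F x : R :=
  pd 0 (fun y => F y 0 0) x * pd 1 (fun y => F y 0 1) x -
  pd 1 (fun y => F y 0 0) x * pd 0 (fun y => F y 0 1) x.

Lemma near_norm_lt (f : plane R -> R) z (e : R) : {for z, continuous f} -> `|f z| < e ->
  nbhs z [set w | `|f w| < e].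
Proof.
move=> cf fe; have e0 : 0 < e - `|f z| by rewrite subr_gt0.
have /cvgrPdist_lt/(_ _ e0)/nbhs_plane[r r0 H] := cf.
apply/nbhs_plane; exists r => // h /H; rewrite distrC => fr /=.
by rewrite -(subrK (f z) (f (z + h))) (le_lt_trans (ler_normD _ _))// -ltrBrDr.
Qed.

Lemma near_neq0 (f : plane R -> R) z : {for z, continuous f} -> f z != 0 ->
  nbhs z [set w | f w != 0].
Proof.
move=> cf f0; have e0 : 0 < `|f z| by rewrite normr_gt0.
have /cvgrPdist_lt/(_ _ e0)/nbhs_plane[r r0 H] := cf.
apply/nbhs_plane; exists r => // h /H /=.
by apply: contraTneq => ->; rewrite subr0 ltxx.
Qed.

Lemma smooth_on_coord U k : smooth_on U (fun x : plane R => x 0 k).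
Proof.
apply: (@smooth_on_sub _ _ setT) => //.
by apply: (smooth_on_coordP _ openT).1; exact: smooth_id.
Qed.

Lemma is_derive_coord x v k : is_derive x v (fun y : plane R => y 0 k) (v 0 k).
Proof.
have d : derivable (id : plane R -> plane R) x v by exact: derivable_id.
split; first exact: ((derivable_coordP _ _ _).1 d k).
by rewrite -(derive_coord k d) derive_id.
Qed.

Lemma smooth_on_linear_defect U F k (a b : R) : open U -> smooth_on U F ->
  smooth_on U (fun x => x 0 k - (a * F x 0 0 + b * F x 0 1)).
Proof.
move=> oU sF n; apply: Ck_onB => //; first exact: smooth_on_coord.
by apply: Ck_onD => //; apply: Ck_onZ => //; exact: ((smooth_on_coordP F oU).1 sF).
Qed.

Lemma pd_linear_defect U F k i (a b : R) x : open U -> smooth_on U F -> U x ->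
  pd i (fun x => x 0 k - (a * F x 0 0 + b * F x 0 1)) x =
  (k == i)%:R - (a * pd i (fun y => F y 0 0) x + b * pd i (fun y => F y 0 1) x).
Proof.
move=> oU sF Ux.
have dF j : is_derive x (coord_vec i) (fun y => F y 0 j) (pd i (fun y => F y 0 j) x).
  by apply: (@Ck_on_is_derive _ 0 U) => //; exact: ((smooth_on_coordP F oU).1 sF).
have H := is_deriveB (is_derive_coord x (coord_vec i) k)
  (is_deriveD (is_deriveZ a (dF 0)) (is_deriveZ b (dF 1))).
by rewrite coord_vecE in H; case: H.
Qed.

(** The hypotheses make (a, b; c, d) the inverse of the Jacobian matrix at [z], so [x - A (F x)] has
    zero derivative at [z] and a small one nearby. The bound 1/8 becomes the Lipschitz constant 1/4,
    because [lipschitz_ball] adds the contributions of two directions. *)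
Lemma inverse_contraction U F z (a b c d : R) : open U -> U z -> smooth_on U F ->
  let p := pd 0 (fun y => F y 0 0) z in let q := pd 1 (fun y => F y 0 0) z in
  let r := pd 0 (fun y => F y 0 1) z in let s := pd 1 (fun y => F y 0 1) z in
  a * p + b * r = 1 -> a * q + b * s = 0 -> c * p + d * r = 0 -> c * q + d * s = 1 ->
  nbhs z (fun w => U w /\ forall k i, `|pd i (fun x => x 0 k - mat2_apply a b c d (F x) 0 k) w| < 8^-1).
Proof.
move=> oU Uz sF p q r s E00 E01 E10 E11.
have small (u v : R) k i : (k == i)%:R = u * pd i (fun y => F y 0 0) z + v * pd i (fun y => F y 0 1) z ->
    nbhs z [set w | `|pd i (fun x => x 0 k - (u * F x 0 0 + v * F x 0 1)) w| < 8^-1].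
  move=> E; apply: near_norm_lt.
    apply: (@smooth_on_continuous _ _ U) => //; apply: smooth_on_pd.
    exact: smooth_on_linear_defect.
  by rewrite (pd_linear_defect _ _ _ _ oU sF Uz) -E subrr normr0 invr_gt0.
have h00 := small a b 0 0 (esym E00); have h01 := small a b 0 1 (esym E01).
have h10 := small c d 1 0 (esym E10); have h11 := small c d 1 1 (esym E11).
have oUz : nbhs z U by exact: open_nbhs_nbhs.
apply: filterS (filterI oUz (filterI (filterI h00 h01) (filterI h10 h11))).
move=> w /= [Uw [[w00 w01] [w10 w11]]]; split=> //.
have r0 : (fun x => x 0 0 - mat2_apply a b c d (F x) 0 0) = (fun x => x 0 0 - (a * F x 0 0 + b * F x 0 1)).
  by apply/funext => x; rewrite mat2_apply0.
have r1 : (fun x => x 0 1 - mat2_apply a b c d (F x) 0 1) = (fun x => x 0 1 - (c * F x 0 0 + d * F x 0 1)).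
  by apply/funext => x; rewrite mat2_apply1.
by apply: forall_I2; apply: forall_I2; rewrite ?r0 ?r1.
Qed.

End InverseFunction.

(** Joins completeness to the normed module structure of matrices, so that the Banach fixed point
    theorem applies to the plane. *)
HB.instance Definition _ (R : realType) (m n : nat) := Complete.on 'M[R]_(m.+1, n.+1).

Section InverseFunctionTheorem.
Context {R : realType}.
Implicit Types (U V W : set (plane R)) (F H : plane R -> plane R) (x y z : plane R).

(** A contraction factor 1/2 together with a displacement of the centre of at most r / 2 makes the
    closed ball stable under [g]. *)
Lemma closed_ball_fixed_point (X : completeNormedModType R) (g : X -> X) (x : X) (r : R) :
  0 <= r ->
  (forall y y' : X, `|x - y| <= r -> `|x - y'| <= r -> `|g y - g y'| <= 2^-1 * `|y - y'|) ->
  `|x - g x| <= r / 2 -> exists2 p, `|x - p| <= r & g p = p.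
Proof.
move=> r0 lip gx; pose B : set X := closed_ball_ (fun v : X => `|v|) x r.
have Bx : B x by rewrite /B /closed_ball_/= subrr normr0.
have gB : {homo g : x / B x >-> B x}.
  move=> y By; rewrite /B /closed_ball_/= -(subrK (g x) x) -addrA.
  rewrite (le_trans (ler_normD _ _))// (splitr r) lerD//.
  rewrite (le_trans (lip _ _ Bx By))// mulrC ler_wpM2r//.
have [|||p Bp gp] := @banach_fixed_point R X B (mkfun_fun gB).
- exists (2^-1)%:nng; split; first by rewrite /= invf_lt1// ltr1n.
  by move=> [y y'] [/= By By']; exact: lip.
- exact: closed_closed_ball_.
- by exists x.
by exists p.
Qed.

Lemma plane_sub_cancel (x y u v : plane R) : x - y = x - u - (y - v) + (u - v).
Proof. by apply/rowP => i; rewrite !mxE; ring. Qed.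

Lemma absorb_quarter (u m n M k : R) : 0 <= m ->
  u <= 4^-1 * n -> m <= M * k -> n <= u + m -> n <= 2 * M * k.
Proof. by lra. Qed.

(** Let A be the inverse Jacobian matrix at [z]. As [x - A (F x)] is 1/4-Lipschitz near [z], the
    distance of [x] and [y] can be absorbed into a multiple of that of [F x] and [F y]; this gives
    injectivity and a Lipschitz inverse. Openness of the image comes from a fixed point argument
    around each image point. *)
Lemma inverse_function_topological U F z : open U -> U z -> smooth_on U F -> jac F z != 0 ->
  exists (r M : R) H,
    [/\ 0 < r, 0 < M, (forall x, ball z r x -> U x /\ jac F x != 0), open (F @` ball z r) &
      (forall x, ball z r x -> H (F x) = x) /\
      (forall x y, ball z r x -> ball z r y -> `|x - y| <= M * `|F x - F y|)].
Proof.
move=> oU Uz sF jz; pose D := jac F z.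
pose p := pd 0 (fun y => F y 0 0) z; pose q := pd 1 (fun y => F y 0 0) z.
pose s := pd 0 (fun y => F y 0 1) z; pose t := pd 1 (fun y => F y 0 1) z.
have DE : D = p * t - q * s by [].
pose a := t / D; pose b := - q / D; pose c := - s / D; pose d := p / D.
have adbc : a * d - b * c != 0.
  rewrite (_ : _ - _ = D^-1) ?invr_eq0// /a /b /c /d.
  by move: jz; rewrite -/D DE; clear; move=> h; field.
pose A := mat2_apply a b c d.
have near1 : nbhs z (fun w => U w /\ forall k i, `|pd i (fun x => x 0 k - A (F x) 0 k) w| < 8^-1).
  apply: inverse_contraction => //; rewrite -/p -/q -/s -/t /a /b /c /d;
  by move: jz; rewrite -/D DE; clear; move=> h; field.
have near2 : nbhs z [set w | jac F w != 0].
  apply: near_neq0 => //; apply: (@smooth_on_continuous _ _ U) => // n.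
  have sFk k i : Ck_on n U (pd i (fun y => F y 0 k)).
    by apply: smooth_on_pd; exact: ((smooth_on_coordP F oU).1 sF).
  by apply: Ck_onB => //; apply: Ck_onM.
have [r r0 Br] := (@nbhs_ballP R (plane R) z _).1 (filterI near1 near2).
have oBr : open (ball z r : set (plane R)) by exact: ball_open.
have lipA x y : ball z r x -> ball z r y -> `|x - A (F x) - (y - A (F y))| <= 4^-1 * `|x - y|.
  move=> Bx By.
  have lipk k : `|(x 0 k - A (F x) 0 k) - (y 0 k - A (F y) 0 k)| <= 4^-1 * `|x - y|.
    have -> : 4^-1 = 8^-1 + 8^-1 :> R by clear; lra.
    apply: (@lipschitz_ball _ (fun x => x 0 k - A (F x) 0 k) z y x r) => //.
    - move=> i w Bw; have [[Uw _] _] := Br _ Bw.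
      have [] := pselect True => // _; move: k; apply: forall_I2.
      + have -> : (fun x => x 0 0 - A (F x) 0 0) = (fun x => x 0 0 - (a * F x 0 0 + b * F x 0 1)).
          by apply/funext => x'; rewrite /A mat2_apply0.
        exact: (smooth_on_derivable (smooth_on_linear_defect _ _ _ oU sF)).
      + have -> : (fun x => x 0 1 - A (F x) 0 1) = (fun x => x 0 1 - (c * F x 0 0 + d * F x 0 1)).
          by apply/funext => x'; rewrite /A mat2_apply1.
        exact: (smooth_on_derivable (smooth_on_linear_defect _ _ _ oU sF)).
    - by move=> i w /Br[[_ /(_ k i)/ltW]].
  apply: norm_plane_le; first by rewrite mulr_ge0.
  - by have := lipk 0; rewrite !mxE.
  - by have := lipk 1; rewrite !mxE.
pose M0 := `|a| + `|b| + `|c| + `|d| + 1.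
have M00 : 0 < M0 by rewrite ltr_wpDl// !addr_ge0.
have AM v : `|A v| <= M0 * `|v|.
  by rewrite (le_trans (norm_mat2_apply _ _ _ _ _))// ler_wpM2r// lerDl.
have bilip x y : ball z r x -> ball z r y -> `|x - y| <= (2 * M0) * `|F x - F y|.
  move=> Bx By; have h1 := lipA _ _ Bx By; have h2 := AM (F x - F y).
  have E : x - y = (x - A (F x) - (y - A (F y))) + A (F x - F y).
    by rewrite /A mat2_applyB; exact: plane_sub_cancel.
  have h3 := ler_normD (x - A (F x) - (y - A (F y))) (A (F x - F y)); rewrite -E in h3.
  exact: absorb_quarter (normr_ge0 _) h1 h2 h3.
have [H HF] : exists H, forall x, ball z r x -> H (F x) = x.
  (* Points outside the image of the ball are sent to 0, a dummy value. *)
  have /choice[H HP] : forall y, exists x, (exists2 x', ball z r x' & F x' = y) -> ball z r x /\ F x = y.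
    move=> y; have [[x Bx Fx]|n] := pselect (exists2 x', ball z r x' & F x' = y).
      by exists x.
    by exists 0.
  exists H => x Bx; have [|BH FH] := HP (F x); first by exists x.
  apply/eqP; rewrite -subr_eq0 -normr_le0 (le_trans (bilip _ _ BH Bx))//.
  by rewrite FH subrr normr0 mulr0.
exists r, (2 * M0), H; split=> //.
- by rewrite mulr_gt0.
- by move=> x /Br[[]].
rewrite openE => _ [x Bx <-].
have /nbhs_plane[e e0 Be] : nbhs x (ball z r) by exact: open_nbhs_nbhs.
apply/nbhs_plane; pose e' := e / 2; have e'0 : 0 < e' by rewrite divr_gt0.
exists (e' / 2 / M0); first by rewrite !divr_gt0.
move=> h hh; have inB y : `|x - y| <= e' -> ball z r y.
  move=> xy; rewrite -(subrK x y) addrC; apply: Be; rewrite distrC.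
  by rewrite (le_lt_trans xy)// /e' ltr_pdivrMr// ltr_pMr// ltr1n.
pose g y : plane R := y - A (F y - (F x + h)).
have gE y y' : g y - g y' = y - A (F y) - (y' - A (F y')).
  rewrite /g /A !mat2_applyB; move: (mat2_apply _ _ _ _ _) (mat2_apply _ _ _ _ _) (mat2_apply _ _ _ _ _).
  by move=> u v w; apply/rowP => i; rewrite !mxE; ring.
have [||y xy gy] := @closed_ball_fixed_point (plane R) g x e' (ltW e'0).
- move=> y y' xy xy'; rewrite gE (le_trans (lipA _ _ (inB _ xy) (inB _ xy')))//.
  by rewrite ler_wpM2r//; clear; lra.
- rewrite /g opprD addrA subrr add0r opprK opprD addrA subrr add0r.
  rewrite (le_trans (AM _))// normrN.
  by rewrite -ler_pdivlMl// mulrC ltW.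
exists y; first exact: inB.
apply/eqP; rewrite -subr_eq0; apply/eqP; apply: (mat2_apply_eq0 adbc).
by move/eqP: gy; rewrite /g subr_eq addrC -subr_eq subrr eq_sym => /eqP.
Qed.

End InverseFunctionTheorem.

Section InverseSmooth.
Context {R : realType}.
Implicit Types (U V W : set (plane R)) (F H : plane R -> plane R) (x y z v : plane R).

Definition jac_inv F x v : plane R :=
  mat2_apply (pd 1 (fun y => F y 0 1) x / jac F x) (- pd 1 (fun y => F y 0 0) x / jac F x)
    (- pd 0 (fun y => F y 0 1) x / jac F x) (pd 0 (fun y => F y 0 0) x / jac F x) v.

Lemma mat2_applyZ (a b c d k : R) v : mat2_apply a b c d (k *: v) = k *: mat2_apply a b c d v.
Proof.
have mxZ (u : plane R) i : (k *: u) 0 i = k * u 0 i by rewrite mxE.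
by apply: plane_eq; rewrite mxZ !(mat2_apply0, mat2_apply1) !mxZ; ring.
Qed.

Lemma mat2_apply_remainder0 y v k (p q s t : R) :
  (v - mat2_apply p q s t k) 0 0 = (y + v) 0 0 - y 0 0 - (k 0 0 * p + k 0 1 * q).
Proof.
have -> : (v - mat2_apply p q s t k) 0 0 = v 0 0 - mat2_apply p q s t k 0 0 by rewrite !mxE.
by rewrite mat2_apply0 mxE; ring.
Qed.

Lemma mat2_apply_remainder1 y v k (p q s t : R) :
  (v - mat2_apply p q s t k) 0 1 = (y + v) 0 1 - y 0 1 - (k 0 0 * s + k 0 1 * t).
Proof.
have -> : (v - mat2_apply p q s t k) 0 1 = v 0 1 - mat2_apply p q s t k 0 1 by rewrite !mxE.
by rewrite mat2_apply1 mxE; ring.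
Qed.

Lemma mat2_apply_inv (p q s t : R) v : p * t - q * s != 0 ->
  mat2_apply (t / (p * t - q * s)) (- q / (p * t - q * s)) (- s / (p * t - q * s)) (p / (p * t - q * s))
    (mat2_apply p q s t v) = v.
Proof.
by move=> h; apply: plane_eq; rewrite !(mat2_apply0, mat2_apply1); field.
Qed.

Lemma inverse_derive_bound F x k v (e h M : R) : jac F x != 0 -> h != 0 ->
  let A := jac_inv F x in
  let Jk := mat2_apply (pd 0 (fun y => F y 0 0) x) (pd 1 (fun y => F y 0 0) x)
     (pd 0 (fun y => F y 0 1) x) (pd 1 (fun y => F y 0 1) x) k in
  (forall w, `|A w| <= M * `|w|) -> 0 <= M -> `|h *: v - Jk| <= e * `|h| ->
  `|A v - h^-1 *: k| <= M * e.
Proof.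
move=> j0 h0 A Jk AM M0 vk.
have -> : A v - h^-1 *: k = A (h^-1 *: (h *: v - Jk)).
  by rewrite scalerBr scalerA mulVf// scale1r /A /jac_inv mat2_applyB mat2_applyZ mat2_apply_inv.
rewrite (le_trans (AM _))// ler_wpM2l// normrZ normfV mulrC ler_pdivrMr//.
by rewrite normr_gt0.
Qed.

(** Put [k = H (F x + h v) - x]. Differentiability of [F] gives h v - J k = o(|k|), the Lipschitz
    bound on [H] makes this o(|h|), and applying the inverse Jacobian compares k / h with its value
    on [v]. *)
Lemma is_derive_inverse_plane U F H x v (M r : R) : open U -> U x -> smooth_on U F ->
  jac F x != 0 -> 0 < M -> 0 < r -> H (F x) = x ->
  (forall w, `|w| < r -> F (H (F x + w)) = F x + w /\ `|H (F x + w) - x| <= M * `|w|) ->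
  is_derive (F x) v H (jac_inv F x v).
Proof.
move=> oU Ux sF jx M0 r0 Hx Hw.
pose B := `|pd 1 (fun y => F y 0 1) x / jac F x| + `|- pd 1 (fun y => F y 0 0) x / jac F x| +
  `|- pd 0 (fun y => F y 0 1) x / jac F x| + `|pd 0 (fun y => F y 0 0) x / jac F x|.
have AB w : `|jac_inv F x w| <= B * `|w| by exact: norm_mat2_apply.
have B0 : 0 <= B by rewrite !addr_ge0.
have dF k : differentiable (fun y => F y 0 k) x.
  by apply: (@Ck_on_differentiable _ 0 U) => //; exact: ((smooth_on_coordP F oU).1 sF).
have DF k w : 'D_w (fun y => F y 0 k) x =
    w 0 0 * pd 0 (fun y => F y 0 k) x + w 0 1 * pd 1 (fun y => F y 0 k) x.
  by apply: (@Ck_on_deriveE _ 0 U) => //; exact: ((smooth_on_coordP F oU).1 sF).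
have lim : h^-1 *: ((H \o shift (F x)) (h *: v) - H (F x)) @[h --> (0 : R)^'] --> jac_inv F x v.
  apply/cvgrPdist_le => e e0.
  pose n := `|v| + 1; have n0 : 0 < n by rewrite ltr_wpDl.
  (* The tolerance for [F] is divided beforehand by the later losses: [M * n] from the Lipschitz
     bound on [k] and [B] from the inverse Jacobian. Adding 1 in [n] and [B + 1] keeps the
     denominators positive. *)
  pose e1 := e / (B + 1) / (M * n).
  have e10 : 0 < e1 by rewrite !divr_gt0// ?mulr_gt0// ltr_wpDl.
  have [r1 r10 D0] := differentiable_near (dF 0) e10.
  have [r2 r20 D1] := differentiable_near (dF 1) e10.
  pose d := Num.min r (Num.min r1 r2 / M) / n.
  have d0 : 0 < d by rewrite divr_gt0// lt_min r0 divr_gt0// lt_min r10.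
  near=> h; have h0 : h != 0 by near: h; exact: nbhs_dnbhs_neq.
  have hd : `|h| < d by near: h; exact: dnbhs0_lt.
  have hv : `|h *: v| <= `|h| * n by rewrite normrZ ler_wpM2l// lerDl.
  have hv' : `|h *: v| < Num.min r (Num.min r1 r2 / M).
    by rewrite (le_lt_trans hv)// -ltr_pdivlMr.
  move: hv'; rewrite lt_min => /andP[hvr]; rewrite ltr_pdivlMr// mulrC => hvM.
  have [FH Hle] := Hw _ hvr.
  pose k := H (F x + h *: v) - x.
  have xk : x + k = H (F x + h *: v) by rewrite /k addrC subrK.
  have kM : `|k| <= M * `|h *: v| by [].
  move: hvM; rewrite lt_min => /andP[hv1 hv2].
  have {}D0 := D0 _ (le_lt_trans kM hv1); have {}D1 := D1 _ (le_lt_trans kM hv2).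
  rewrite xk FH (DF 0 k) in D0; rewrite xk FH (DF 1 k) in D1.
  have ek : e1 * `|k| <= e / (B + 1) * `|h|.
    have -> : e / (B + 1) = e1 * (M * n) by rewrite /e1 divfK// mulf_neq0// gt_eqF.
    rewrite -mulrA ler_wpM2l//; first exact: ltW.
    by rewrite (le_trans kM)// -mulrA ler_wpM2l ?(ltW M0)// mulrC.
  rewrite /= [h *: v + _]addrC Hx -/k.
  have step : `|jac_inv F x v - h^-1 *: k| <= B * (e / (B + 1)).
    apply: inverse_derive_bound => //.
    apply: norm_plane_le; first by rewrite mulr_ge0// ltW// divr_gt0// ltr_wpDl.
    - by rewrite (mat2_apply_remainder0 (F x)) (le_trans D0).
    - by rewrite (mat2_apply_remainder1 (F x)) (le_trans D1).
  rewrite (le_trans step)// mulrCA (ler_piMr (ltW e0))//.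
  by rewrite ler_pdivrMr ?ltr_wpDl// mul1r lerDl.
by split; [apply/cvg_ex; exists (jac_inv F x v)|apply/cvg_lim].
Unshelve. all: by end_near. Qed.

End InverseSmooth.

Section InverseFunctionMain.
Context {R : realType}.
Implicit Types (U V W : set (plane R)) (F H : plane R -> plane R) (x y z v : plane R).

Lemma smooth_on_pd_coord U F i k : open U -> smooth_on U F ->
  smooth_on U (pd i (fun y => F y 0 k)).
Proof. by move=> oU sF; apply: smooth_on_pd; exact: (smooth_on_coordP F oU).1. Qed.

Lemma smooth_on_jac U F : open U -> smooth_on U F -> smooth_on U (jac F).
Proof.
move=> oU sF n; apply: Ck_onB => //; apply: Ck_onM => //; exact: smooth_on_pd_coord.
Qed.

Lemma smooth_on_jac_inv U F v : open U -> smooth_on U F -> (forall x, U x -> jac F x != 0) ->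
  smooth_on U (fun x => jac_inv F x v).
Proof.
move=> oU sF j0; apply/smooth_on_coordP => // k n.
have sj : Ck_on n U (fun x => (jac F x)^-1) by apply: Ck_onV => //; exact: smooth_on_jac.
have s i j : Ck_on n U (pd i (fun y => F y 0 j)) by exact: smooth_on_pd_coord.
have sc (c : R) : Ck_on n U (fun=> c) by exact: smooth_cst.
have sD i j : Ck_on n U (fun x => pd i (fun y => F y 0 j) x / jac F x) by exact: Ck_onM.
have sND i j : Ck_on n U (fun x => - pd i (fun y => F y 0 j) x / jac F x).
  by apply: Ck_onM => //; exact: Ck_onN.
move: k; apply: forall_I2.
- rewrite (_ : (fun x => jac_inv F x v 0 0) = fun x =>
    pd 1 (fun y => F y 0 1) x / jac F x * v 0 0 + - pd 1 (fun y => F y 0 0) x / jac F x * v 0 1).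
    by apply: Ck_onD => //; apply: Ck_onM.
  by apply/funext => x; rewrite /jac_inv mat2_apply0.
- rewrite (_ : (fun x => jac_inv F x v 0 1) = fun x =>
    - pd 0 (fun y => F y 0 1) x / jac F x * v 0 0 + pd 0 (fun y => F y 0 0) x / jac F x * v 0 1).
    by apply: Ck_onD => //; apply: Ck_onM.
  by apply/funext => x; rewrite /jac_inv mat2_apply1.
Qed.

Theorem inverse_function U F z : open U -> U z -> smooth_on U F -> jac F z != 0 ->
  exists (W V : set (plane R)) H,
    [/\ open W /\ W z, W `<=` U, open V,
      (forall x, W x -> V (F x) /\ H (F x) = x) &
      (forall y, V y -> W (H y) /\ F (H y) = y) /\ smooth_on V H].
Proof.
move=> oU Uz sF jz.
have [r [M [H [r0 M0 Br oV [HF lip]]]]] := inverse_function_topological oU Uz sF jz.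
pose W : set (plane R) := ball z r; pose V : set (plane R) := F @` W.
have oW : open W by exact: ball_open.
have WU : W `<=` U by move=> x /Br[].
have FH y : V y -> W (H y) /\ F (H y) = y.
  by move=> [x Wx <-]; rewrite HF.
exists W, V, H; split => //.
- by split => //; exact: ballxx.
- by move=> x Wx; split; [exists x|exact: HF].
split=> //.
have Hlip x w : W x -> V (F x + w) -> `|H (F x + w) - x| <= M * `|w|.
  move=> Wx /FH[WH FHw]; rewrite (le_trans (lip _ _ WH Wx))// FHw.
  by rewrite [F x + w]addrC addrK.
have dH v x : W x -> is_derive (F x) v H (jac_inv F x v).
  move=> Wx; have [Ux jx] := Br x Wx.
  have /nbhs_plane[e e0 Ve] : nbhs (F x) V by apply: open_nbhs_nbhs; split=> //; exists x.
  apply: (is_derive_inverse_plane v oU Ux sF jx M0 e0 (HF x Wx)) => w /Ve Vw.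
  by split; [have [] := FH _ Vw|exact: Hlip].
have cH y : V y -> {for y, continuous H}.
  move=> [x Wx <-]; apply: (@cvgrPdist_le _ _ _ (nbhs (F x)) _ H (H (F x))).2 => e e0.
  have /nbhs_plane[d d0 Vd] : nbhs (F x) V by apply: open_nbhs_nbhs; split=> //; exists x.
  apply/nbhs_plane; exists (Num.min d (e / M)); first by rewrite lt_min d0 divr_gt0.
  move=> h; rewrite lt_min => /andP[hd he]; rewrite HF// distrC.
  by rewrite (le_trans (Hlip _ _ Wx (Vd _ hd)))// mulrC -ler_pdivlMr// ltW.
have sJ v : smooth_on W (fun x => jac_inv F x v).
  by apply: smooth_on_jac_inv => //; [exact: smooth_on_sub sF|move=> x /Br[]].
(* Bootstrap: the partial derivatives of [H] are the entries of the inverse Jacobian composed with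
   [H], so they are C^n as soon as [H] is. *)
elim=> [|n IH]; first by split.
apply: (Ck_onS (F := fun i y => jac_inv F (H y) (coord_vec i))) => //.
- by move=> i y Vy; have [WH {1}<-] := FH y Vy; exact: dH.
- move=> i; apply/Ck_on_coordP => // k.
  apply: (@Ck_on_comp _ _ _ W (fun x => jac_inv F x (coord_vec i) 0 k)) => //.
    by apply: (Ck_on_coordP n _ oW).1; exact: sJ.
  by move=> y /FH[].
Qed.

End InverseFunctionMain.

(** * Differential equations *)

Section Gronwall.
Context {R : realType}.
Implicit Types (x y z : plane R).

(** Multiplication by exp(c x_i), with c = - C or C according to the sign of [h], makes [f]
    non-increasing away from [x]. Being non-negative and zero at [x], it stays zero. *)
Lemma gronwall_line (f : plane R -> R) x (i : 'I_2) (h C : R) :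
  (forall s : R, (0 <= s <= h) || (h <= s <= 0) ->
     [/\ derivable f (x + s *: coord_vec i) (coord_vec i), 0 <= f (x + s *: coord_vec i) &
       `|pd i f (x + s *: coord_vec i)| <= C * f (x + s *: coord_vec i)]) ->
  f x = 0 -> f (x + h *: coord_vec i) = 0.
Proof.
move=> H fx; pose c := if 0 <= h then - C else C.
have expD y : is_derive y (coord_vec i) (fun y => expR (c * y 0 i)) (expR (c * y 0 i) * c).
  have H1 := is_deriveZ c (is_derive_coord y (coord_vec i) i).
  rewrite coord_vecE eqxx /GRing.scale /= mulr1 in H1.
  exact: is_derive_scalar_comp (is_derive_expR _) H1.
pose g y := expR (c * y 0 i) * f y.
have dg y : derivable f y (coord_vec i) ->
    is_derive y (coord_vec i) g (expR (c * y 0 i) * pd i f y + f y * (expR (c * y 0 i) * c)).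
  by move=> df; exact: is_deriveM (expD y) (derivableP df).
have [s /H[/dg[]]//|s sb E] := @mvt_line_between _ _ g x (coord_vec i) h.
have [df f0 fC] := H s sb; have [_ dgE] := dg _ df.
have fh0 : 0 <= f (x + h *: coord_vec i).
  by have [] := H h; rewrite // lexx; case: (leP 0 h) => //= ?; rewrite ltW.
have : g (x + h *: coord_vec i) <= 0.
  rewrite -[leLHS]subr0 -[X in _ - X](_ : g x = 0); last by rewrite /g fx mulr0.
  rewrite E dgE; move: fC; rewrite ler_norml => /andP[fC1 fC2].
  rewrite [f _ * _]mulrCA -mulrDr mulrCA pmulr_rle0 ?expR_gt0// /c.
  case: (leP 0 h) => h0.
    by apply: mulr_ge0_le0 => //; rewrite mulrN subr_le0 [_ * C]mulrC.
  by apply: mulr_le0_ge0; [exact: ltW|rewrite [_ * C]mulrC -lerBlDr sub0r].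
rewrite /g pmulr_rle0 ?expR_gt0// => fh.
by apply/eqP; rewrite eq_le fh fh0.
Qed.

Lemma gronwall_ball (f : plane R -> R) z (r C : R) :
  (forall i x, ball z r x ->
     [/\ derivable f x (coord_vec i), 0 <= f x & `|pd i f x| <= C * f x]) ->
  forall x y, ball z r x -> ball z r y -> f x = 0 -> f y = 0.
Proof.
move=> H x y xr yr fx; have [] := ball_path xr yr; set m := x + _ => yE b0 b1; rewrite yE.
apply: (gronwall_line (C := C)) => [s sb|]; first exact: (H _ _ (b1 s sb)).
by apply: (gronwall_line (C := C)) fx => s sb; exact: (H _ _ (b0 s sb)).
Qed.

Lemma quadratic_form_bound (t0 t1 c00 c01 c10 c11 K : R) :
  `|c00| <= K -> `|c01| <= K -> `|c10| <= K -> `|c11| <= K ->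
  `|t0 * (c00 * t0 + c01 * t1) + t0 * (c00 * t0 + c01 * t1) +
    (t1 * (c10 * t0 + c11 * t1) + t1 * (c10 * t0 + c11 * t1))| <= 4 * K * (t0 * t0 + t1 * t1).
Proof.
rewrite !ler_norml => /andP[a1 a2] /andP[b1 b2] /andP[d1 d2] /andP[e1 e2].
have K0 : 0 <= K by lra.
have h (c : R) : - K <= c -> c <= K -> forall u v, - (K * (u * u + v * v)) <= 2 * (c * (u * v)) <= K * (u * u + v * v).
  move=> cl cr u v; apply/andP; split.
  - have : 0 <= (K + c) * ((u + v) ^+ 2) + (K - c) * ((u - v) ^+ 2).
      by rewrite addr_ge0// mulr_ge0 ?sqr_ge0//; lra.
    by rewrite !expr2; lra.
  - have : 0 <= (K - c) * ((u + v) ^+ 2) + (K + c) * ((u - v) ^+ 2).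
      by rewrite addr_ge0// mulr_ge0 ?sqr_ge0//; lra.
    by rewrite !expr2; lra.
have /andP[h1 h2] := h c00 a1 a2 t0 t0; have /andP[h3 h4] := h c01 b1 b2 t0 t1.
have /andP[h5 h6] := h c10 d1 d2 t1 t0; have /andP[h7 h8] := h c11 e1 e2 t1 t1.
by apply/andP; split; lra.
Qed.

(** The squared length [f] of the solution satisfies |df| <= 4 K f near [z], so the Gronwall
    estimate propagates its zero. This is how a parallel tensor is seen to vanish near each of its
    zeros. *)
Lemma linear_system_vanishing (U : set (plane R)) (t : 'I_2 -> plane R -> R)
    (c : 'I_2 -> 'I_2 -> 'I_2 -> plane R -> R) z :
  open U -> U z -> (forall k, smooth_on U (t k)) ->
  (forall i k j, smooth_on U (c i k j)) ->
  (forall i k x, U x -> pd i (t k) x = c i k 0 x * t 0 x + c i k 1 x * t 1 x) ->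
  (forall k, t k z = 0) -> nbhs z [set x | forall k, t k x = 0].
Proof.
move=> oU Uz st sc tE tz.
pose f x := t 0 x * t 0 x + t 1 x * t 1 x.
(* The summand 1 makes [K] exceed every coefficient at [z] strictly, so that the bounds persist on a
   neighbourhood. *)
pose K := 1 + \sum_i \sum_k \sum_j `|c i k j z|.
have cK i k j : `|c i k j z| < K.
  rewrite /K (bigD1 i)//= (bigD1 k)//= (bigD1 j)//=.
  rewrite !addrA ltr_wpDr ?sumr_ge0//; first by move=> *; do 2 apply: sumr_ge0 => ? _.
  rewrite ltr_wpDr ?sumr_ge0//; first by move=> *; apply: sumr_ge0.
  by rewrite ltr_wpDr ?sumr_ge0// ltrDr.
have nc i k j : nbhs z [set x | `|c i k j x| < K].
  by apply: near_norm_lt => //; apply: (@smooth_on_continuous _ _ U).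
have nU : nbhs z U by exact: open_nbhs_nbhs.
have n2 (i k : 'I_2) : nbhs z [set x | `|c i k 0 x| < K /\ `|c i k 1 x| < K].
  exact: (filterI (nc i k 0) (nc i k 1)).
have n1 (i : 'I_2) : nbhs z [set x | (`|c i 0 0 x| < K /\ `|c i 0 1 x| < K) /\
    (`|c i 1 0 x| < K /\ `|c i 1 1 x| < K)].
  exact: (filterI (n2 i 0) (n2 i 1)).
have [r r0 Br] := (@nbhs_ballP R (plane R) z _).1 (filterI nU (filterI (n1 0) (n1 1))).
have Bc i k j x : ball z r x -> `|c i k j x| <= K.
  move=> /Br[_ [[[a b] [d e]] [[a' b'] [d' e']]]].
  by move: i k j; apply: forall_I2; apply: forall_I2; apply: forall_I2; exact: ltW.
apply/nbhs_ballP; exists r => //= y yr.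
have fz : f z = 0 by rewrite /f !tz mulr0 addr0.
have fy : f y = 0.
  apply: (@gronwall_ball f z r (4 * K)) fz => // [i x Bx|]; last exact: ballxx.
  have [Ux _] := Br _ Bx.
  have dt k : is_derive x (coord_vec i) (t k) (pd i (t k) x).
    by apply: (@Ck_on_is_derive _ 0 U) => //; exact: st.
  have [d1 d2] := is_deriveD (is_deriveM (dt 0) (dt 0)) (is_deriveM (dt 1) (dt 1)).
  split; first exact: d1.
    by rewrite addr_ge0// -expr2 sqr_ge0.
  rewrite /f d2 !tE//; apply: quadratic_form_bound; exact: Bc.
have : t 0 y * t 0 y = 0 /\ t 1 y * t 1 y = 0.
  have := sqr_ge0 (t 0 y); have := sqr_ge0 (t 1 y); rewrite !expr2.
  move: fy; rewrite /f; move: (t 0 y * _) (t 1 y * _) => a b; clear => *; split; lra.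
move=> [/eqP + /eqP]; rewrite !mulf_eq0 !orbb => /eqP t0 /eqP t1.
exact: forall_I2.
Qed.

End Gronwall.

Section DampedOscillator.
Context {R : realType}.

Lemma is_derive_scale (l x : R) : is_derive x (1 : R) (fun s => l * s) l.
Proof.
have := is_deriveZ l (is_derive_id x (1 : R)).
by rewrite [l *: 1]mulr1.
Qed.

Lemma damped_oscillator (u e : R) : exists w w1 : R -> R,
  [/\ w 0 = 1, (forall s, is_derive s (1 : R) w (w1 s)) &
    forall s, is_derive s (1 : R) w1 (- (2 * u) * w1 s - e * w s)].
Proof.
have dexp l s : is_derive s (1 : R) (fun s => expR (l * s)) (expR (l * s) * l).
  exact: is_derive_scalar_comp (is_derive_expR _) (is_derive_scale l s).
have [h|h] := leP 0 (u ^+ 2 - e).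
- pose l := - u + Num.sqrt (u ^+ 2 - e).
  have lE : l ^+ 2 = - (2 * u) * l - e.
    have := sqr_sqrtr h; rewrite /l; move: (Num.sqrt _) => t.
    by rewrite !expr2 => H; rewrite mulrDl !mulrDr H; ring.
  exists (fun s => expR (l * s)), (fun s => expR (l * s) * l); split => //.
  + by rewrite mulr0 expR0.
  + move=> s.
    have -> : - (2 * u) * (expR (l * s) * l) - e * expR (l * s) = l * (expR (l * s) * l).
      have -> : l * (expR (l * s) * l) = expR (l * s) * l ^+ 2 by rewrite expr2; ring.
      by rewrite lE; ring.
    have -> : (fun s => expR (l * s) * l) = (fun s => l * expR (l * s)).
      by apply/funext => t; rewrite mulrC.
    exact: is_deriveZ (dexp l s).
- pose o := Num.sqrt (e - u ^+ 2).
  have oE : o ^+ 2 = e - u ^+ 2 by rewrite sqr_sqrtr// ltW// subr_gt0 -subr_lt0.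
  pose E s := expR (- u * s).
  have dE s : is_derive s (1 : R) E (E s * - u) by exact: dexp.
  have dc s : is_derive s (1 : R) (fun s => cos (o * s)) (- sin (o * s) * o).
    exact: is_derive_scalar_comp (is_derive_cos _) (is_derive_scale o s).
  have ds s : is_derive s (1 : R) (fun s => sin (o * s)) (cos (o * s) * o).
    exact: is_derive_scalar_comp (is_derive_sin _) (is_derive_scale o s).
  exists (fun s => E s * cos (o * s)), (fun s => E s * (- u * cos (o * s) - o * sin (o * s))); split.
  + by rewrite /E !mulr0 expR0 cos0 mulr1.
  + move=> s; apply: is_derive_eq (is_deriveM (dE s) (dc s)) _.
    by rewrite /GRing.scale /=; ring.
  + move=> s.
    have dk : is_derive s (1 : R) (fun s => - u * cos (o * s) - o * sin (o * s))
        (- u * (- sin (o * s) * o) - o * (cos (o * s) * o)).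
      exact: is_deriveB (is_deriveZ (- u) (dc s)) (is_deriveZ o (ds s)).
    apply: is_derive_eq (is_deriveM (dE s) dk) _.
    move: oE; rewrite /GRing.scale /=.
    move: (E s) (cos _) (sin _) => a b c; rewrite !expr2 => oE.
    have -> : e = o * o + u * u by rewrite oE; ring.
    by ring.
Qed.

(** The two claims are proved by a joint induction on the order, because the derivatives of [w] and
    [w1] are expressed through each other. *)
Lemma smooth_on_damped_oscillator (U : set (plane R)) (f : plane R -> R) (w w1 : R -> R) (u e : R) :
  open U -> (forall s, is_derive s (1 : R) w (w1 s)) ->
  (forall s, is_derive s (1 : R) w1 (- (2 * u) * w1 s - e * w s)) ->
  smooth_on U f -> smooth_on U (fun x => w (f x)) /\ smooth_on U (fun x => w1 (f x)).
Proof.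
move=> oU dw dw1 sf.
have c (h : R -> R) (dh : R -> R) x : (forall s, is_derive s (1 : R) h (dh s)) -> U x ->
    {for x, continuous (fun x => h (f x))}.
  move=> Hh Ux; apply: (@continuous_comp _ _ _ f h x (smooth_on_continuous sf Ux)).
  by have [d _] := Hh (f x); exact/differentiable_continuous/derivable1_diffP.
have dc (h : R -> R) (dh : R -> R) i x : (forall s, is_derive s (1 : R) h (dh s)) -> U x ->
    is_derive x (coord_vec i) (fun x => h (f x)) (dh (f x) * pd i f x).
  move=> Hh Ux; apply: is_derive_scalar_comp (Hh _) _.
  by apply: (@Ck_on_is_derive _ 0 U).
suff S n : Ck_on n U (fun x => w (f x)) /\ Ck_on n U (fun x => w1 (f x)).
  by split=> n; have [] := S n.
elim: n => [|n [IH IH1]].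
  by split; split=> // x Ux; [exact: c dw Ux|exact: c dw1 Ux].
have pf i : Ck_on n U (pd i f) by exact: smooth_on_pd.
split.
- have IF i : Ck_on n U (fun x => w1 (f x) * pd i f x) by exact: Ck_onM oU IH1 (pf i).
  exact: (Ck_onS oU (fun x => c _ _ x dw) (fun i x => dc _ _ i x dw) IF).
- have IF i : Ck_on n U (fun x => (- (2 * u) * w1 (f x) - e * w (f x)) * pd i f x).
    exact: Ck_onM oU (Ck_onB oU (Ck_onZ _ oU IH1) (Ck_onZ _ oU IH)) (pf i).
  exact: (Ck_onS oU (fun x => c _ _ x dw1) (fun i x =>
    dc _ (fun s => - (2 * u) * w1 s - e * w s) i x dw1) IF).
Qed.

End DampedOscillator.

(** * Torsion and curvature in coordinates *)

Section PartialDerivatives.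
Context {R : realType}.
Implicit Types (f g : plane R -> R) (x : plane R) (i : 'I_2) (d e : R).

(* A conjunction rather than the class [is_derive], so that applying the rules
   below does not trigger instance search. *)
Definition has_pd f x i d := derivable f x (coord_vec i) /\ pd i f x = d.

Lemma has_pd_is_derive f x i d : has_pd f x i d -> is_derive x (coord_vec i) f d.
Proof. by case. Qed.

Lemma is_derive_has_pd f x i d : is_derive x (coord_vec i) f d -> has_pd f x i d.
Proof. by case. Qed.

Lemma has_pd_eq f x i d e : has_pd f x i d -> d = e -> has_pd f x i e.
Proof. by move=> ? <-. Qed.

Lemma has_pdE f x i d : has_pd f x i d -> pd i f x = d.
Proof. by case. Qed.

Lemma has_pdD f g x i d e : has_pd f x i d -> has_pd g x i e ->
  has_pd (fun y => f y + g y) x i (d + e).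
Proof.
move=> /has_pd_is_derive df /has_pd_is_derive dg.
by apply: is_derive_has_pd; exact: is_deriveD.
Qed.

Lemma has_pdN f x i d : has_pd f x i d -> has_pd (fun y => - f y) x i (- d).
Proof. by move=> /has_pd_is_derive df; apply: is_derive_has_pd; exact: is_deriveN. Qed.

Lemma has_pdM f g x i d e : has_pd f x i d -> has_pd g x i e ->
  has_pd (fun y => f y * g y) x i (f x * e + g x * d).
Proof.
move=> /has_pd_is_derive df /has_pd_is_derive dg.
by apply: is_derive_has_pd; exact: is_deriveM.
Qed.

Lemma has_pd_cst c x i : has_pd (fun=> c) x i 0.
Proof. exact: is_derive_has_pd. Qed.

Lemma has_pdV f x i d : f x != 0 -> has_pd f x i d ->
  has_pd (fun y => (f y)^-1) x i (- ((f x)^-1 * (f x)^-1) * d).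
Proof.
move=> f0 [df dE]; split; first exact: derivableV f0 df.
by rewrite (deriveV f0 df) -exprVn expr2 dE.
Qed.

Lemma has_pd_expR f x i d : has_pd f x i d ->
  has_pd (fun y => expR (f y)) x i (expR (f x) * d).
Proof.
move=> /has_pd_is_derive df; apply: is_derive_has_pd.
exact: is_derive_scalar_comp (is_derive_expR _) df.
Qed.

Lemma has_pd_smooth (U : set (plane R)) f x i : smooth_on U f -> U x ->
  has_pd f x i (pd i f x).
Proof. by move=> sf Ux; split=> //; exact: smooth_on_derivable sf Ux. Qed.

End PartialDerivatives.

Section SmoothFunctions.
Context {R : realType}.
Implicit Types (U : set (plane R)) (f g : plane R -> R).

Lemma smooth_onD U f g : open U -> smooth_on U f -> smooth_on U g ->
  smooth_on U (fun x => f x + g x).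
Proof. by move=> oU sf sg n; exact: Ck_onD. Qed.

Lemma smooth_onM U f g : open U -> smooth_on U f -> smooth_on U g ->
  smooth_on U (fun x => f x * g x).
Proof. by move=> oU sf sg n; exact: Ck_onM. Qed.

Lemma smooth_onN U f : open U -> smooth_on U f -> smooth_on U (fun x => - f x).
Proof. by move=> oU sf n; exact: Ck_onN. Qed.

Lemma smooth_onV U f : open U -> (forall x, U x -> f x != 0) -> smooth_on U f ->
  smooth_on U (fun x => (f x)^-1).
Proof. by move=> oU f0 sf n; exact: Ck_onV. Qed.

End SmoothFunctions.

(** * Automation for smoothness and partial derivatives *)

Ltac smooth_atom :=
  lazymatch goal with
  | |- smooth_on _ (fun y => derive ?h y (coord_vec ?j)) =>
    refine (@smooth_on_pd _ _ _ h j _); smooth_atom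
  | |- smooth_on _ (fun y => ?h y) => change (fun y => h y) with h; smooth_atom
  | |- smooth_on ?U ?f =>
    match goal with
    | H : smooth_on U f |- _ => exact H
    | H : forall i, smooth_on U (?A i) |- _ =>
      lazymatch f with A ?i => exact (H i) end
    | H : forall i j, smooth_on U (?A i j) |- _ =>
      lazymatch f with A ?i ?j => exact (H i j) end
    | H : forall i j k, smooth_on U (?A i j k) |- _ =>
      lazymatch f with A ?i ?j ?k => exact (H i j k) end
    end
  end.

Ltac smooth_rule :=
  lazymatch goal with
  | |- smooth_on _ (fun _ => ?c) => exact (@smooth_cst _ _ _ c)
  | |- smooth_on _ (fun y => @?f y + @?g y) =>
    refine (smooth_onD (f := f) (g := g) _ _ _); [assumption | smooth_rule | smooth_rule]
  | |- smooth_on _ (fun y => @?f y * @?g y) =>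
    refine (smooth_onM (f := f) (g := g) _ _ _); [assumption | smooth_rule | smooth_rule]
  | |- smooth_on _ (fun y => - (@?f y)) =>
    refine (smooth_onN (f := f) _ _); [assumption | smooth_rule]
  | |- smooth_on _ (fun y => (@?f y)^-1) =>
    refine (smooth_onV (f := f) _ _ _); [assumption | | smooth_rule]
  | |- _ => smooth_atom
  end.

Ltac pd_atom :=
  try match goal with
  | |- has_pd (fun y => ?h y) ?x ?i ?d => change (has_pd h x i d)
  end;
  match goal with
  | oU : open ?U, Ux : ?U ?x |- has_pd _ ?x _ _ =>
    refine (@has_pd_smooth _ U _ x _ _ Ux); smooth_atom
  end.

(** Differentiation by proof search: called on a goal whose value is an existential variable created
    by [eassert], the rules compute the derivative. Non-vanishing of an inverted function is left as
    a subgoal. *)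
Ltac pd_rule :=
  lazymatch goal with
  | |- has_pd (fun _ => ?c) _ _ _ => exact (has_pd_cst c _ _)
  | |- has_pd (fun y => @?f y + @?g y) _ _ _ => refine (has_pdD (f := f) (g := g) _ _); pd_rule
  | |- has_pd (fun y => @?f y * @?g y) _ _ _ => refine (has_pdM (f := f) (g := g) _ _); pd_rule
  | |- has_pd (fun y => - (@?f y)) _ _ _ => refine (has_pdN (f := f) _); pd_rule
  | |- has_pd (fun y => (@?f y)^-1) _ _ _ => refine (has_pdV (f := f) _ _); [ | pd_rule]
  | |- _ => pd_atom
  end.

(* Partial derivatives are generalized before calling [ring], which would
   otherwise try to unify them up to conversion. *)
Ltac abstract_pd :=
  repeat match goal with
  | |- context [derive ?f ?x ?v] => generalize (derive f x v); intro
  end.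

Notation smooth_christoffel U G := (forall i j k, smooth_on U (G i j k)).

Section Curvature.
Context {R : realType}.
Implicit Types (U : set (plane R)) (G : christoffel R) (x v w : plane R)
  (X Y Z : field R) (i j k : 'I_2).

Definition gam G x v w : plane R :=
  \row_k \sum_i \sum_j G i j k x * v 0 i * w 0 j.

(* [tor G] and [cur G k j] are the components of T(d_1, d_2) and of
   R(d_1, d_2) d_j; in dimension 2 they determine T and R. *)
Definition tor G k x : R := 2^-1 * (G 0 1 k x - G 1 0 k x).

Definition cur G k j x : R :=
  pd 0 (G 1 j k) x - pd 1 (G 0 j k) x +
  (G 0 0 k x * G 1 j 0 x - G 1 0 k x * G 0 j 0 x) +
  (G 0 1 k x * G 1 j 1 x - G 1 1 k x * G 0 j 1 x).

Lemma gamE G x v w k : gam G x v w 0 k =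
  G 0 0 k x * v 0 0 * w 0 0 + G 0 1 k x * v 0 0 * w 0 1 +
  (G 1 0 k x * v 0 1 * w 0 0 + G 1 1 k x * v 0 1 * w 0 1).
Proof. by rewrite mxE !sum_I2. Qed.

Lemma torsionE G X Y x k : torsion G X Y x 0 k =
  (X x 0 0 * Y x 0 1 - X x 0 1 * Y x 0 0) * tor G k x.
Proof.
have -> : torsion G X Y x = 2^-1 *: (gam G x (X x) (Y x) - gam G x (Y x) (X x)).
  have E (a b p q : plane R) : a + p - (b + q) - (a - b) = p - q.
    by apply/rowP => l; rewrite !mxE; ring.
  by congr (_ *: _); exact: E.
have mxZB (c : R) u u' : (c *: (u - u') : plane R) 0 k = c * (u 0 k - u' 0 k) by rewrite !mxE.
by rewrite mxZB !gamE /tor; ring.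
Qed.

Implicit Types A B C : 'I_2 -> plane R -> R.

(* The inner derivatives are written as functions on [plane R], the syntactic form
   produced by [pd_rule]. *)
Lemma schwarz_eta U (f : plane R -> R) x : open U -> smooth_on U f -> U x ->
  pd 0 (fun y : plane R => derive f y (coord_vec 1)) x =
  pd 1 (fun y : plane R => derive f y (coord_vec 0)) x.
Proof. by move=> oU sf Ux; exact: (schwarz oU (sf 2) Ux). Qed.

(** Covariant derivative and bracket are restated on scalar component functions, the shape on which
    [pd_rule] and [ring] can compute. *)
Definition cov_comp G A B k x : R :=
  A 0 x * pd 0 (B k) x + A 1 x * pd 1 (B k) x +
  (G 0 0 k x * A 0 x * B 0 x + G 0 1 k x * A 0 x * B 1 x +
  (G 1 0 k x * A 1 x * B 0 x + G 1 1 k x * A 1 x * B 1 x)).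

Definition bracket_comp A B k x : R :=
  A 0 x * pd 0 (B k) x + A 1 x * pd 1 (B k) x -
  (B 0 x * pd 0 (A k) x + B 1 x * pd 1 (A k) x).

Lemma smooth_cov_comp U G A B k : open U -> smooth_christoffel U G ->
  (forall i, smooth_on U (A i)) -> (forall i, smooth_on U (B i)) ->
  smooth_on U (cov_comp G A B k).
Proof.
move=> oU sG sA sB; rewrite /cov_comp.
smooth_rule.
Qed.

(** Tensoriality of R: the first derivatives of the components of A, B and C cancel algebraically,
    and the second derivatives of C cancel by the symmetry of mixed partial derivatives. *)
Lemma curvature_comp U G A B C k x : open U -> U x -> smooth_christoffel U G ->
  (forall i, smooth_on U (A i)) -> (forall i, smooth_on U (B i)) ->
  (forall i, smooth_on U (C i)) ->
  cov_comp G A (cov_comp G B C) k x - cov_comp G B (cov_comp G A C) k x -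
  cov_comp G (bracket_comp A B) C k x =
  (A 0 x * B 1 x - A 1 x * B 0 x) * (cur G k 0 x * C 0 x + cur G k 1 x * C 1 x).
Proof.
move=> oU Ux sG sA sB sC.
have sw := schwarz_eta oU (sC k) Ux.
eassert (A0 : has_pd (cov_comp G A C k) x 0 _) by (unfold cov_comp; pd_rule).
eassert (A1 : has_pd (cov_comp G A C k) x 1 _) by (unfold cov_comp; pd_rule).
eassert (B0 : has_pd (cov_comp G B C k) x 0 _) by (unfold cov_comp; pd_rule).
eassert (B1 : has_pd (cov_comp G B C k) x 1 _) by (unfold cov_comp; pd_rule).
move: A0 A1 B0 B1 => /has_pdE A0 /has_pdE A1 /has_pdE B0 /has_pdE B1.
rewrite {1 3}/cov_comp A0 A1 B0 B1 /cov_comp /bracket_comp /cur {A0 A1 B0 B1}.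
move: sw; abstract_pd => ->.
repeat match goal with |- context [G ?i ?j ?l x] => generalize (G i j l x); intro end.
move: (A 0 x) (A 1 x) (B 0 x) (B 1 x) (C 0 x) (C 1 x). intros. ring.
Qed.

End Curvature.

(** The component form of nabla T = 0, and below of nabla R = 0. The trace of the symbols is the
    density weight: it arises from nabla_a acting on d_1 and d_2 in T(d_1, d_2) and R(d_1, d_2). *)
Notation torsion_system U G := (forall a k x, U x -> pd a (tor G k) x =
    (G a 0 0 x + G a 1 1 x) * tor G k x - (G a 0 k x * tor G 0 x + G a 1 k x * tor G 1 x)).

Notation curvature_system U G := (forall a k j x, U x -> pd a (cur G k j) x =
    (G a 0 0 x + G a 1 1 x) * cur G k j x -
    (G a 0 k x * cur G 0 j x + G a 1 k x * cur G 1 j x) +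
    (G a j 0 x * cur G k 0 x + G a j 1 x * cur G k 1 x)).

Ltac abstract_at x :=
  repeat match goal with
  | |- context [cur ?G ?k ?j x] => generalize (cur G k j x); intro
  | |- context [tor ?G ?k x] => generalize (tor G k x); intro
  | |- context [?G ?i ?j ?k x] => generalize (G i j k x); intro
  end.

Section TensorFields.
Context {R : realType}.
Implicit Types (U : set (plane R)) (G : christoffel R) (x u v w y : plane R)
  (X Y Z : field R) (i j k : 'I_2) (A B C : 'I_2 -> plane R -> R).

Lemma plane0E k : (0 : plane R) 0 k = 0.
Proof. by rewrite mxE. Qed.

Lemma plane_subE v w k : (v - w : plane R) 0 k = v 0 k - w 0 k.
Proof. by rewrite !mxE. Qed.

Lemma plane_sub3E u v w y k : (u - v - w - y : plane R) 0 k = u 0 k - v 0 k - w 0 k - y 0 k.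
Proof. by rewrite !plane_subE. Qed.

Definition comp X i : plane R -> R := fun x => X x 0 i.

Lemma smooth_comp U X i : open U -> smooth_on U X -> smooth_on U (comp X i).
Proof. by move=> oU; move/(smooth_on_coordP _ oU); exact. Qed.

Lemma derive_compE U X v x k : open U -> smooth_on U X -> U x ->
  ('D_v X x) 0 k = v 0 0 * pd 0 (comp X k) x + v 0 1 * pd 1 (comp X k) x.
Proof.
move=> oU sX Ux; have sXk l : Ck_on 1 U (comp X l) by exact: smooth_comp.
rewrite -(Ck_on_deriveE v oU (sXk k) Ux) -derive_coord//; apply/derivable_coordP => l.
exact: diff_derivable (Ck_on_differentiable oU (sXk l) Ux).
Qed.

Lemma cov_compE U G X Y x k : open U -> smooth_on U Y -> U x ->
  cov G X Y x 0 k = cov_comp G (comp X) (comp Y) k x.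
Proof.
move=> oU sY Ux.
have -> : cov G X Y x 0 k = ('D_(X x) Y x) 0 k + gam G x (X x) (Y x) 0 k by rewrite mxE.
by rewrite (derive_compE _ _ oU sY Ux) gamE.
Qed.

Lemma smooth_cov U G X Y : open U -> smooth_christoffel U G -> smooth_on U X ->
  smooth_on U Y -> smooth_on U (cov G X Y).
Proof.
move=> oU sG sX sY; apply/smooth_on_coordP => // k.
apply: (eq_smooth_on (f := cov_comp G (comp X) (comp Y) k)) => //.
  by move=> y Uy; rewrite (cov_compE _ _ _ oU sY Uy).
by apply: smooth_cov_comp => // i; exact: smooth_comp.
Qed.

Lemma bracket_compE U X Y x k : open U -> smooth_on U X -> smooth_on U Y -> U x ->
  bracket X Y x 0 k = bracket_comp (comp X) (comp Y) k x.
Proof.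
move=> oU sX sY Ux.
have -> : bracket X Y x 0 k = ('D_(X x) Y x) 0 k - ('D_(Y x) X x) 0 k by rewrite /bracket plane_subE.
by rewrite (derive_compE _ _ oU sY Ux) (derive_compE _ _ oU sX Ux).
Qed.

Lemma eq_cov_comp U G A A' B B' x k : open U -> U x -> (forall i, A i x = A' i x) ->
  (forall i y, U y -> B i y = B' i y) -> cov_comp G A B k x = cov_comp G A' B' k x.
Proof.
move=> oU Ux AA BB; rewrite /cov_comp !AA !(BB _ _ Ux).
by rewrite !(eq_on_derive _ oU (BB k) Ux).
Qed.

Lemma curvatureE U G X Y Z x k : open U -> smooth_christoffel U G -> smooth_on U X ->
  smooth_on U Y -> smooth_on U Z -> U x ->
  curvature G X Y Z x 0 k = (X x 0 0 * Y x 0 1 - X x 0 1 * Y x 0 0) *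
    (cur G k 0 x * Z x 0 0 + cur G k 1 x * Z x 0 1).
Proof.
move=> oU sG sX sY sZ Ux.
have -> : curvature G X Y Z x 0 k = cov G X (cov G Y Z) x 0 k -
    cov G Y (cov G X Z) x 0 k - cov G (bracket X Y) Z x 0 k by rewrite /curvature !plane_subE.
rewrite (cov_compE _ _ _ oU (smooth_cov oU sG sY sZ) Ux).
rewrite (cov_compE _ _ _ oU (smooth_cov oU sG sX sZ) Ux) (cov_compE _ _ _ oU sZ Ux).
have cX i := smooth_comp i oU sX; have cY i := smooth_comp i oU sY.
have cZ i := smooth_comp i oU sZ.
have E (W : field R) : smooth_on U W -> forall i y, U y ->
    comp (cov G W Z) i y = cov_comp G (comp W) (comp Z) i y.
  by move=> sW i y Uy; exact: cov_compE oU sZ Uy.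
rewrite (eq_cov_comp G k oU Ux (fun i => erefl (comp X i x)) (E _ sY)).
rewrite (eq_cov_comp G k oU Ux (fun i => erefl (comp Y i x)) (E _ sX)).
rewrite (eq_cov_comp (A' := bracket_comp (comp X) (comp Y)) G k oU Ux _ (fun i y _ => erefl (comp Z i y))).
  exact: curvature_comp oU Ux sG cX cY cZ.
by move=> i; exact: bracket_compE oU sX sY Ux.
Qed.

Lemma torsion_eval G X Y x k (a0 a1 b0 b1 : R) :
  X x 0 0 = a0 -> X x 0 1 = a1 -> Y x 0 0 = b0 -> Y x 0 1 = b1 ->
  torsion G X Y x 0 k = (a0 * b1 - a1 * b0) * tor G k x.
Proof. by move=> <- <- <- <-; exact: torsionE. Qed.

Lemma curvature_eval U G X Y Z x k (a0 a1 b0 b1 c0 c1 : R) : open U ->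
  smooth_christoffel U G -> smooth_on U X -> smooth_on U Y -> smooth_on U Z -> U x ->
  X x 0 0 = a0 -> X x 0 1 = a1 -> Y x 0 0 = b0 -> Y x 0 1 = b1 ->
  Z x 0 0 = c0 -> Z x 0 1 = c1 ->
  curvature G X Y Z x 0 k = (a0 * b1 - a1 * b0) * (cur G k 0 x * c0 + cur G k 1 x * c1).
Proof. by move=> oU sG sX sY sZ Ux <- <- <- <- <- <-; exact: curvatureE oU sG sX sY sZ Ux. Qed.

Lemma smooth_tor U G k : open U -> smooth_christoffel U G -> smooth_on U (tor G k).
Proof. by move=> oU sG; rewrite /tor; smooth_rule. Qed.

Lemma smooth_cur U G k j : open U -> smooth_christoffel U G -> smooth_on U (cur G k j).
Proof. by move=> oU sG; rewrite /cur; smooth_rule. Qed.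

Lemma pd_cst i (c : R) x : pd i (fun=> c) x = 0.
Proof. exact: derive_cst. Qed.

Lemma cov_cst G v w x k : cov G (cst v) (cst w) x 0 k = gam G x v w 0 k.
Proof.
have -> : cov G (cst v) (cst w) x 0 k = ('D_v (cst w) x) 0 k + gam G x v w 0 k by rewrite mxE.
by rewrite derive_cst mxE add0r.
Qed.

Lemma gam_coord G x a b k : gam G x (coord_vec a) (coord_vec b) 0 k = G a b k x.
Proof.
rewrite gamE !coord_vecE; move: a b; apply: forall_I2; apply: forall_I2 => /=; ring.
Qed.

Lemma pd_coordE (B : 'I_2 -> plane R -> R) G (a k : 'I_2) x :
  cov_comp G (comp (cst (coord_vec a))) B k x =
  pd a (B k) x + (G a 0 k x * B 0 x + G a 1 k x * B 1 x).
Proof.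
rewrite /cov_comp /comp /cst !coord_vecE; move: a; apply: forall_I2 => /=; abstract_pd; ring.
Qed.

Lemma cov_coord G (a b : 'I_2) x k :
  cov G (cst (coord_vec a)) (cst (coord_vec b)) x 0 k = G a b k x.
Proof. by rewrite cov_cst gam_coord. Qed.

Lemma cst_coord (a k : 'I_2) x : cst (coord_vec a : plane R) x 0 k = (k == a)%:R.
Proof. exact: coord_vecE. Qed.

Lemma cov_coord_field U G (a k : 'I_2) X B x : open U -> smooth_on U X -> U x ->
  (forall i y, U y -> comp X i y = B i y) ->
  cov G (cst (coord_vec a)) X x 0 k = pd a (B k) x + (G a 0 k x * B 0 x + G a 1 k x * B 1 x).
Proof.
move=> oU sX Ux XB; rewrite (cov_compE _ _ _ oU sX Ux) -pd_coordE.
exact: eq_cov_comp oU Ux (fun i => erefl _) XB.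
Qed.

Lemma tor_parallel U G : open U -> smooth_christoffel U G ->
  (forall X Y Z, smooth_on U X -> smooth_on U Y -> smooth_on U Z ->
     forall x, U x -> cov_torsion G Z X Y x = 0) ->
  torsion_system U G.
Proof.
move=> oU sG H a k x Ux.
have sc (b : 'I_2) : smooth_on U (cst (coord_vec b : plane R)) by exact: smooth_cst.
have t01 i y : U y -> comp (torsion G (cst (coord_vec 0)) (cst (coord_vec 1))) i y = tor G i y.
  move=> _; apply: (etrans (torsion_eval G i (cst_coord 0 0 y) (cst_coord 0 1 y) (cst_coord 1 0 y) (cst_coord 1 1 y))).
  by rewrite /= mulr1 mulr0 subr0 mul1r.
have sT : smooth_on U (torsion G (cst (coord_vec 0)) (cst (coord_vec 1))).
  apply/smooth_on_coordP => // i; apply: (eq_smooth_on (f := tor G i)) => //.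
    by move=> y Uy; rewrite -(t01 i y Uy).
  exact: smooth_tor.
have E0 := cov_coord_field G a k oU sT Ux t01.
have E1 := torsion_eval G k (cov_coord G a 0 x 0) (cov_coord G a 0 x 1) (cst_coord 1 0 x) (cst_coord 1 1 x).
have E2 := torsion_eval G k (cst_coord 0 0 x) (cst_coord 0 1 x) (cov_coord G a 1 x 0) (cov_coord G a 1 x 1).
have := congr1 (fun v : plane R => v 0 k) (H _ _ _ (sc 0) (sc 1) (sc a) x Ux).
rewrite /= plane0E => h.
have {h} := etrans (esym (congr2 (fun p q => p - q) (congr2 (fun p q => p - q) E0 E1) E2))
  (etrans _ h).
rewrite /cov_torsion !plane_subE => /(_ erefl) /=.
abstract_pd; abstract_at x; move=> h; apply: subr0_eq; rewrite -[RHS]h; ring.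
Qed.

Lemma cur_parallel U G : open U -> smooth_christoffel U G ->
  (forall V X Y Z, smooth_on U V -> smooth_on U X -> smooth_on U Y -> smooth_on U Z ->
     forall x, U x -> cov_curvature G V X Y Z x = 0) ->
  curvature_system U G.
Proof.
move=> oU sG H a k j x Ux.
have sc (b : 'I_2) : smooth_on U (cst (coord_vec b : plane R)) by exact: smooth_cst.
have sce b : smooth_on U (cov G (cst (coord_vec a)) (cst (coord_vec b))) by exact: smooth_cov.
have cE i y : U y ->
    comp (curvature G (cst (coord_vec 0)) (cst (coord_vec 1)) (cst (coord_vec j))) i y = cur G i j y.
  move=> Uy; apply: (etrans (curvature_eval i oU sG (sc 0) (sc 1) (sc j) Uy
    (cst_coord 0 0 y) (cst_coord 0 1 y) (cst_coord 1 0 y) (cst_coord 1 1 y) (cst_coord j 0 y) (cst_coord j 1 y))).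
  by move: {Uy sc} j; apply: forall_I2 => /=; rewrite mulr1 mulr0 subr0 mul1r ?mulr1 ?mulr0 ?addr0 ?add0r.
have sC : smooth_on U (curvature G (cst (coord_vec 0)) (cst (coord_vec 1)) (cst (coord_vec j))).
  apply/smooth_on_coordP => // i; apply: (eq_smooth_on (f := cur G i j)) => //.
    by move=> y Uy; rewrite -(cE i y Uy).
  exact: smooth_cur.
have E0 : _ = pd a (cur G k j) x + (G a 0 k x * cur G 0 j x + G a 1 k x * cur G 1 j x) :=
  cov_coord_field G a k oU sC Ux cE.
have E1 := curvature_eval k oU sG (sce 0) (sc 1) (sc j) Ux (cov_coord G a 0 x 0) (cov_coord G a 0 x 1)
  (cst_coord 1 0 x) (cst_coord 1 1 x) (cst_coord j 0 x) (cst_coord j 1 x).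
have E2 := curvature_eval k oU sG (sc 0) (sce 1) (sc j) Ux (cst_coord 0 0 x) (cst_coord 0 1 x)
  (cov_coord G a 1 x 0) (cov_coord G a 1 x 1) (cst_coord j 0 x) (cst_coord j 1 x).
have E3 := curvature_eval k oU sG (sc 0) (sc 1) (sce j) Ux (cst_coord 0 0 x) (cst_coord 0 1 x)
  (cst_coord 1 0 x) (cst_coord 1 1 x) (cov_coord G a j x 0) (cov_coord G a j x 1).
have := congr1 (fun v : plane R => v 0 k) (H _ _ _ _ (sc a) (sc 0) (sc 1) (sc j) x Ux).
rewrite /= plane0E => h.
have {h} := etrans (esym (congr2 (fun p q => p - q) (congr2 (fun p q => p - q)
  (congr2 (fun p q => p - q) E0 E1) E2) E3)) (etrans _ h).
move=> /(_ (esym (plane_sub3E _ _ _ _ _))).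
move: {E0 E1 E2 E3 cE sC H sce sc} j; apply: forall_I2 => /=.
all: abstract_pd; abstract_at x; move=> h; apply: subr0_eq; rewrite -[RHS]h; ring.
Qed.

End TensorFields.

(** A trace-free endomorphism of the plane that kills a vector t != 0 has its image in the line of
    t, so it is a multiple of t (x) (- t1, t0). The skew part r01 - r10 = b (t0^2 + t1^2) determines
    the multiple. Each identity is checked after multiplication by the squared length of t. *)
Lemma rank_one_algebra (R : realType) (r00 r01 r10 r11 t0 t1 : R) :
  t0 * t0 + t1 * t1 != 0 -> r00 * t0 + r01 * t1 = 0 -> r10 * t0 + r11 * t1 = 0 ->
  r00 + r11 = 0 -> let b := (r01 - r10) / (t0 * t0 + t1 * t1) in
  [/\ r00 = - b * t0 * t1, r01 = b * t0 * t0, r10 = - b * t1 * t1 & r11 = b * t1 * t0].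
Proof.
move=> n0 h0 h1 h2 b; have r11E : r11 = - r00 by apply/eqP; rewrite -addr_eq0 addrC h2.
rewrite r11E in h1 *.
have key (p q : R) : p * (t0 * t0 + t1 * t1) = q * (t0 * t0 + t1 * t1) -> p = q by exact: mulIf.
have bE : b * (t0 * t0 + t1 * t1) = r01 - r10 by rewrite /b divfK.
have comb (p q : R) : p * (r00 * t0 + r01 * t1) + q * (r10 * t0 + - r00 * t1) = 0.
  by rewrite h0 h1 !mulr0 addr0.
split; apply: key.
- have -> : - b * t0 * t1 * (t0 * t0 + t1 * t1) = - (b * (t0 * t0 + t1 * t1)) * t0 * t1 by ring.
  by rewrite bE; apply: subr0_eq; rewrite -[RHS](comb (t0) (- t1)); ring.
- have -> : b * t0 * t0 * (t0 * t0 + t1 * t1) = b * (t0 * t0 + t1 * t1) * t0 * t0 by ring.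
  by rewrite bE; apply: subr0_eq; rewrite -[RHS](comb (t1) (t0)); ring.
- have -> : - b * t1 * t1 * (t0 * t0 + t1 * t1) = - (b * (t0 * t0 + t1 * t1)) * t1 * t1 by ring.
  by rewrite bE; apply: subr0_eq; rewrite -[RHS](comb (t1) (t0)); ring.
- have -> : b * t1 * t0 * (t0 * t0 + t1 * t1) = b * (t0 * t0 + t1 * t1) * t1 * t0 by ring.
  by rewrite bE; apply: subr0_eq; rewrite -[RHS](comb (- t0) (t1)); ring.
Qed.

(** * Algebraic consequences of parallel torsion and curvature *)

Section ParallelTorsion.
Context {R : realType}.
Variables (U : set (plane R)) (G : christoffel R).
Hypotheses (oU : open U) (sG : smooth_christoffel U G).
Hypothesis dtor : torsion_system U G.
Hypothesis dcur : curvature_system U G.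

Let st k : smooth_on U (tor G k).
Proof. exact: smooth_tor. Qed.

Let sr k j : smooth_on U (cur G k j).
Proof. exact: smooth_cur. Qed.

(** The Ricci identity for the parallel vector density t: curvature acts on it by r t from the
    vector index and by - (tr r) t from the weight, and the sum vanishes. *)
Lemma cur_tor x k : U x ->
  cur G k 0 x * tor G 0 x + cur G k 1 x * tor G 1 x = (cur G 0 0 x + cur G 1 1 x) * tor G k x.
Proof.
move=> Ux; have sc := schwarz oU (st k 2) Ux.
rewrite (eq_on_derive _ oU (fun y => @dtor 1 k y) Ux) in sc.
rewrite (eq_on_derive _ oU (fun y => @dtor 0 k y) Ux) in sc.
eassert (E1 : has_pd (fun x => (G 1 0 0 x + G 1 1 1 x) * tor G k x -
  (G 1 0 k x * tor G 0 x + G 1 1 k x * tor G 1 x)) x 0 _) by pd_rule.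
eassert (E0 : has_pd (fun x => (G 0 0 0 x + G 0 1 1 x) * tor G k x -
  (G 0 0 k x * tor G 0 x + G 0 1 k x * tor G 1 x)) x 1 _) by pd_rule.
move: sc; rewrite (has_pdE E1) (has_pdE E0) !dtor// /cur {E0 E1}.
abstract_pd; abstract_at x; move/eqP; rewrite -subr_eq0 => /eqP h; apply: subr0_eq.
by apply: oppr_inj; rewrite oppr0 -[RHS]h; ring.
Qed.

(** The Ricci identity for the parallel density r: on an endomorphism the curvature acts by the
    commutator, and r commutes with itself, so only the weight term (tr r) r survives. *)
Lemma trace_cur_mul x k j : U x -> (cur G 0 0 x + cur G 1 1 x) * cur G k j x = 0.
Proof.
move=> Ux; have sc := schwarz oU (sr k j 2) Ux.
rewrite (eq_on_derive _ oU (fun y => @dcur 1 k j y) Ux) in sc.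
rewrite (eq_on_derive _ oU (fun y => @dcur 0 k j y) Ux) in sc.
eassert (E1 : has_pd (fun x => (G 1 0 0 x + G 1 1 1 x) * cur G k j x -
  (G 1 0 k x * cur G 0 j x + G 1 1 k x * cur G 1 j x) +
  (G 1 j 0 x * cur G k 0 x + G 1 j 1 x * cur G k 1 x)) x 0 _) by pd_rule.
eassert (E0 : has_pd (fun x => (G 0 0 0 x + G 0 1 1 x) * cur G k j x -
  (G 0 0 k x * cur G 0 j x + G 0 1 k x * cur G 1 j x) +
  (G 0 j 0 x * cur G k 0 x + G 0 j 1 x * cur G k 1 x)) x 1 _) by pd_rule.
move: sc; rewrite (has_pdE E1) (has_pdE E0) !dcur// {E0 E1}.
(* The definition of [cur] is solved for one derivative of the symbols; substituting it eliminates
   these derivatives in favour of the curvature, which leaves a polynomial identity. *)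
have D a b : cur G a b x = pd 0 (G 1 b a) x - pd 1 (G 0 b a) x +
  (G 0 0 a x * G 1 b 0 x - G 1 0 a x * G 0 b 0 x) +
  (G 0 1 a x * G 1 b 1 x - G 1 1 a x * G 0 b 1 x) by [].
have D' a b : pd 0 (G 1 b a) x = cur G a b x + pd 1 (G 0 b a) x -
  (G 0 0 a x * G 1 b 0 x - G 1 0 a x * G 0 b 0 x) -
  (G 0 1 a x * G 1 b 1 x - G 1 1 a x * G 0 b 1 x).
  by rewrite D; abstract_pd; abstract_at x; ring.
rewrite !D' {D D'}.
abstract_pd; abstract_at x; move/eqP; rewrite -subr_eq0 => /eqP h.
by rewrite -[RHS]h; ring.
Qed.

Lemma trace_cur x : U x -> cur G 0 0 x + cur G 1 1 x = 0.
Proof.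
move=> Ux; have h0 := trace_cur_mul 0 0 Ux; have h1 := trace_cur_mul 1 1 Ux.
have /eqP : (cur G 0 0 x + cur G 1 1 x) * (cur G 0 0 x + cur G 1 1 x) = 0.
  by rewrite mulrDr h0 h1 addr0.
by rewrite mulf_eq0 orbb => /eqP.
Qed.

Lemma cur_tor_eq0 x k : U x -> cur G k 0 x * tor G 0 x + cur G k 1 x * tor G 1 x = 0.
Proof. by move=> Ux; rewrite cur_tor// trace_cur// mul0r. Qed.

Definition tor_norm2 x := tor G 0 x * tor G 0 x + tor G 1 x * tor G 1 x.

(* As [cur G] kills [tor G] and is trace free, it equals
   [cur_ratio *: tor (x) tau] with [tau = (- tor 1, tor 0)]. *)
Definition cur_ratio x := (cur G 0 1 x - cur G 1 0 x) / tor_norm2 x.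

Lemma tor_norm2_neq0 x : (exists k, tor G k x != 0) -> tor_norm2 x != 0.
Proof.
move=> [k tk]; rewrite /tor_norm2 paddr_eq0 -?expr2 ?sqr_ge0// !sqrf_eq0 negb_and.
by move: k tk; apply: forall_I2 => ->; rewrite ?orbT.
Qed.

Lemma curE x : U x -> (exists k, tor G k x != 0) ->
  [/\ cur G 0 0 x = - cur_ratio x * tor G 0 x * tor G 1 x,
      cur G 0 1 x = cur_ratio x * tor G 0 x * tor G 0 x,
      cur G 1 0 x = - cur_ratio x * tor G 1 x * tor G 1 x &
      cur G 1 1 x = cur_ratio x * tor G 1 x * tor G 0 x].
Proof.
move=> Ux tx; have n0 := tor_norm2_neq0 tx; have := trace_cur Ux.
have := cur_tor_eq0 1 Ux; have := cur_tor_eq0 0 Ux.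
rewrite /cur_ratio; move: n0; rewrite /tor_norm2; abstract_at x.
exact: rank_one_algebra.
Qed.

End ParallelTorsion.

Section CurvatureRatio.
Context {R : realType}.

Lemma ratio_derivative_algebra (t0 t1 b r00 r01 r10 r11 g00 g01 g10 g11 : R) :
  t0 * t0 + t1 * t1 != 0 ->
  [/\ r00 = - b * t0 * t1, r01 = b * t0 * t0, r10 = - b * t1 * t1 & r11 = b * t1 * t0] ->
  let tr := g00 + g11 in
  let d0 := tr * t0 - (g00 * t0 + g10 * t1) in
  let d1 := tr * t1 - (g01 * t0 + g11 * t1) in
  let d01 := tr * r01 - (g00 * r01 + g10 * r11) + (g10 * r00 + g11 * r01) in
  let d10 := tr * r10 - (g01 * r00 + g11 * r10) + (g00 * r10 + g01 * r11) in
  (r01 - r10) * (- ((t0 * t0 + t1 * t1)^-1 * (t0 * t0 + t1 * t1)^-1) *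
    (t0 * d0 + t0 * d0 + (t1 * d1 + t1 * d1))) +
  (t0 * t0 + t1 * t1)^-1 * (d01 + - d10) = 0.
Proof.
move=> n0 [-> -> -> ->] /=; field; first exact: n0.
Qed.

(** In r = b t (x) tau both r and t (x) tau are parallel and of the same weight, so the factor b has
    zero derivative. *)
Lemma pd_cur_ratio (U : set (plane R)) (G : christoffel R) x a :
  open U -> smooth_christoffel U G ->
  torsion_system U G ->
  curvature_system U G ->
  U x -> (exists k, tor G k x != 0) -> has_pd (cur_ratio G) x a 0.
Proof.
move=> oU sG dtor dcur Ux tx; have n0 := tor_norm2_neq0 tx.
have rE := curE oU sG dtor dcur Ux tx.
have st k : smooth_on U (tor G k) by exact: smooth_tor.
have sr k j : smooth_on U (cur G k j) by exact: smooth_cur.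
eassert (E : has_pd (fun x => (cur G 0 1 x - cur G 1 0 x) * (tor_norm2 G x)^-1) x a _).
  unfold tor_norm2; pd_rule; exact: n0.
apply: has_pd_eq E _; rewrite !dtor// !dcur//; move: n0 rE; rewrite /tor_norm2.
abstract_at x; exact: ratio_derivative_algebra.
Qed.

End CurvatureRatio.

(** * The local normal form *)

Section AdaptedCoframe.
Context {R : realType}.
Implicit Types (U W : set (plane R)) (G : christoffel R) (z : plane R).

Lemma open_subset_nbhs z (P : set (plane R)) : nbhs z P ->
  exists W, [/\ open W, W z & W `<=` P].
Proof.
move=> /(nbhs_ballP z)[r r0 rP]; exists (ball z r).
by split => //; [exact: ball_open|exact: ballxx].
Qed.

Definition rank_one_curvature U G (b : R) := forall x, U x ->
  [/\ cur G 0 0 x = - b * tor G 0 x * tor G 1 x, cur G 0 1 x = b * tor G 0 x * tor G 0 x,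
      cur G 1 0 x = - b * tor G 1 x * tor G 1 x & cur G 1 1 x = b * tor G 1 x * tor G 0 x].

(* [y] is a potential of [tau / u]; [s] is a coframe with [s (tor) > 0] which is
   parallel up to multiples of [dy], and [c] is its connection form. *)
Definition adapted_coframe W G (b u : R) (y : plane R -> R) (s : 'I_2 -> plane R -> R)
    (c : 'I_2 -> plane R -> R) :=
  forall x, W x ->
  [/\ pd 0 y x = - tor G 1 x / u /\ pd 1 y x = tor G 0 x / u,
      0 < s 0 x * tor G 0 x + s 1 x * tor G 1 x,
      (forall a j, pd a (s j) x = G a j 0 x * s 0 x + G a j 1 x * s 1 x + c a x * pd j y x) &
      pd 0 (c 1) x - pd 1 (c 0) x = - (b * u) * (s 0 x * tor G 0 x + s 1 x * tor G 1 x)].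

(** Closedness of tau means that the divergence of t is zero. By parallelism the divergence reduces
    to the skew part of the symbols contracted with t, which is 2 (t1 t0 - t0 t1). *)
Lemma torsion_potential U G (u : R) z : open U -> U z -> smooth_christoffel U G ->
  torsion_system U G -> exists W y, [/\ open W, W z, W `<=` U, y z = 0 /\ smooth_on W y &
    forall x, W x -> pd 0 y x = - tor G 1 x / u /\ pd 1 y x = tor G 0 x / u].
Proof.
move=> oU Uz sG dtor; have st k : smooth_on U (tor G k) by exact: smooth_tor.
pose P (i : 'I_2) := if i == 0 then (fun x => - tor G 1 x * u^-1) else (fun x => tor G 0 x * u^-1).
have [||W [y [oW Wz WU yz [sy dy]]]] := @poincare _ U P z 0 oU Uz.
- by apply: forall_I2; rewrite /P /=; smooth_rule.
- move=> x Ux; rewrite /P /=.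
  eassert (E0 : has_pd (fun x => tor G 0 x * u^-1) x 0 _) by pd_rule.
  eassert (E1 : has_pd (fun x => - tor G 1 x * u^-1) x 1 _) by pd_rule.
  rewrite (has_pdE E0) (has_pdE E1) !dtor// /tor; abstract_at x; ring.
exists W, y; split => // x Wx.
by have [_ ->] := dy 0 x Wx; have [_ ->] := dy 1 x Wx.
Qed.

(** The curl of the trace of the connection is tr r, so the trace has a potential [phi]; then
    exp(phi) dx^1 ^ dx^2 is a parallel area form. *)
Lemma trace_potential U G z : open U -> U z -> smooth_christoffel U G ->
  (forall x, U x -> cur G 0 0 x + cur G 1 1 x = 0) ->
  exists W phi, [/\ open W, W z, W `<=` U, smooth_on W phi &
    forall a x, W x -> pd a phi x = G a 0 0 x + G a 1 1 x].
Proof.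
move=> oU Uz sG trG.
have [||W [y [oW Wz WU yz [sy dy]]]] := @poincare _ U (fun i x => G i 0 0 x + G i 1 1 x) z 0 oU Uz.
- by move=> i; smooth_rule.
- move=> x Ux.
  eassert (E0 : has_pd (fun x => G 1 0 0 x + G 1 1 1 x) x 0 _) by pd_rule.
  eassert (E1 : has_pd (fun x => G 0 0 0 x + G 0 1 1 x) x 1 _) by pd_rule.
  rewrite (has_pdE E0) (has_pdE E1); apply: subr0_eq; rewrite -(trG x Ux) /cur.
  by abstract_pd; abstract_at x; ring.
exists W, y; split => // a x Wx.
by have [_ ->] := dy a x Wx.
Qed.

(** With the area density [a] = exp(phi), the choice s = (a / t_p) dx^p at an index with t_p != 0
    has s(t) = a. The equation for dc is the Ricci identity for s: r acts on s by b s(t) tau = b u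
    s(t) dy. *)
Lemma adapted_coframe_exists U G (b u : R) z : open U -> U z -> smooth_christoffel U G ->
  torsion_system U G -> rank_one_curvature U G b -> u != 0 -> (exists k, tor G k z != 0) ->
  exists W y s c, [/\ open W /\ W z, W `<=` U /\ y z = 0, smooth_on W y,
    (forall i, smooth_on W (s i)) /\ (forall i, smooth_on W (c i)) & adapted_coframe W G b u y s c].
Proof.
move=> oU Uz sG dtor rG u0 [p tp].
have [W1 [y [oW1 W1z W1U [yz sy] dy]]] := torsion_potential u oU Uz sG dtor.
have [|W2 [phi [oW2 W2z W2U sphi dphi]]] := trace_potential oU Uz sG.
  by move=> x /rG[-> _ _ ->]; move: (tor G 0 x) (tor G 1 x) => *; ring.
have st k : smooth_on U (tor G k) by exact: smooth_tor.
have nt := near_neq0 (smooth_on_continuous (st p) Uz) tp.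
have n1 : nbhs z W1 by exact: open_nbhs_nbhs.
have n2 : nbhs z W2 by exact: open_nbhs_nbhs.
have [W [oW Wz WP]] := open_subset_nbhs (filterI nt (filterI n1 n2)).
have WW1 : W `<=` W1 by move=> x /WP[_ []].
have WW2 : W `<=` W2 by move=> x /WP[_ []].
have WU : W `<=` U by move=> x /WW1/W1U.
have tp0 x : W x -> tor G p x != 0 by move=> /WP[].
have sGW i j k : smooth_on W (G i j k) by exact: smooth_on_sub (sG i j k).
have stW k : smooth_on W (tor G k) by exact: smooth_on_sub (st k).
have syW : smooth_on W y by exact: smooth_on_sub sy.
pose a x := expR (phi x).
have sa : smooth_on W a by move=> n; apply: Ck_on_expR => //; exact: smooth_on_sub sphi n.
have da i x : W x -> pd i a x = a x * (G i 0 0 x + G i 1 1 x).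
  move=> Wx; rewrite -(dphi i x (WW2 _ Wx)).
  apply: has_pdE; apply: has_pd_expR; exact: has_pd_smooth sphi (WW2 _ Wx).
have a0 x : 0 < a x by exact: expR_gt0.
have iV : smooth_on W (fun x => (tor G p x)^-1) by apply: smooth_onV.
have [p0|p1] : p = 0 \/ p = 1 by move: p {tp nt WP tp0 iV}; apply: forall_I2; [left|right].
- rewrite p0 in tp0 iV.
  pose s (j : 'I_2) := if j == 0 then (fun x => a x * (tor G 0 x)^-1) else (fun=> 0).
  (* Read off from the component j = 1 of nabla s = c (x) dy, where s_1 = 0 and dy has the component
     t_0 / u. The case p = 1 uses j = 0, hence the opposite sign there. *)
  pose c (i : 'I_2) (x : plane R) := - u * G i 1 0 x * a x * ((tor G 0 x)^-1 * (tor G 0 x)^-1).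
  exists W, y, s, c; split => //.
    split; first by apply: forall_I2; rewrite /s /=; smooth_rule.
    by move=> i; rewrite /c; smooth_rule.
  move=> x Wx; have Ux := WU _ Wx; have t0 := tp0 x Wx; have [y0 y1] := dy x (WW1 _ Wx).
  split => //.
  + by rewrite /s /= mulfVK// mul0r addr0.
  + move=> i.
    eassert (E0 : has_pd (fun x => a x * (tor G 0 x)^-1) x i _) by (pd_rule; exact: t0).
    apply: forall_I2; rewrite /s /c /= ?y0 ?y1.
    * rewrite (has_pdE E0) da// dtor//; move: t0 u0; abstract_at x; move: (a x) => A h1 h2.
      by field; rewrite h1 h2.
    * rewrite pd_cst; move: t0 u0; abstract_at x; move: (a x) => A h1 h2.
      by field; rewrite h1 h2.
  + eassert (E0 : has_pd (c 1) x 0 _) by (unfold c; pd_rule; exact: t0).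
    eassert (E1 : has_pd (c 0) x 1 _) by (unfold c; pd_rule; exact: t0).
    have [_ h _ _] := rG x Ux.
    rewrite (has_pdE E0) (has_pdE E1) !da// !dtor// /s /=.
    have h' : pd 0 (G 1 1 0) x = b * tor G 0 x * tor G 0 x + pd 1 (G 0 1 0) x -
        (G 0 0 0 x * G 1 1 0 x - G 1 0 0 x * G 0 1 0 x) -
        (G 0 1 0 x * G 1 1 1 x - G 1 1 0 x * G 0 1 1 x).
      by rewrite -h /cur; abstract_pd; abstract_at x; ring.
    rewrite h'; have g : G 1 0 1 x = G 0 1 1 x - 2 * tor G 1 x by rewrite /tor; abstract_at x; field.
    have g' : G 1 0 0 x = G 0 1 0 x - 2 * tor G 0 x by rewrite /tor; abstract_at x; field.
    rewrite ?g ?g' {h h' g g' E0 E1}; move: t0 u0; abstract_pd; abstract_at x; move: (a x) => A h1 h2.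
    by field; rewrite h1.
- rewrite p1 in tp0 iV.
  pose s (j : 'I_2) := if j == 0 then (fun=> 0) else (fun x => a x * (tor G 1 x)^-1).
  pose c (i : 'I_2) (x : plane R) := u * G i 0 1 x * a x * ((tor G 1 x)^-1 * (tor G 1 x)^-1).
  exists W, y, s, c; split => //.
    split; first by apply: forall_I2; rewrite /s /=; smooth_rule.
    by move=> i; rewrite /c; smooth_rule.
  move=> x Wx; have Ux := WU _ Wx; have t0 := tp0 x Wx; have [y0 y1] := dy x (WW1 _ Wx).
  split => //.
  + by rewrite /s /= mulfVK// mul0r add0r.
  + move=> i.
    eassert (E0 : has_pd (fun x => a x * (tor G 1 x)^-1) x i _) by (pd_rule; exact: t0).
    apply: forall_I2; rewrite /s /c /= ?y0 ?y1.
    * rewrite pd_cst; move: t0 u0; abstract_at x; move: (a x) => A h1 h2.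
      by field; rewrite h1 h2.
    * rewrite (has_pdE E0) da// dtor//; move: t0 u0; abstract_at x; move: (a x) => A h1 h2.
      by field; rewrite h1 h2.
  + eassert (E0 : has_pd (c 1) x 0 _) by (unfold c; pd_rule; exact: t0).
    eassert (E1 : has_pd (c 0) x 1 _) by (unfold c; pd_rule; exact: t0).
    have [_ _ h _] := rG x Ux.
    rewrite (has_pdE E0) (has_pdE E1) !da// !dtor// /s /=.
    have h' : pd 0 (G 1 0 1) x = - b * tor G 1 x * tor G 1 x + pd 1 (G 0 0 1) x -
        (G 0 0 1 x * G 1 0 0 x - G 1 0 1 x * G 0 0 0 x) -
        (G 0 1 1 x * G 1 0 1 x - G 1 1 1 x * G 0 0 1 x).
      by rewrite -h /cur; abstract_pd; abstract_at x; ring.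
    rewrite h'; have g : G 1 0 1 x = G 0 1 1 x - 2 * tor G 1 x by rewrite /tor; abstract_at x; field.
    have g' : G 1 0 0 x = G 0 1 0 x - 2 * tor G 0 x by rewrite /tor; abstract_at x; field.
    rewrite ?g ?g' {h h' g g' E0 E1}; move: t0 u0; abstract_pd; abstract_at x; move: (a x) => A h1 h2.
    by field; rewrite h1.
Qed.

End AdaptedCoframe.

Section NormalForm.
Context {R : realType}.
Variables (U : set (plane R)) (G : christoffel R) (u e : R).
Variables (y : plane R -> R) (s c : 'I_2 -> plane R -> R).
Hypotheses (oU : open U) (sy : smooth_on U y).
Hypotheses (ss : forall i, smooth_on U (s i)) (sc : forall i, smooth_on U (c i)).
Hypothesis torE : forall x, U x ->
  G 0 1 0 x = G 1 0 0 x + 2 * u * pd 1 y x /\ G 0 1 1 x = G 1 0 1 x - 2 * u * pd 0 y x.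
Hypothesis ds : forall a j x, U x ->
  pd a (s j) x = G a j 0 x * s 0 x + G a j 1 x * s 1 x + c a x * pd j y x.
Hypothesis dc : forall x, U x ->
  pd 0 (c 1) x = pd 1 (c 0) x - e * (s 0 x * pd 1 y x - s 1 x * pd 0 y x).

Let y_ i : plane R -> R := pd i y.
Let sy_ i : smooth_on U (y_ i).
Proof. exact: smooth_on_pd. Qed.
Let y_sym x : U x -> pd 0 (y_ 1) x = pd 1 (y_ 0) x.
Proof. by move=> Ux; exact: schwarz oU (sy 2) Ux. Qed.

(* The system for [g] and [n] is solved by quadratures: the substitution
   [n = K / (E w) + w1 m], [g = w m] turns it into closed forms for [dK] and [dm]. *)
Lemma damped_potential (E w w1 : plane R -> R) z : U z ->
  smooth_on U E -> smooth_on U w -> smooth_on U w1 ->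
  (forall x, U x -> 0 < E x) -> (forall x, U x -> 0 < w x) ->
  (forall i x, U x -> pd i E x = E x * (2 * u * y_ i x)) ->
  (forall i x, U x -> pd i w x = w1 x * y_ i x) ->
  (forall i x, U x -> pd i w1 x = (- (2 * u) * w1 x - e * w x) * y_ i x) ->
  exists (W : set (plane R)) (g n : plane R -> R),
  [/\ open W /\ W z, W `<=` U, smooth_on W g /\ smooth_on W n, g z = w z &
    forall i x, W x -> pd i g x = s i x + n x * y_ i x /\
      pd i n x = - (c i x + 2 * u * s i x + (2 * u * n x + e * g x) * y_ i x)].
Proof.
move=> Uz sE sw sw1 E0 w0 dE dw dw1.
(* [K] = E (w n - w1 g) is the Wronskian of g and w weighted by Abel's factor E = exp(2 u y) up to a
   constant. The unknowns cancel in its differential, which leaves the given closed form. *)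
have [||W1 [K [oW1 W1z W1U _ [sK dK]]]] := @poincare _ U
  (fun i x => - (E x * (w x * (c i x + 2 * u * s i x) + w1 x * s i x))) z 0 oU Uz.
- by move=> i; smooth_rule.
- move=> x Ux.
  eassert (H1 : has_pd (fun x => - (E x * (w x * (c 1 x + 2 * u * s 1 x) + w1 x * s 1 x))) x 0 _) by pd_rule.
  eassert (H0 : has_pd (fun x => - (E x * (w x * (c 0 x + 2 * u * s 0 x) + w1 x * s 0 x))) x 1 _) by pd_rule.
  refine (etrans (has_pdE H1) (etrans _ (esym (has_pdE H0)))) => {H0 H1}.
  rewrite !(dE _ _ Ux) !(dw _ _ Ux) !(dw1 _ _ Ux) (dc Ux) (ds 0 1 Ux) (ds 1 0 Ux).
  have [-> ->] := torE Ux; rewrite /y_; cbv beta.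
  abstract_pd; abstract_at x.
  move: (E x) (w x) (w1 x) (c 0 x) (c 1 x) (s 0 x) (s 1 x) => *; ring.
have sub (f : plane R -> R) : smooth_on U f -> smooth_on W1 f := smooth_on_sub W1U.
have [[sE' sw'] sw1'] := (sub _ sE, sub _ sw, sub _ sw1).
have ss' i := sub _ (ss i); have sc' i := sub _ (sc i); have sy' i := sub _ (sy_ i).
have E0' x : W1 x -> E x != 0 by move=> /W1U/E0/gt_eqF ->.
have w0' x : W1 x -> w x != 0 by move=> /W1U/w0/gt_eqF ->.
have dKE i x : W1 x -> pd i K x = - (E x * (w x * (c i x + 2 * u * s i x) + w1 x * s i x)).
  by move=> W1x; have [_ ->] := dK i x W1x.
have [||W2 [m [oW2 W2z W2W mz [sm dm]]]] := @poincare _ W1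
  (fun i x => s i x * (w x)^-1 + K x * y_ i x * ((E x)^-1 * ((w x)^-1 * (w x)^-1))) z 1 oW1 W1z.
- by move=> i; smooth_rule.
- move=> x W1x; have Ux := W1U _ W1x; have Ex0 := E0' _ W1x; have wx0 := w0' _ W1x.
  eassert (H1 : has_pd (fun x => s 1 x * (w x)^-1 + K x * y_ 1 x * ((E x)^-1 * ((w x)^-1 * (w x)^-1))) x 0 _).
    by pd_rule.
  eassert (H0 : has_pd (fun x => s 0 x * (w x)^-1 + K x * y_ 0 x * ((E x)^-1 * ((w x)^-1 * (w x)^-1))) x 1 _).
    by pd_rule.
  refine (etrans (has_pdE H1) (etrans _ (esym (has_pdE H0)))) => {H0 H1}.
  rewrite !(dE _ _ Ux) !(dw _ _ Ux) !(dKE _ _ W1x) (ds 0 1 Ux) (ds 1 0 Ux) (y_sym Ux).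
  have [-> ->] := torE Ux; rewrite /y_; cbv beta.
  move: Ex0 wx0; abstract_pd; abstract_at x.
  move: (K x) (E x) (w x) (w1 x) (c 0 x) (c 1 x) (s 0 x) (s 1 x) => k E1 w2 w3 c0 c1 s0' s1' h1 h2.
  by field; rewrite h1 h2.
have W2U : W2 `<=` U by move=> x /W2W/W1U.
have sub2 (f : plane R -> R) : smooth_on W1 f -> smooth_on W2 f := smooth_on_sub W2W.
have [[sE2 sw2] sw12] := (sub2 _ sE', sub2 _ sw', sub2 _ sw1').
have sK2 := sub2 _ sK.
have E2 x : W2 x -> E x != 0 by move=> /W2W/E0'.
have w2 x : W2 x -> w x != 0 by move=> /W2W/w0'.
have dmE i x : W2 x -> pd i m x = s i x * (w x)^-1 + K x * y_ i x * ((E x)^-1 * ((w x)^-1 * (w x)^-1)).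
  by move=> W2x; have [_ ->] := dm i x W2x.
exists W2, (fun x => w x * m x), (fun x => K x * ((E x)^-1 * (w x)^-1) + w1 x * m x); split => //.
- by split; smooth_rule; first [exact: E2|exact: w2].
- by rewrite mz mulr1.
move=> i x W2x; have Ux := W2U _ W2x; have Ex0 := E2 _ W2x; have wx0 := w2 _ W2x.
have W1x := W2W _ W2x.
eassert (H1 : has_pd (fun x => w x * m x) x i _) by pd_rule.
eassert (H0 : has_pd (fun x => K x * ((E x)^-1 * (w x)^-1) + w1 x * m x) x i _).
  by pd_rule.
rewrite (has_pdE H0) (has_pdE H1) (dmE _ _ W2x) (dE _ _ Ux) (dw _ _ Ux) (dw1 _ _ Ux) (dKE _ _ W1x) {H0 H1}.
move: Ex0 wx0.
move: (K x) (m x) (E x) (w x) (w1 x) (c i x) (s i x) (y_ i x) => k m' E1 w3 w4 c0 s0' y0 h1 h2.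
by split; field; rewrite ?h1 ?h2.
Qed.

End NormalForm.

Section LocalModel.
Context {R : realType}.
Implicit Types (U W : set (plane R)) (G : christoffel R) (F : plane R -> plane R) (x z v w : plane R).

(* The second-order equation expressing that [F] intertwines the connections [G]
   and [G']. *)
Definition connection_law W G G' F := forall a b k x, W x ->
  pd a (pd b (comp F k)) x = G a b 0 x * pd 0 (comp F k) x + G a b 1 x * pd 1 (comp F k) x -
    gam G' (F x) (pd a F x) (pd b F x) 0 k.

Lemma near_gt0 (f : plane R -> R) z : {for z, continuous f} -> 0 < f z ->
  nbhs z [set x | 0 < f x].
Proof.
move=> cf f0; have /cvgrPdist_lt/(_ _ f0)/nbhs_plane[r r0 H] := cf.
apply/nbhs_plane; exists r => // h /H /=; rewrite ltr_norml => /andP[_].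
by rewrite ltrBlDr ltrDl.
Qed.

Definition model_symbols (u e : R) : christoffel R :=
  @chart_symbols R (plane_model 1 (2 * u) e) tt.

Lemma gam_model0 (u e : R) x v w (v0 v1 w0 w1 : R) :
  v 0 0 = v0 -> v 0 1 = v1 -> w 0 0 = w0 -> w 0 1 = w1 ->
  gam (model_symbols u e) x v w 0 0 = v0 * w0 + 2 * u * v0 * w1 + e * v1 * w1.
Proof. by move=> <- <- <- <-; rewrite gamE /model_symbols /chart_symbols /=; ring. Qed.

Lemma gam_model1 (u e : R) x v w : gam (model_symbols u e) x v w 0 1 = 0.
Proof. by rewrite gamE /model_symbols /chart_symbols /=; ring. Qed.

Lemma log_hessian (g ga gb h q : R) (G0 G1 g0 g1 ya yb u e : R) : g != 0 ->
  h = G0 * g0 + G1 * g1 - 2 * u * ga * yb - e * g * ya * yb ->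
  g^-1 * h + gb * (- (g^-1 * g^-1) * ga) = G0 * (g^-1 * g0) + G1 * (g^-1 * g1) -
    (g^-1 * ga * (g^-1 * gb) + 2 * u * (g^-1 * ga) * yb + e * ya * yb).
Proof. by move=> g0' ->; field. Qed.

Lemma has_pd_ln (f : plane R -> R) x i d : 0 < f x -> has_pd f x i d ->
  has_pd (fun y => ln (f y)) x i ((f x)^-1 * d).
Proof.
move=> f0 /has_pd_is_derive df; apply: is_derive_has_pd.
exact: is_derive_scalar_comp (is_derive1_ln f0) df.
Qed.

(* The equation for the first coordinate of an affine map to the model becomes
   linear in its exponential [g]. *)
Lemma log_map_law W G (u e : R) (g y : plane R -> R) : open W ->
  smooth_christoffel W G -> smooth_on W g -> smooth_on W y -> (forall x, W x -> 0 < g x) ->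
  (forall a j x, W x -> pd a (pd j y) x = G a j 0 x * pd 0 y x + G a j 1 x * pd 1 y x) ->
  (forall a j x, W x -> pd a (pd j g) x = G a j 0 x * pd 0 g x + G a j 1 x * pd 1 g x -
     2 * u * pd a g x * pd j y x - e * g x * pd a y x * pd j y x) ->
  let F x : plane R := \row_k (if k == 0 then ln (g x) else y x) in
  [/\ smooth_on W F, connection_law W G (model_symbols u e) F &
    forall x, W x -> jac F x = (g x)^-1 * (pd 0 g x * pd 1 y x - pd 1 g x * pd 0 y x)].
Proof.
move=> oW sG sg sy g0 hy hg F.
have F0 : comp F 0 = (fun x => ln (g x)) by apply/funext => x; rewrite /comp mxE.
have F1 : comp F 1 = y by apply/funext => x; rewrite /comp mxE.
have sF k : smooth_on W (comp F k).
  move: k; apply: forall_I2; rewrite ?F0 ?F1 // => n.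
  by apply: Ck_on_ln.
have sFF : smooth_on W F by apply/smooth_on_coordP.
have dg i x : W x -> pd i (fun x => ln (g x)) x = (g x)^-1 * pd i g x.
  by move=> Wx; apply: has_pdE; apply: has_pd_ln; [exact: g0|exact: has_pd_smooth sg Wx].
have dF a x : W x -> (pd a F x) 0 0 = (g x)^-1 * pd a g x /\ (pd a F x) 0 1 = pd a y x.
  move=> Wx; have dFx : derivable F x (coord_vec a) by exact: smooth_on_derivable sFF Wx.
  rewrite !derive_coord// -/(comp F 0) -/(comp F 1) F0 F1; split => //; exact: dg.
split => //.
- move=> a b; apply: forall_I2 => x Wx.
  + have [a0 a1] := dF a x Wx; have [b0 b1] := dF b x Wx.
    refine (etrans _ (congr1 (fun t => _ - t) (esym (gam_model0 u e (F x) a0 a1 b0 b1)))).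
    rewrite F0 (dg 0 x Wx) (dg 1 x Wx).
    refine (etrans (eq_on_derive _ oW (fun y => dg b y) Wx) _).
    have gn0 : g x != 0 by rewrite gt_eqF// g0.
    eassert (E : has_pd (fun x => (g x)^-1 * pd b g x) x a _).
      by pd_rule.
    refine (etrans (has_pdE E) _) => {E}.
    apply: log_hessian => //; exact: hg.
  + refine (etrans _ (congr1 (fun t => _ - t) (esym (gam_model1 u e (F x) _ _)))).
    by rewrite F1 subr0; exact: hy.
- move=> x Wx; rewrite /jac -/(comp F 0) -/(comp F 1) F0 F1 !dg//.
  by move: (_^-1) => q; abstract_pd; ring.
Qed.

(** As dg = s + n dy and both nabla dy = 0 and nabla s = c (x) dy, the Hessian of g is (c + dn) (x)
    dy; the equation for dn is the one that makes it - 2 u dg (x) dy - e g dy (x) dy. The unknown n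
    drops out of dg ^ dy = s ^ dy, which is non-zero because s(t) > 0. *)
Lemma local_normal_form U G (b u e : R) z : open U -> U z -> smooth_christoffel U G ->
  torsion_system U G -> rank_one_curvature U G b -> (exists k, tor G k z != 0) ->
  0 < u -> b * (u * u) = e ->
  exists W F, [/\ open W /\ W z, W `<=` U, smooth_on W F,
    connection_law W G (model_symbols u e) F & jac F z != 0].
Proof.
move=> oU Uz sG dtor rG tz u0 be; have un0 : u != 0 by rewrite gt_eqF.
have [W1 [y [s [c [[oW1 W1z] [W1U yz] sy [ss sc] cof]]]]] :=
  adapted_coframe_exists oU Uz sG dtor rG un0 tz.
have dy x : W1 x -> pd 0 y x = - tor G 1 x / u /\ pd 1 y x = tor G 0 x / u by move=> /cof[].
have st k : smooth_on W1 (tor G k) by apply: smooth_on_sub W1U _; exact: smooth_tor.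
have sG1 i j k : smooth_on W1 (G i j k) by exact: smooth_on_sub (sG i j k).
have dy2 a j x : W1 x -> pd a (pd j y) x = G a j 0 x * pd 0 y x + G a j 1 x * pd 1 y x.
  move=> W1x; have Ux := W1U _ W1x; have [y0 y1] := dy x W1x; rewrite y0 y1.
  move: j; apply: forall_I2.
  - rewrite (eq_on_derive _ oW1 (fun x W1x => (dy x W1x).1) W1x).
    eassert (E : has_pd (fun x => - tor G 1 x * u^-1) x a _) by pd_rule.
    refine (etrans (has_pdE E) _); rewrite dtor//; abstract_at x; ring.
  - rewrite (eq_on_derive _ oW1 (fun x W1x => (dy x W1x).2) W1x).
    eassert (E : has_pd (fun x => tor G 0 x * u^-1) x a _) by pd_rule.
    refine (etrans (has_pdE E) _); rewrite dtor//; abstract_at x; ring.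
have torE x : W1 x -> G 0 1 0 x = G 1 0 0 x + 2 * u * pd 1 y x /\
    G 0 1 1 x = G 1 0 1 x - 2 * u * pd 0 y x.
  by move=> /dy[-> ->]; rewrite /tor; abstract_at x; split; field.
have ds a j x : W1 x -> pd a (s j) x = G a j 0 x * s 0 x + G a j 1 x * s 1 x + c a x * pd j y x.
  by move=> /cof[].
have tE x : W1 x -> s 0 x * tor G 0 x + s 1 x * tor G 1 x =
    u * (s 0 x * pd 1 y x - s 1 x * pd 0 y x).
  by move=> /dy[-> ->]; move: (s 0 x) (s 1 x); abstract_at x => *; field.
have dc x : W1 x -> pd 0 (c 1) x = pd 1 (c 0) x - e * (s 0 x * pd 1 y x - s 1 x * pd 0 y x).
  move=> W1x; have [_ _ _] := cof x W1x; rewrite tE// -be => /eqP; rewrite subr_eq => /eqP ->.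
  by move: (s 0 x) (s 1 x); abstract_pd => *; ring.
have [w [w1 [w00 dw dw1]]] := damped_oscillator u e.
have [sw sw1] := smooth_on_damped_oscillator oW1 dw dw1 sy.
(* The potential is normalized by y(z) = 0 for this purpose: w(0) = 1. Elsewhere w may change sign,
   so the domain shrinks. *)
have wz : 0 < w (y z) by rewrite yz w00.
have [W2 [oW2 W2z W2P]] := open_subset_nbhs (filterI (near_gt0 (smooth_on_continuous sw W1z) wz)
  (open_nbhs_nbhs (conj oW1 W1z))).
have W21 : W2 `<=` W1 by move=> x /W2P[].
have sE : smooth_on W1 (fun x => expR (2 * u * y x)).
  by move=> n; apply: Ck_on_expR => //; apply: Ck_onZ => //; exact: sy.
have dEx i x : W1 x -> pd i (fun x => expR (2 * u * y x)) x = expR (2 * u * y x) * (2 * u * pd i y x).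
  move=> W1x; eassert (E : has_pd (fun x => 2 * u * y x) x i _) by pd_rule.
  rewrite (has_pdE (has_pd_expR E)); move: (expR _); abstract_pd => *; ring.
have dcomp (h dh : R -> R) i x : (forall t, is_derive t (1 : R) h (dh t)) -> W1 x ->
    pd i (fun x => h (y x)) x = dh (y x) * pd i y x.
  move=> Hh W1x; have := is_derive_scalar_comp (Hh (y x)) (Ck_on_is_derive i (sy 1) W1x).
  by case.
have [W3 [g [n [[oW3 W3z] W32 [sg sn] gz dgn]]]] := damped_potential oW2
  (smooth_on_sub W21 sy) (fun i => smooth_on_sub W21 (ss i)) (fun i => smooth_on_sub W21 (sc i))
  (fun x W2x => torE x (W21 _ W2x)) (fun a j x W2x => ds a j x (W21 _ W2x))
  (fun x W2x => dc x (W21 _ W2x)) W2z (smooth_on_sub W21 sE) (smooth_on_sub W21 sw)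
  (smooth_on_sub W21 sw1) (fun x _ => expR_gt0 _) (fun x W2x => (W2P x W2x).1)
  (fun i x W2x => dEx i x (W21 _ W2x)) (fun i x W2x => dcomp _ _ i x dw (W21 _ W2x))
  (fun i x W2x => dcomp _ _ i x dw1 (W21 _ W2x)).
have gz0 : 0 < g z by rewrite gz.
have [W [oW Wz WP]] := open_subset_nbhs (filterI (near_gt0 (smooth_on_continuous sg W3z) gz0)
  (open_nbhs_nbhs (conj oW3 W3z))).
have W_3 : W `<=` W3 by move=> x /WP[].
have W_1 : W `<=` W1 by move=> x /W_3/W32/W21.
have hg a j x : W x -> pd a (pd j g) x = G a j 0 x * pd 0 g x + G a j 1 x * pd 1 g x -
     2 * u * pd a g x * pd j y x - e * g x * pd a y x * pd j y x.
  move=> Wx; have W3x := W_3 _ Wx; have W1x := W_1 _ Wx.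
  have sy3 : smooth_on W3 y by apply: smooth_on_sub sy => x' /W32/W21.
  have ss3 i : smooth_on W3 (s i) by apply: smooth_on_sub (ss i) => x' /W32/W21.
  rewrite (eq_on_derive _ oW3 (fun x W3x => (dgn j x W3x).1) W3x).
  eassert (E : has_pd (fun x => s j x + n x * pd j y x) x a _) by pd_rule.
  refine (etrans (has_pdE E) _) => {E}; rewrite dy2// ds// !(dgn _ _ W3x).1 (dgn _ _ W3x).2.
  by move: (s a x) (s j x) (s 0 x) (s 1 x) (n x) (c a x) (g x); abstract_pd; abstract_at x => *; ring.
have [sF lF jF] := log_map_law oW (fun i j k => smooth_on_sub W_1 (sG1 i j k))
  (smooth_on_sub W_3 sg) (smooth_on_sub W_1 sy) (fun x Wx => (WP x Wx).1)
  (fun a j x Wx => dy2 a j x (W_1 _ Wx)) hg.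
exists W, (fun x => \row_k (if k == 0 then ln (g x) else y x)); split => //.
  by move=> x /W_1/W1U.
rewrite jF//; apply: mulf_neq0; first by rewrite invr_neq0// gt_eqF.
have [_ + _ _] := cof z W1z; rewrite tE// pmulr_rgt0// => /lt0r_neq0.
rewrite !(dgn _ _ W3z).1; apply: contra => /eqP h; apply/eqP; rewrite -[RHS]h.
by move: (s 0 z) (s 1 z) (n z); abstract_pd => *; ring.
Qed.

End LocalModel.

(** * Affine maps *)

Section ConnectionLaw.
Context {R : realType}.
Implicit Types (U V W : set (plane R)) (G : christoffel R) (F H : plane R -> plane R)
  (x z v w : plane R) (X Y : field R).

Definition gam_comp G x k (v0 v1 w0 w1 : R) : R :=
  G 0 0 k x * v0 * w0 + G 0 1 k x * v0 * w1 + (G 1 0 k x * v1 * w0 + G 1 1 k x * v1 * w1).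

Lemma gam_eval G x k v w (v0 v1 w0 w1 : R) :
  v 0 0 = v0 -> v 0 1 = v1 -> w 0 0 = w0 -> w 0 1 = w1 ->
  gam G x v w 0 k = gam_comp G x k v0 v1 w0 w1.
Proof. by move=> <- <- <- <-; exact: gamE. Qed.

Lemma pd_comp W F a x k : smooth_on W F -> W x -> (pd a F x) 0 k = pd a (comp F k) x.
Proof. by move=> sF Wx; rewrite derive_coord//; exact: smooth_on_derivable sF Wx. Qed.

Lemma connection_lawP W G G' F : smooth_on W F -> connection_law W G G' F <->
  forall a b k x, W x -> pd a (pd b (comp F k)) x =
    G a b 0 x * pd 0 (comp F k) x + G a b 1 x * pd 1 (comp F k) x -
    gam_comp G' (F x) k (pd a (comp F 0) x) (pd a (comp F 1) x)
      (pd b (comp F 0) x) (pd b (comp F 1) x).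
Proof.
move=> sF; have E a b k x : W x -> gam G' (F x) (pd a F x) (pd b F x) 0 k =
    gam_comp G' (F x) k (pd a (comp F 0) x) (pd a (comp F 1) x)
      (pd b (comp F 0) x) (pd b (comp F 1) x).
  by move=> Wx; apply: gam_eval; exact: pd_comp sF Wx.
split=> h a b k x Wx.
  by apply: (etrans (h a b k x Wx)); rewrite -(E a b k x Wx).
by apply: (etrans (h a b k x Wx)); rewrite -(E a b k x Wx).
Qed.

Lemma connection_law_sub V W G G' F : W `<=` V -> connection_law V G G' F ->
  connection_law W G G' F.
Proof. by move=> WV h a b k x /WV; exact: h. Qed.

Lemma derive_pushforward V W F Y v x k : open W -> open V -> smooth_on W F ->
  (forall y, W y -> V (F y)) -> smooth_on V Y -> W x ->
  ('D_('D_v F x) Y (F x)) 0 k = 'D_v (fun y => Y (F y) 0 k) x.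
Proof.
move=> oW oV sF FV sY Wx; have VFx := FV x Wx.
have dY l : differentiable (comp Y l) (F x).
  by apply: (Ck_on_differentiable (n := 0) oV _ VFx); exact: smooth_comp.
have dF : derivable F x v.
  apply/derivable_coordP => l; apply: diff_derivable.
  by apply: (Ck_on_differentiable (n := 0) oW _ Wx); exact: smooth_comp.
have dYF : derivable Y (F x) ('D_v F x).
  by apply/derivable_coordP => l; exact: diff_derivable (dY l).
have [_ E] := is_derive_comp_diff (dY k) dF.
exact: etrans (derive_coord k dYF) (esym E).
Qed.

(* The covariant derivative of [Y] along [X] pushes forward under [F]: the second
   derivatives of [F] produced by the chain rule are the ones of the law. *)
Lemma pushforward_algebra (g00 g01 g10 g11 h00 h01 h10 h11 x0 x1 y0 y1 d00 d01 d10 d11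
    f0 f1 p0 p1 q0 q1 s00 s01 s10 s11 e00 e01 e10 e11 : R) :
  s00 = g00 * f0 + h00 * f1 - (e00 * p0 * p0 + e01 * p0 * q0 + (e10 * q0 * p0 + e11 * q0 * q0)) ->
  s01 = g01 * f0 + h01 * f1 - (e00 * p0 * p1 + e01 * p0 * q1 + (e10 * q0 * p1 + e11 * q0 * q1)) ->
  s10 = g10 * f0 + h10 * f1 - (e00 * p1 * p0 + e01 * p1 * q0 + (e10 * q1 * p0 + e11 * q1 * q0)) ->
  s11 = g11 * f0 + h11 * f1 - (e00 * p1 * p1 + e01 * p1 * q1 + (e10 * q1 * p1 + e11 * q1 * q1)) ->
  x0 * (y0 * s00 + f0 * d00 + (y1 * s01 + f1 * d01)) + x1 * (y0 * s10 + f0 * d10 + (y1 * s11 + f1 * d11)) +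
  (e00 * (x0 * p0 + x1 * p1) * (y0 * p0 + y1 * p1) + e01 * (x0 * p0 + x1 * p1) * (y0 * q0 + y1 * q1) +
   (e10 * (x0 * q0 + x1 * q1) * (y0 * p0 + y1 * p1) + e11 * (x0 * q0 + x1 * q1) * (y0 * q0 + y1 * q1))) =
  (x0 * d00 + x1 * d10 + (g00 * x0 * y0 + g01 * x0 * y1 + (g10 * x1 * y0 + g11 * x1 * y1))) * f0 +
  (x0 * d01 + x1 * d11 + (h00 * x0 * y0 + h01 * x0 * y1 + (h10 * x1 * y0 + h11 * x1 * y1))) * f1.
Proof. by move=> -> -> -> ->; ring. Qed.

Lemma law_preserves_connection W G G' F : open W -> open (F @` W) -> smooth_on W F ->
  connection_law W G G' F -> preserves_connection W G G' F.
Proof.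
move=> oW oV sF /(connection_lawP _ _ sF) law X Y X' Y' sX sY sX' sY' XX' YY' x Wx.
have sFk k : smooth_on W (comp F k) by exact: smooth_comp.
have sYk k : smooth_on W (comp Y k) by exact: smooth_comp.
apply/rowP => k.
have FV y : W y -> (F @` W) (F y) by move=> Wy; exists y.
have covE : cov G' X' Y' (F x) 0 k =
    'D_(X x) (fun y => Y' (F y) 0 k) x + gam G' (F x) (X' (F x)) (Y' (F x)) 0 k.
  rewrite -(derive_pushforward (X x) k oW oV sF FV sY' Wx) -(XX' x Wx).
  by rewrite [LHS]mxE.
have vE (Z Z' : field R) l y : related W F Z Z' -> W y -> Z' (F y) 0 l =
    Z y 0 0 * pd 0 (comp F l) y + Z y 0 1 * pd 1 (comp F l) y.
  by move=> ZZ' Wy; rewrite ZZ'// (derive_compE _ _ oW sF Wy).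
have YE y : W y -> (fun y => comp Y 0 y * pd 0 (comp F k) y + comp Y 1 y * pd 1 (comp F k) y) y =
    Y' (F y) 0 k by move=> Wy; rewrite (vE Y Y' k y YY' Wy).
have dYE : 'D_(X x) (fun y => Y' (F y) 0 k) x =
    X x 0 0 * (comp Y 0 x * pd 0 (pd 0 (comp F k)) x + pd 0 (comp F k) x * pd 0 (comp Y 0) x +
      (comp Y 1 x * pd 0 (pd 1 (comp F k)) x + pd 1 (comp F k) x * pd 0 (comp Y 1) x)) +
    X x 0 1 * (comp Y 0 x * pd 1 (pd 0 (comp F k)) x + pd 0 (comp F k) x * pd 1 (comp Y 0) x +
      (comp Y 1 x * pd 1 (pd 1 (comp F k)) x + pd 1 (comp F k) x * pd 1 (comp Y 1) x)).
  rewrite -(eq_on_derive _ oW YE Wx).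
  have sE : smooth_on W (fun y => comp Y 0 y * pd 0 (comp F k) y + comp Y 1 y * pd 1 (comp F k) y).
    by smooth_rule.
  rewrite (Ck_on_deriveE (X x) oW (sE 1) Wx).
  eassert (E0 : has_pd (fun y => comp Y 0 y * pd 0 (comp F k) y + comp Y 1 y * pd 1 (comp F k) y) x 0 _) by pd_rule.
  eassert (E1 : has_pd (fun y => comp Y 0 y * pd 0 (comp F k) y + comp Y 1 y * pd 1 (comp F k) y) x 1 _) by pd_rule.
  by rewrite (has_pdE E0) (has_pdE E1).
have gE := gam_eval G' (F x) k (vE X X' 0 x XX' Wx) (vE X X' 1 x XX' Wx)
  (vE Y Y' 0 x YY' Wx) (vE Y Y' 1 x YY' Wx).
apply: (etrans covE); apply: (etrans (congr2 _ dYE gE)).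
apply: (etrans _ (esym (derive_compE _ k oW sF Wx))).
rewrite !(cov_compE _ _ _ oW sY Wx) /cov_comp /gam_comp.
apply: pushforward_algebra; exact: law.
Qed.

(** The definition is tested on the coordinate fields and their pushforwards [P c]. The inverse [H]
    serves to express these as smooth fields on the image; their chain rule derivative is the second
    derivative of [F]. *)
Lemma preserves_connection_law V W G G' F H : open W -> open V -> smooth_on W F ->
  smooth_on V H -> (forall y, W y -> V (F y) /\ H (F y) = y) ->
  (forall y, V y -> W (H y) /\ F (H y) = y) ->
  preserves_connection W G G' F -> connection_law W G G' F.
Proof.
move=> oW oV sF sH FH HF pF a b k x Wx.
have VE : F @` W = V.
  apply/seteqP; split=> [_ [y Wy <-]|y Vy]; first by have [] := FH y Wy.
  by have [WH FHy] := HF y Vy; exists (H y).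
have spd c : smooth_on W (pd c F) by exact: smooth_on_pd.
pose P c : field R := fun y => pd c F (H y).
have sP c : smooth_on (F @` W) (P c).
  by rewrite VE; apply: (smooth_on_comp_plane oV oW (spd c) sH) => y /HF[].
have rP c : related W F (cst (coord_vec c)) (P c).
  by move=> y Wy; rewrite /P /cst (FH y Wy).2.
have := pF _ _ _ _ (smooth_cst _ (coord_vec a)) (smooth_cst _ (coord_vec b)) (sP a) (sP b) (rP a) (rP b) x Wx.
move=> /(congr1 (fun v : plane R => v 0 k)) /= E.
have sPV : smooth_on V (P b) by rewrite -VE.
have FV y : W y -> V (F y) by move=> /FH[].
have E1 : cov G' (P a) (P b) (F x) 0 k =
    pd a (pd b (comp F k)) x + gam G' (F x) (pd a F x) (pd b F x) 0 k.
  have -> : cov G' (P a) (P b) (F x) 0 k =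
      ('D_(P a (F x)) (P b) (F x)) 0 k + gam G' (F x) (P a (F x)) (P b (F x)) 0 k by rewrite [LHS]mxE.
  have rPE d : P d (F x) = pd d F x := rP d x Wx.
  rewrite !rPE; congr (_ + _).
  apply: (etrans (derive_pushforward _ k oW oV sF FV sPV Wx)).
  apply: (eq_on_derive _ oW _ Wx) => y Wy.
  by rewrite /P (FH y Wy).2; exact: pd_comp sF Wy.
have E2 := derive_compE (cov G (cst (coord_vec a)) (cst (coord_vec b)) x) k oW sF Wx.
rewrite (cov_coord G a b x 0) (cov_coord G a b x 1) in E2.
by apply/eqP; rewrite eq_sym subr_eq eq_sym; apply/eqP; rewrite -E1 E E2.
Qed.

End ConnectionLaw.

(** * Behaviour of torsion and curvature under affine maps *)

Section TensorTransformation.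
Context {R : realType}.
Implicit Types (U V W : set (plane R)) (G : christoffel R) (F H : plane R -> plane R)
  (x z v w : plane R).

Lemma pd_comp_chain V W (g : plane R -> R) F x i : open W -> open V -> smooth_on W F ->
  (forall y, W y -> V (F y)) -> smooth_on V g -> W x ->
  has_pd (fun y => g (F y)) x i
    (pd i (comp F 0) x * pd 0 g (F x) + pd i (comp F 1) x * pd 1 g (F x)).
Proof.
move=> oW oV sF FV sg Wx; apply: is_derive_has_pd.
exact: (Ck_on_is_derive_comp i oW oV (sg 1) (sF 1) FV Wx).
Qed.

Lemma connection_law_comp V W G G' G'' F H : open W -> open V -> smooth_on W F ->
  smooth_on V H -> (forall y, W y -> V (F y)) ->
  connection_law W G G' F -> connection_law V G' G'' H ->
  connection_law W G G'' (fun x => H (F x)).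
Proof.
move=> oW oV sF sH FV lF lH.
have sHF : smooth_on W (fun x => H (F x)) by exact: smooth_on_comp_plane sH sF FV.
apply/(connection_lawP _ _ sHF) => a b k x Wx.
have sFk l : smooth_on W (comp F l) by exact: smooth_comp.
have sHk l : smooth_on V (comp H l) by exact: smooth_comp.
have {}lF := (connection_lawP G G' sF).1 lF; have {}lH := (connection_lawP G' G'' sH).1 lH.
have d1 c l y : W y -> pd c (comp (fun x => H (F x)) l) y =
    pd c (comp F 0) y * pd 0 (comp H l) (F y) + pd c (comp F 1) y * pd 1 (comp H l) (F y).
  by move=> Wy; have [_ <-] := pd_comp_chain c oW oV sF FV (sHk l) Wy.
have h1 m := pd_comp_chain a oW oV sF FV (smooth_on_pd m (sHk k)) Wx.
have d2 : pd a (pd b (comp (fun x => H (F x)) k)) x =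
    pd b (comp F 0) x * (pd a (comp F 0) x * pd 0 (pd 0 (comp H k)) (F x) +
      pd a (comp F 1) x * pd 1 (pd 0 (comp H k)) (F x)) + pd 0 (comp H k) (F x) * pd a (pd b (comp F 0)) x +
    (pd b (comp F 1) x * (pd a (comp F 0) x * pd 0 (pd 1 (comp H k)) (F x) +
      pd a (comp F 1) x * pd 1 (pd 1 (comp H k)) (F x)) + pd 1 (comp H k) (F x) * pd a (pd b (comp F 1)) x).
  apply: (etrans (eq_on_derive _ oW (fun y => d1 b k y) Wx)).
  have p l : has_pd (pd b (comp F l)) x a (pd a (pd b (comp F l)) x).
    exact: has_pd_smooth (smooth_on_pd b (sFk l)) Wx.
  exact: has_pdE (has_pdD (has_pdM (p 0) (h1 0)) (has_pdM (p 1) (h1 1))).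
move: d2 (d1 0 k x Wx) (d1 1 k x Wx) (d1 a 0 x Wx) (d1 a 1 x Wx) (d1 b 0 x Wx) (d1 b 1 x Wx).
move: (lF a b 0 x Wx) (lF a b 1 x Wx).
move: (lH 0 0 k _ (FV x Wx)) (lH 0 1 k _ (FV x Wx)) (lH 1 0 k _ (FV x Wx)) (lH 1 1 k _ (FV x Wx)).
rewrite /gam_comp; abstract_pd; abstract_at x.
repeat match goal with |- context [?K ?i ?j ?l (F x)] => generalize (K i j l (F x)); intro end.
by move=> -> -> -> -> -> -> -> -> -> -> -> -> ->; ring.
Qed.

(** Antisymmetrizing the law in its two lower indices removes the second derivatives of [F]. The
    factor [jac F x] is the density weight. *)
Lemma torsion_transform W G G' F x k : open W -> smooth_on W F -> connection_law W G G' F ->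
  W x -> jac F x * tor G' k (F x) =
    tor G 0 x * pd 0 (comp F k) x + tor G 1 x * pd 1 (comp F k) x.
Proof.
move=> oW sF lF Wx; have {}lF := (connection_lawP G G' sF).1 lF.
have := schwarz oW (smooth_comp k oW sF 2) Wx.
move: (lF 0 1 k x Wx) (lF 1 0 k x Wx); rewrite /jac /tor /gam_comp.
rewrite -/(comp F 0) -/(comp F 1).
abstract_pd; abstract_at x.
repeat match goal with |- context [?K ?i ?j ?l (F x)] => generalize (K i j l (F x)); intro end.
move=> -> -> /eqP; rewrite -subr_eq0 => /eqP h; apply: subr0_eq.
by apply: oppr_inj; rewrite oppr0 -[RHS](mul0r (2^-1)) -h; ring.
Qed.

(** The law is differentiated once more and antisymmetrized, which removes the third derivatives of
    [F]; the law itself then eliminates the second ones. *)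
Lemma curvature_transform V W G G' F x k j : open W -> open V -> smooth_on W F ->
  smooth_christoffel W G -> smooth_christoffel V G' -> (forall y, W y -> V (F y)) ->
  connection_law W G G' F -> W x ->
  jac F x * (cur G' k 0 (F x) * pd j (comp F 0) x + cur G' k 1 (F x) * pd j (comp F 1) x) =
    cur G 0 j x * pd 0 (comp F k) x + cur G 1 j x * pd 1 (comp F k) x.
Proof.
move=> oW oV sF sG sG' FV lF Wx; have {}lF := (connection_lawP G G' sF).1 lF.
have sFk l : smooth_on W (comp F l) by exact: smooth_comp.
pose h a b l : plane R -> R := fun x => G' a b l (F x).
have sh a b l : smooth_on W (h a b l).
  by apply: (smooth_on_comp oW oV (sG' a b l) sF FV).
have dh i a b l := pd_comp_chain i oW oV sF FV (sG' a b l) Wx.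
pose L a := fun x => G a j 0 x * pd 0 (comp F k) x + G a j 1 x * pd 1 (comp F k) x -
  (h 0 0 k x * pd a (comp F 0) x * pd j (comp F 0) x +
   h 0 1 k x * pd a (comp F 0) x * pd j (comp F 1) x +
   (h 1 0 k x * pd a (comp F 1) x * pd j (comp F 0) x +
    h 1 1 k x * pd a (comp F 1) x * pd j (comp F 1) x)).
have LE a y : W y -> pd a (pd j (comp F k)) y = L a y by exact: lF.
have sc := schwarz oW (smooth_on_pd j (sFk k) 2) Wx.
have {}sc := etrans (etrans (esym (eq_on_derive _ oW (LE 1) Wx)) sc) (eq_on_derive _ oW (LE 0) Wx).
eassert (E1 : has_pd (L 1) x 0 _) by (unfold L; pd_rule).
eassert (E0 : has_pd (L 0) x 1 _) by (unfold L; pd_rule).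
have {}sc := etrans (esym (has_pdE E1)) (etrans sc (has_pdE E0)).
have law2 a b l : pd a (fun y : plane R => derive (comp F l) y (coord_vec b)) x = _ := lF a b l x Wx.
move: {E0 E1 LE} sc.
have d i a b l := has_pdE (dh i a b l).
move: (d 0 0 0 k) (d 0 0 1 k) (d 0 1 0 k) (d 0 1 1 k) (d 1 0 0 k) (d 1 0 1 k) (d 1 1 0 k) (d 1 1 1 k).
move: (law2 0 0 k) (law2 0 1 k) (law2 1 0 k) (law2 1 1 k).
move: (law2 0 j 0) (law2 1 j 0) (law2 0 j 1) (law2 1 j 1).
move: (law2 0 0 0) (law2 0 1 0) (esym (schwarz_eta oW (sFk 0) Wx)) (law2 1 1 0).
move: (law2 0 0 1) (law2 0 1 1) (esym (schwarz_eta oW (sFk 1) Wx)) (law2 1 1 1).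
rewrite /jac /cur /gam_comp -/(comp F 0) -/(comp F 1) /h; cbv beta.
abstract_pd; abstract_at x.
repeat match goal with |- context [?K ?i ?j ?l (F x)] => generalize (K i j l (F x)); intro end.
(* One step for each of the 24 equations just generalized: eight derivatives of the symbols along
   [F] and sixteen expressions for second derivatives of [F]. Those whose left side no longer occurs
   are discarded. *)
do 24 (move=> -> || move=> _).
move=> /eqP; rewrite -subr_eq0 => /eqP hh; apply: subr0_eq.
by apply: oppr_inj; rewrite oppr0 -[RHS]hh; ring.
Qed.

End TensorTransformation.

Section Invariance.
Context {R : realType}.
Implicit Types (U V W : set (plane R)) (G : christoffel R) (F H : plane R -> plane R)
  (x z v w : plane R).

Lemma det_product_neq0 (a b c d e f g h : R) :
  a * e + b * f = 1 -> a * g + b * h = 0 -> c * e + d * f = 0 -> c * g + d * h = 1 ->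
  a * d - c * b != 0.
Proof.
move=> h00 h01 h10 h11; apply/eqP => D0.
have : (a * e + b * f) * (c * g + d * h) - (a * g + b * h) * (c * e + d * f) =
  (a * d - c * b) * (e * h - f * g) by ring.
by rewrite h00 h01 h10 h11 D0 !mul0r mulr1 subr0 => /eqP; rewrite oner_eq0.
Qed.

Lemma jac_inverse_neq0 V W F H x : open W -> open V -> smooth_on W F -> smooth_on V H ->
  (forall y, W y -> V (F y) /\ H (F y) = y) -> W x -> jac F x != 0.
Proof.
move=> oW oV sF sH FH Wx.
have FV y : W y -> V (F y) by move=> /FH[].
have id i k : pd i (comp F 0) x * pd 0 (comp H k) (F x) +
    pd i (comp F 1) x * pd 1 (comp H k) (F x) = (k == i)%:R.
  rewrite -(has_pdE (pd_comp_chain i oW oV sF FV (smooth_comp k oV sH) Wx)).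
  have [_ E] := is_derive_coord x (coord_vec i) k; rewrite -(coord_vecE i k) -E.
  by apply: (eq_on_derive _ oW _ Wx) => y Wy; rewrite /comp (FH y Wy).2.
move: (id 0 0) (id 0 1) (id 1 0) (id 1 1); rewrite /jac -/(comp F 0) -/(comp F 1) /=.
abstract_pd; exact: det_product_neq0.
Qed.

Lemma linear_kernel_trivial (a b c d t0 t1 : R) : 0 = t0 * a + t1 * b ->
  0 = t0 * c + t1 * d -> a * d - b * c != 0 -> t0 = 0 /\ t1 = 0.
Proof.
move=> h0 h1 D0; split; apply: (mulfI D0); rewrite mulr0.
- transitivity (d * (t0 * a + t1 * b) - b * (t0 * c + t1 * d)); first by ring.
  by rewrite -h0 -h1 !mulr0 subrr.
- transitivity (a * (t0 * c + t1 * d) - c * (t0 * a + t1 * b)); first by ring.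
  by rewrite -h0 -h1 !mulr0 subrr.
Qed.

(** The form tau has no density weight, so its pullback is exact: tau' P = tau, without the factor
    D. With P t = D t', the relation D r' P = P r becomes (b - b') D t' (x) tau = 0, while neither
    t' nor tau is zero. *)
Lemma ratio_invariance_algebra (D b b' t0 t1 t0' t1' p00 p01 p10 p11 : R) : D != 0 ->
  D = p00 * p11 - p01 * p10 -> ~ (t0 = 0 /\ t1 = 0) ->
  D * t0' = t0 * p00 + t1 * p01 -> D * t1' = t0 * p10 + t1 * p11 ->
  (D * ((- b' * t0' * t1') * p00 + (b' * t0' * t0') * p10) =
    (- b * t0 * t1) * p00 + (- b * t1 * t1) * p01) ->
  (D * ((- b' * t1' * t1') * p00 + (b' * t1' * t0') * p10) =
    (- b * t0 * t1) * p10 + (- b * t1 * t1) * p11) ->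
  (D * ((- b' * t0' * t1') * p01 + (b' * t0' * t0') * p11) =
    (b * t0 * t0) * p00 + (b * t1 * t0) * p01) ->
  (D * ((- b' * t1' * t1') * p01 + (b' * t1' * t0') * p11) =
    (b * t0 * t0) * p10 + (b * t1 * t0) * p11) ->
  b = b' /\ ~ (t0' = 0 /\ t1' = 0).
Proof.
move=> D0 DE t0n E0 E1 c00 c10 c01 c11.
have tau0 : - t1' * p00 + t0' * p10 = - t1.
  apply: (mulfI D0); transitivity (- (D * t1') * p00 + D * t0' * p10); first by ring.
  by rewrite E0 E1 DE; ring.
have tau1 : - t1' * p01 + t0' * p11 = t0.
  apply: (mulfI D0); transitivity (- (D * t1') * p01 + D * t0' * p11); first by ring.
  by rewrite E0 E1 DE; ring.
have t'n : ~ (t0' = 0 /\ t1' = 0).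
  move=> [h0 h1]; apply: t0n; split; first by rewrite -tau1 h0 h1; ring.
  by apply: oppr_inj; rewrite -tau0 h0 h1; ring.
split => //; apply/eqP; rewrite -subr_eq0; apply/negPn/negP => bb.
apply: t'n.
have k00 : (b - b') * (D * t0' * t1) = 0.
  have := c00; have -> : - b' * t0' * t1' * p00 + b' * t0' * t0' * p10 = b' * t0' * (- t1' * p00 + t0' * p10) by ring.
  have -> : - b * t0 * t1 * p00 + - b * t1 * t1 * p01 = - b * t1 * (t0 * p00 + t1 * p01) by ring.
  by rewrite tau0 -E0 => h; rewrite -[RHS](subrr (D * (b' * t0' * - t1))) {2}h; ring.
have k10 : (b - b') * (D * t1' * t1) = 0.
  have := c10; have -> : - b' * t1' * t1' * p00 + b' * t1' * t0' * p10 = b' * t1' * (- t1' * p00 + t0' * p10) by ring.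
  have -> : - b * t0 * t1 * p10 + - b * t1 * t1 * p11 = - b * t1 * (t0 * p10 + t1 * p11) by ring.
  by rewrite tau0 -E1 => h; rewrite -[RHS](subrr (D * (b' * t1' * - t1))) {2}h; ring.
have k01 : (b - b') * (D * t0' * t0) = 0.
  have := c01; have -> : - b' * t0' * t1' * p01 + b' * t0' * t0' * p11 = b' * t0' * (- t1' * p01 + t0' * p11) by ring.
  have -> : b * t0 * t0 * p00 + b * t1 * t0 * p01 = b * t0 * (t0 * p00 + t1 * p01) by ring.
  by rewrite tau1 -E0 => h; rewrite -[RHS](subrr (D * (b' * t0' * t0))) {1}h; ring.
have k11 : (b - b') * (D * t1' * t0) = 0.
  have := c11; have -> : - b' * t1' * t1' * p01 + b' * t1' * t0' * p11 = b' * t1' * (- t1' * p01 + t0' * p11) by ring.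
  have -> : b * t0 * t0 * p10 + b * t1 * t0 * p11 = b * t0 * (t0 * p10 + t1 * p11) by ring.
  by rewrite tau1 -E1 => h; rewrite -[RHS](subrr (D * (b' * t1' * t0))) {1}h; ring.
have canc (p q : R) : (b - b') * (D * p * q) = 0 -> q != 0 -> p = 0.
  move=> /eqP; rewrite !mulf_eq0 (negPf bb) (negPf D0) /= => /orP[/eqP//|/eqP->].
  by rewrite eqxx.
have [t00|t0z] := eqVneq t0 0; last by split; [exact: canc k01 t0z|exact: canc k11 t0z].
have t1z : t1 != 0 by apply/eqP => t1z; apply: t0n.
by split; [exact: canc k00 t1z|exact: canc k10 t1z].
Qed.

Lemma tor_neq0P G x : (exists k, tor G k x != 0) <-> ~ (tor G 0 x = 0 /\ tor G 1 x = 0).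
Proof.
split=> [[k tk] [h0 h1]|tn].
  by move: k tk; apply: forall_I2; rewrite ?h0 ?h1 eqxx.
have [t0|t0] := eqVneq (tor G 0 x) 0; last by exists 0.
by exists 1; apply/eqP => t1; apply: tn.
Qed.

(** The formula for [cur_ratio] involves the Euclidean length of t and is not visibly invariant;
    invariance comes from the tensor identity r = b t (x) tau on both sides. *)
Lemma ratio_transform V W G G' F H x : open W -> open V -> smooth_on W F ->
  smooth_on V H -> (forall y, W y -> V (F y) /\ H (F y) = y) ->
  smooth_christoffel W G -> smooth_christoffel V G' ->
  torsion_system W G -> torsion_system V G' ->
  curvature_system W G -> curvature_system V G' ->
  connection_law W G G' F -> W x -> (exists k, tor G k x != 0) ->
  cur_ratio G x = cur_ratio G' (F x) /\ exists k, tor G' k (F x) != 0.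
Proof.
move=> oW oV sF sH FH sG sG' dG dG' cG cG' law Wx tx.
have FV y : W y -> V (F y) by move=> /FH[].
have VFx := FV x Wx.
have jx := jac_inverse_neq0 oW oV sF sH FH Wx.
have T k := torsion_transform k oW sF law Wx.
have C k j := curvature_transform k j oW oV sF sG sG' FV law Wx.
have t'n : exists k, tor G' k (F x) != 0.
  apply/tor_neq0P => -[h0 h1]; move/tor_neq0P: tx; apply.
  move: (T 0) (T 1) jx; rewrite h0 h1 !mulr0 /jac -/(comp F 0) -/(comp F 1).
  abstract_pd; abstract_at x; exact: linear_kernel_trivial.
have [r00 r01 r10 r11] := curE oW sG dG cG Wx tx.
have [r00' r01' r10' r11'] := curE oV sG' dG' cG' VFx t'n.
move: (T 0) (T 1) (C 0 0) (C 1 0) (C 0 1) (C 1 1).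
rewrite r00 r01 r10 r11 r00' r01' r10' r11'.
move/tor_neq0P: tx; move: jx (erefl (jac F x)); rewrite {3}/jac -/(comp F 0) -/(comp F 1).
move: (jac F x) (cur_ratio G x) (cur_ratio G' (F x)) => D b b'.
move: (tor G' 0 (F x)) (tor G' 1 (F x)) t'n => t0' t1' t'n; abstract_pd; abstract_at x.
move=> D0 DE tx T0 T1 C00 C10 C01 C11; split => //.
exact: (ratio_invariance_algebra D0 DE tx T0 T1 C00 C10 C01 C11).1.
Qed.

Lemma cur_ratio_locally_constant U G z : open U -> U z -> smooth_christoffel U G ->
  torsion_system U G -> curvature_system U G -> (exists k, tor G k z != 0) ->
  nbhs z [set x | [/\ U x, exists k, tor G k x != 0 & cur_ratio G x = cur_ratio G z]].
Proof.
move=> oU Uz sG dG cG [k tk].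
have nt := near_neq0 (smooth_on_continuous (smooth_tor k oU sG) Uz) tk.
have nU : nbhs z U by exact: open_nbhs_nbhs.
have [r r0 Br] := (@nbhs_ballP R (plane R) z _).1 (filterI nU nt).
apply/nbhs_ballP; exists r => //= x Bx; have [Ux tx] := Br x Bx.
split => //; first by exists k.
have dr i w : ball z r w -> has_pd (cur_ratio G) w i 0.
  by move=> /Br[Uw tw]; apply: (pd_cur_ratio i oU sG dG cG Uw); exists k.
apply/eqP; rewrite -subr_eq0 -normr_le0.
have := @lipschitz_ball _ (cur_ratio G) z z x r 0; rewrite addr0 mul0r; apply => //.
- by move=> i w /(dr i)[].
- by move=> i w /(dr i)/has_pdE ->; rewrite normr0.
- exact: ballxx.
Qed.

End Invariance.

(** * Surfaces *)

Section Charts.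
Context {R : realType} {S T : topologicalType}.

Lemma open_expr_dom (a : chart R S) (b : chart R T) (U : set S) (f : S -> T) :
  open U -> (forall p, U p -> {for p, continuous f}) -> open (expr_dom a b U f).
Proof.
move=> oU cf; rewrite openE => x [ax [Ux bx]].
have n1 : nbhs x (chart_cod a) by apply: open_nbhs_nbhs; split => //; exact: chart_cod_open.
have ci : {for x, continuous (chart_inv a)} by exact: chart_inv_continuous.
have n2 : nbhs x (chart_inv a @^-1` U) by apply: ci; exact: open_nbhs_nbhs.
have n3 : nbhs x (chart_inv a @^-1` (f @^-1` chart_dom b)).
  apply: ci; apply: (cf _ Ux); apply: open_nbhs_nbhs; split => //; exact: chart_dom_open.
by apply: filterS (filterI n1 (filterI n2 n3)) => y [].
Qed.

End Charts.

Section Surfaces.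
Context {R : realType}.
Variable M : affine_surface R.
Hypotheses (sym : symmetric_surface M) (par : torsion_parallel M).
Implicit Types (a b c : atlas_index M) (p q : M).

Lemma smooth_symbols a : smooth_christoffel (chart_cod (atlas a)) (chart_symbols a).
Proof. by move=> i j k; exact: symbols_smooth. Qed.

Arguments smooth_symbols : clear implicits.

Lemma chart_torsion_system a : torsion_system (chart_cod (atlas a)) (chart_symbols a).
Proof.
exact: (tor_parallel (@chart_cod_open _ _ (atlas a)) (@smooth_symbols a) (fun X Y Z sX sY sZ x ax => par sZ sX sY ax)).
Qed.

Lemma chart_curvature_system a : curvature_system (chart_cod (atlas a)) (chart_symbols a).
Proof.
exact: (cur_parallel (@chart_cod_open _ _ (atlas a)) (@smooth_symbols a)
  (fun V X Y Z sV sX sY sZ x ax => sym sV sX sY sZ ax)).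
Qed.

Definition transition_dom a b := expr_dom (atlas a) (atlas b) setT id.
Definition transition a b := expr (atlas a) (atlas b) id.

Lemma open_transition_dom a b : open (transition_dom a b).
Proof.
apply: open_expr_dom; first exact: openT.
by move=> p _; exact: cvg_id.
Qed.

Lemma transitionK a b x : transition_dom a b x ->
  transition_dom b a (transition a b x) /\ transition b a (transition a b x) = x.
Proof.
move=> [ax [_ bx]]; rewrite /transition_dom /transition /expr_dom /expr /=.
by rewrite chart_mapK// chart_invK//; split => //; split; [exact: chart_mapP|split => //; exact: chart_invP].
Qed.

Lemma smooth_transition a b : smooth_on (transition_dom a b) (transition a b).
Proof. exact: atlas_smooth. Qed.

Lemma transition_law a b :
  connection_law (transition_dom a b) (chart_symbols a) (chart_symbols b) (transition a b).
Proof.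
apply: (preserves_connection_law (@open_transition_dom a b) (@open_transition_dom b a)
  (@smooth_transition a b) (@smooth_transition b a)).
- by move=> x; exact: transitionK.
- by move=> x; exact: transitionK.
- exact: symbols_compat.
Qed.

(** Non-vanishing torsion is part of the definition, because division by zero would give [cur_ratio]
    the value 0 at a torsion-free point, the same as for flat points with torsion. *)
Definition ratio_at a p (beta : R) := [/\ chart_dom (atlas a) p,
  exists k, tor (chart_symbols a) k (chart_map (atlas a) p) != 0 &
  cur_ratio (chart_symbols a) (chart_map (atlas a) p) = beta].

Lemma ratio_at_chart a b p beta : chart_dom (atlas b) p -> ratio_at a p beta -> ratio_at b p beta.
Proof.
move=> bp [ap ta ra].
pose x := chart_map (atlas a) p.
have Wx : transition_dom a b x.
  by split; [exact: chart_mapP|split => //; rewrite /x chart_mapK].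
have xp : transition a b x = chart_map (atlas b) p by rewrite /transition /expr /x chart_mapK.
have subG c d i j k : smooth_on (transition_dom c d) (chart_symbols c i j k).
  by apply: smooth_on_sub (smooth_symbols c i j k) => y [].
have [] := ratio_transform (@open_transition_dom a b) (@open_transition_dom b a)
  (@smooth_transition a b) (@smooth_transition b a) (@transitionK a b)
  (subG a b) (subG b a) _ _ _ _ (@transition_law a b) Wx ta.
- by move=> i k y [ay _]; exact: chart_torsion_system.
- by move=> i k y [ay _]; exact: chart_torsion_system.
- by move=> i k j y [ay _]; exact: chart_curvature_system.
- by move=> i k j y [ay _]; exact: chart_curvature_system.
by rewrite xp -/x ra => rb tb; split.
Qed.

Lemma near_chart a p (P : set (plane R)) : chart_dom (atlas a) p ->
  nbhs (chart_map (atlas a) p) P -> nbhs p [set q | chart_dom (atlas a) q /\ P (chart_map (atlas a) q)].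
Proof.
move=> ap nP.
have n1 : nbhs p (chart_dom (atlas a)) by apply: open_nbhs_nbhs; split => //; exact: chart_dom_open.
have n2 : nbhs p (chart_map (atlas a) @^-1` P) by apply: (chart_map_continuous ap).
exact: filterI n1 n2.
Qed.

Lemma near_ratio_at a p beta : ratio_at a p beta -> nbhs p [set q | ratio_at a q beta].
Proof.
move=> [ap ta ra].
have := near_chart ap (cur_ratio_locally_constant (@chart_cod_open _ _ (atlas a)) (chart_mapP ap) (@smooth_symbols a) (@chart_torsion_system a) (@chart_curvature_system a) ta).
by apply: filterS => q [aq [_ tq rq]]; split => //; rewrite rq.
Qed.

(** The condition nabla T = 0 is a linear homogeneous first-order system for t, with the
    coefficients [c] below, so a zero of t spreads to a neighbourhood. *)
Lemma near_torsion_free a x : chart_cod (atlas a) x ->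
  (forall k, tor (chart_symbols a) k x = 0) ->
  nbhs x [set y | forall k, tor (chart_symbols a) k y = 0].
Proof.
move=> ax t0; have oU := @chart_cod_open _ _ (atlas a); have sGa := smooth_symbols a.
pose c i k j : plane R -> R := fun y => (k == j)%:R * (chart_symbols a i 0 0 y + chart_symbols a i 1 1 y) -
  chart_symbols a i j k y.
have sc i k j : smooth_on (chart_cod (atlas a)) (c i k j).
  apply: smooth_onD => //; last by apply: smooth_onN => //.
  by apply: smooth_onM => //; [exact: smooth_cst|apply: smooth_onD].
apply: (linear_system_vanishing oU ax (fun k => smooth_tor k oU sGa) sc _ t0).
move=> i k y ay; rewrite (chart_torsion_system i k ay) /c.
by move: k; apply: forall_I2 => /=; abstract_at y; ring.
Qed.

(** The points of ratio [beta] form an open set. Its complement is open as well: a point outside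
    either has another ratio or has no torsion, and each alternative persists nearby. Connectedness
    concludes. *)
Lemma ratio_at_everywhere (beta : R) : connected [set: M] ->
  (exists a p, ratio_at a p beta) -> forall p, exists a, ratio_at a p beta.
Proof.
move=> cM [a0 [p0 r0]]; pose S := [set p | exists a, ratio_at a p beta].
have oS : open S.
  by rewrite openE => p [a /near_ratio_at]; apply: filterS => q rq; exists a.
have oC : open (~` S).
  rewrite openE => p nSp; have [a ap] := atlas_cover p.
  have ax := chart_mapP ap.
  have [/asboolP tx|/asboolP tx] := boolP `[<exists k, tor (chart_symbols a) k (chart_map (atlas a) p) != 0>].
    have rp : ratio_at a p (cur_ratio (chart_symbols a) (chart_map (atlas a) p)) by split.
    apply: filterS (near_ratio_at rp) => q rq [b rbq]; apply: nSp; exists a.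
    have [aq _ rqp] := rq; split => //.
    by have [_ _ <-] := ratio_at_chart aq rbq; rewrite rqp.
  have t0 k : tor (chart_symbols a) k (chart_map (atlas a) p) = 0.
    by apply/eqP; apply: contra_notT tx => tk; exists k.
  apply: filterS (near_chart ap (near_torsion_free ax t0)) => q [aq tq] [b rbq].
  by have [_ [k /eqP + _]] := ratio_at_chart aq rbq; apply.
suff SE : S = [set: M] by move=> p; have : [set: M] p by []; rewrite -SE.
apply: cM; first by exists p0; exists a0.
- by exists S => //; rewrite setTI.
- by exists S; [rewrite -(setCK S); exact: open_closedC|rewrite setTI].
Qed.

End Surfaces.

Section ChartIsomorphism.
Context {R : realType}.
Variables (M : affine_surface R) (a b c : R).
Let N : affine_surface R := plane_model a b c.
Variables (i : atlas_index M) (W V : set (plane R)) (F H : plane R -> plane R).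
Hypotheses (oW : open W) (oV : open V) (Wi : W `<=` chart_cod (atlas i)).
Hypotheses (sF : smooth_on W F) (sH : smooth_on V H).
Hypotheses (FH : forall x, W x -> V (F x) /\ H (F x) = x).
Hypotheses (HF : forall y, V y -> W (H y) /\ F (H y) = y).
Hypothesis law : connection_law W (chart_symbols i) (@chart_symbols R N tt) F.

Let U : set M := [set q | chart_dom (atlas i) q /\ W (chart_map (atlas i) q)].
Let f (q : M) : N := F (chart_map (atlas i) q).
Let g (y : N) : M := chart_inv (atlas i) (H y).

(** An isomorphism has to be tested in every chart of [M], not just in [i]. In chart [j] the map
    reads as [F] after the transition from [j] to [i], so the law follows by composition. *)
Lemma chart_affine_iso : affine_iso U (V : set N) f g.
Proof.
have oU : open U.
  by rewrite openE => q [iq Wq]; apply: near_chart => //; exact: open_nbhs_nbhs.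
have cf q : U q -> {for q, continuous f}.
  move=> [iq Wq]; apply: (@continuous_comp _ _ _ (chart_map (atlas i)) F).
    exact: chart_map_continuous.
  exact: smooth_on_continuous sF Wq.
have cg (y : N) : V y -> {for y, continuous g}.
  move=> Vy; apply: (@continuous_comp _ _ _ H (chart_inv (atlas i))).
    exact: smooth_on_continuous sH Vy.
  by apply: chart_inv_continuous; apply: Wi; exact: (HF Vy).1.
have fU q : U q -> V (f q) /\ g (f q) = q.
  by move=> [iq /FH[Vq Hq]]; split => //; rewrite /g /f Hq chart_mapK.
have gV (y : N) : V y -> U (g y) /\ f (g y) = y.
  move=> /HF[WHy FHy]; have iHy := Wi WHy; split; last by rewrite /f /g chart_invK.
  by split; [exact: chart_invP|rewrite chart_invK].
have trW j x : expr_dom (atlas j) (atlas (tt : atlas_index N)) U f x ->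
    transition_dom j i x /\ W (transition j i x).
  by move=> [jx [[ix Wx] _]].
have oD j : open (expr_dom (atlas j) (atlas (tt : atlas_index N)) U f).
  exact: open_expr_dom.
have oE j : open (expr_dom (atlas (tt : atlas_index N)) (atlas j) (V : set N) g).
  exact: open_expr_dom.
have st j : smooth_on (expr_dom (atlas j) (atlas (tt : atlas_index N)) U f) (transition j i).
  by apply: smooth_on_sub (@smooth_transition _ M j i) => x /trW[].
have sf j : smooth_on (expr_dom (atlas j) (atlas (tt : atlas_index N)) U f)
    (fun x => F (transition j i x)).
  by apply: (smooth_on_comp_plane (oD j) oW sF (st j)) => x /trW[].
split => //.
- split; split => //.
  case=> j; have trV y : expr_dom (atlas (tt : atlas_index N)) (atlas j) (V : set N) g y ->
      transition_dom i j (H y).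
    by move=> [_ [/HF[WHy _] jy]]; split => //; exact: Wi.
  apply: (smooth_on_comp_plane (oE j) (@open_transition_dom _ M i j)
    (@smooth_transition _ M i j) _ trV).
  by apply: smooth_on_sub sH => y [_ []].
- move=> j [].
  apply: (law_preserves_connection (oD j)).
  + have -> : expr (atlas j) (atlas (tt : atlas_index N)) f @`
        expr_dom (atlas j) (atlas (tt : atlas_index N)) U f =
        expr_dom (atlas (tt : atlas_index N)) (atlas j) (V : set N) g; last exact: oE.
    apply/seteqP; split=> [_ [x [jx [Ux _]] <-]|y [_ [Vy jy]]].
      have [Vx gx] := fU _ Ux; split => //; split => //.
      by rewrite -[expr _ _ _ _]/(f (chart_inv (atlas j) x)) gx; exact: chart_invP.
    have [Ugy fgy] := gV y Vy; exists (chart_map (atlas j) (g y)).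
      by split; [exact: chart_mapP|split => //; rewrite chart_mapK].
    by rewrite -[LHS]/(f (chart_inv (atlas j) (chart_map (atlas j) (g y)))) chart_mapK.
  + exact: sf.
  + apply: (connection_law_comp (oD j) oW (st j) sF _ _ law).
      by move=> x /trW[].
    by apply: connection_law_sub (@transition_law _ M j i) => x /trW[].
Qed.

End ChartIsomorphism.

Section LocalModels.
Context {R : realType}.
Variable M : affine_surface R.
Hypotheses (sym : symmetric_surface M) (par : torsion_parallel M).

Lemma local_model i (p : M) (beta u e : R) : ratio_at i p beta -> 0 < u -> beta * (u * u) = e ->
  exists (U : set M) (V : set (plane_model 1 (2 * u) e)) f g, U p /\ affine_iso U V f g.
Proof.
move=> [ip ti ri] u0 be; have oi := @chart_cod_open _ _ (atlas i).
have si := @smooth_symbols _ M i; have ix := chart_mapP ip.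
have ts := @chart_torsion_system _ M par i; have cs := @chart_curvature_system _ M sym i.
have [W0 [oW0 W0p W0P]] := open_subset_nbhs (cur_ratio_locally_constant oi ix si ts cs ti).
have W0i : W0 `<=` chart_cod (atlas i) by move=> y /W0P[].
have r1 : rank_one_curvature W0 (chart_symbols i) beta.
  by move=> y /W0P[iy ty ry]; rewrite -ri -ry; have := curE oi si ts cs iy ty.
have [W1 [F [[oW1 W1p] W10 sF law jF]]] := local_normal_form oW0 W0p
  (fun i' j k => smooth_on_sub W0i (si i' j k)) (fun a k y W0y => ts a k y (W0i _ W0y)) r1 ti u0 be.
have [W [V [H [[oW Wp] W_1 oV FH [HF sH]]]]] := inverse_function oW1 W1p sF jF.
have W_i : W `<=` chart_cod (atlas i) by move=> y /W_1/W10/W0i.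
have lawW := connection_law_sub W_1 law.
exists [set q | chart_dom (atlas i) q /\ W (chart_map (atlas i) q)], V,
  (fun q => F (chart_map (atlas i) q)), (fun y => chart_inv (atlas i) (H y)); split => //.
exact: (chart_affine_iso oW oV W_i (smooth_on_sub W_1 sF) sH FH HF lawW).
Qed.

Lemma exists_ratio_at : torsion_nonzero M -> exists beta i p, ratio_at (M := M) i p beta.
Proof.
move=> [i [X [Y [x [_ _ ix tx]]]]].
have xE := chart_invK ix.
exists (cur_ratio (chart_symbols i) x), i, (chart_inv (atlas i) x).
split; [exact: chart_invP| |by rewrite xE]; rewrite xE.
apply/tor_neq0P => -[h0 h1]; move/eqP: tx; apply; apply/rowP => k.
rewrite torsionE mxE; move: k; apply: forall_I2; rewrite ?h0 ?h1 mulr0 //.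
Qed.

End LocalModels.

(** * The models *)

Section PlaneModels.
Context {R : realType}.
Variables a b c : R.
Let N : affine_surface R := plane_model a b c.
Let K : christoffel R := @chart_symbols R N tt.

Let translation (v x : plane R) : plane R := x + v.

Let comp_translation v k : comp (translation v) k = (fun x : plane R => x 0 k + v 0 k).
Proof. by apply/funext => x; rewrite /comp mxE. Qed.

Let smooth_translation v : smooth_on setT (translation v).
Proof.
apply/(smooth_on_coordP _ openT) => k.
apply: (eq_smooth_on (f := fun x : plane R => x 0 k + v 0 k)) => [|y _|].
- exact: openT.
- by rewrite mxE.
- by apply: smooth_onD; [exact: openT|exact: smooth_on_coord|exact: smooth_cst].
Qed.

Let pd_translation v i k x : pd i (comp (translation v) k) x = (k == i)%:R.
Proof.
rewrite comp_translation -(coord_vecE i k) -[RHS]addr0.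
exact: has_pdE (has_pdD (is_derive_has_pd (is_derive_coord x (coord_vec i) k)) (has_pd_cst _ x i)).
Qed.

Let translation_law v : connection_law setT K K (translation v).
Proof.
apply/(connection_lawP _ _ (@smooth_translation v)) => i j k x _.
rewrite !pd_translation (_ : pd j (comp (translation v) k) = cst (k == j)%:R).
  rewrite pd_cst /gam_comp; move: k i j; apply: forall_I2; apply: forall_I2; apply: forall_I2 => /=; rewrite /K /=; ring.
by apply/funext => y; rewrite pd_translation.
Qed.

Lemma plane_model_homogeneous : homogeneous N.
Proof.
move=> p q; exists (translation (q - p)); split; last by rewrite /translation addrC subrK.
exists (translation (p - q)).
have K1 v w x : w = - v -> setT x -> setT (translation v x) /\ translation w (translation v x) = x.
  by move=> -> _; split => //; rewrite /translation addrK.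
have := @chart_affine_iso R N a b c tt setT setT (translation (q - p)) (translation (p - q))
  openT openT (fun _ _ => I) (@smooth_translation _) (@smooth_translation _)
  (fun x => K1 _ _ x (esym (opprB _ _))) (fun x => K1 _ _ x (esym (opprB _ _)))
  (@translation_law _).
by rewrite (_ : [set _ | _] = setT)//; apply/seteqP; split.
Qed.

End PlaneModels.

Section PlaneModelTensors.
Context {R : realType}.
Variables a b c : R.
Let N : affine_surface R := plane_model a b c.
Let K : christoffel R := @chart_symbols R N tt.

Let sK : smooth_christoffel setT K.
Proof. by move=> i j k; exact: smooth_cst. Qed.

Lemma plane_model_tor k x : tor K k x = (k == 0)%:R * (2^-1 * b).
Proof. rewrite /tor; move: k; apply: forall_I2; rewrite /K /chart_symbols /=; ring. Qed.

Lemma plane_model_cur k j x : cur K k j x = ((k == 0) && (j == 1))%:R * (a * c).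
Proof.
have dK i i' j' k' : pd i (K i' j' k') x = 0 by exact: pd_cst.
rewrite /cur !dK; move: k j; apply: forall_I2; apply: forall_I2; rewrite /K /chart_symbols /=; ring.
Qed.

Lemma plane_model_torsion_system : torsion_system setT K.
Proof.
move=> i k x _; rewrite (_ : tor K k = cst ((k == 0)%:R * (2^-1 * b))); last first.
  by apply/funext => y; rewrite plane_model_tor.
rewrite pd_cst !plane_model_tor /cst; move: k i; apply: forall_I2; apply: forall_I2; rewrite /K /chart_symbols /=; ring.
Qed.

Lemma plane_model_curvature_system : curvature_system setT K.
Proof.
move=> i k j x _; rewrite (_ : cur K k j = cst (((k == 0) && (j == 1))%:R * (a * c))); last first.
  by apply/funext => y; rewrite plane_model_cur.
rewrite pd_cst !plane_model_cur /cst; move: k j i; apply: forall_I2; apply: forall_I2; apply: forall_I2;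
  rewrite /K /chart_symbols /=; ring.
Qed.

Lemma plane_model_cur_ratio x : cur_ratio K x = (a * c) / ((2^-1 * b) * (2^-1 * b)).
Proof.
by rewrite /cur_ratio /tor_norm2 !plane_model_tor !plane_model_cur /= !mul0r !mul1r subr0 addr0.
Qed.

Lemma plane_model_ricci X Y x : smooth_on setT X -> smooth_on setT Y ->
  ricci K X Y x = a * c * (X x 0 1 * Y x 0 1).
Proof.
move=> sX sY; rewrite /ricci /mxtrace sum_I2 [X in X + _]mxE [X in _ + X]mxE.
have cE i : curvature K (cst (coord_vec i)) X Y x 0 i = _ :=
  curvatureE i openT sK (smooth_cst _ _) sX sY I.
rewrite [X in X + _](cE 0) [X in _ + X](cE 1) !plane_model_cur !cst_coord /=.
ring.
Qed.

End PlaneModelTensors.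

Section Inequivalence.
Context {R : realType}.

(** The hypothesis on [b] says that the first model has torsion, so that its ratio is a genuine
    invariant; constancy of the symbols lets the comparison take place at the single point 0. *)
Lemma plane_model_ratio_invariant (a b c a' b' c' : R) : b != 0 ->
  equivalent (plane_model a b c) (plane_model a' b' c') ->
  a * c / (b * b) = a' * c' / (b' * b').
Proof.
move=> b0 [f [g [_ fK gK [[_ sf] [_ sg]] pf]]].
have dT (h : plane R -> plane R) : expr_dom (plane_chart (R := R)) plane_chart setT h = setT.
  by apply/seteqP; split.
have {}sf : smooth_on setT (f : plane R -> plane R) by have := sf tt tt; rewrite dT.
have {}sg : smooth_on setT (g : plane R -> plane R) by have := sg tt tt; rewrite dT.
have {}pf := pf tt tt; rewrite dT in pf.
have FH (x : plane R) : setT x -> setT (f x) /\ g (f x) = x by move=> /fK.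
have HF (x : plane R) : setT x -> setT (g x) /\ f (g x) = x by move=> /gK.
have law := preserves_connection_law openT openT sf sg FH HF pf.
have [] := ratio_transform (x := 0) openT openT sf sg FH _ _
  (@plane_model_torsion_system R a b c) (@plane_model_torsion_system R a' b' c')
  (@plane_model_curvature_system R a b c) (@plane_model_curvature_system R a' b' c') law I.
- by move=> i j k; exact: smooth_cst.
- by move=> i j k; exact: smooth_cst.
- by exists 0; rewrite plane_model_tor /= mul1r mulf_neq0.
move=> r _; have := etrans (esym (plane_model_cur_ratio a b c 0))
  (etrans r (plane_model_cur_ratio a' b' c' (f 0))); move=> {r}.
(* The factor 4 comes from the 1/2 in the definition of the torsion and cancels on both sides. *)
have E (p q : R) : p / (2^-1 * q * (2^-1 * q)) = 2 * 2 * (p / (q * q)).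
  by rewrite !invfM invrK; ring.
by rewrite !E => /mulfI; apply; rewrite mulf_neq0.
Qed.

Lemma sign_ratio_inj (u u' : R) (s s' : bool) : 0 < u -> 0 < u' ->
  (-1) ^+ s / (2 * u * (2 * u)) = (-1) ^+ s' / (2 * u' * (2 * u')) -> u = u' /\ s = s'.
Proof.
move=> u0 u0' E.
have pos (v : R) : 0 < v -> 0 < (2 * v * (2 * v))^-1 by move=> v0; rewrite invr_gt0 !mulr_gt0.
have ss : s = s'.
  case: s s' E => -[] //= ; rewrite expr0 expr1 mulN1r div1r => E.
    by have := pos _ u0'; rewrite -E oppr_gt0 => /(lt_trans (pos _ u0)); rewrite ltxx.
  by have := pos _ u0; rewrite E oppr_gt0 => /(lt_trans (pos _ u0')); rewrite ltxx.
split => //; move: E; rewrite ss => /mulfI; rewrite signr_eq0 => /(_ isT)/invr_inj.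
move=> E; have {}E : u ^+ 2 = u' ^+ 2.
  by apply: (mulfI (_ : 2 * 2 != 0 :> R)); [rewrite mulf_neq0|rewrite !expr2; move: E; rewrite !mulrA; lra].
by apply/eqP; rewrite -(eqrXn2 (ltn0Sn 1)) ?ltW// E.
Qed.

End Inequivalence.

Theorem theorem2 (R : realType) :
  (forall M : affine_surface R,
     connected [set: M] ->
     symmetric_surface M -> torsion_nonzero M -> torsion_parallel M ->
     modeled_on M (model1 R) \/
     (exists (u : R) (s : bool), 0 < u /\ modeled_on M (model2 u s))) /\
  (forall X Y : field R, smooth_on setT X -> smooth_on setT Y ->
     forall x : plane R,
       ricci (@chart_symbols R (model1 R) tt) X Y x = 0) /\
  (forall (u : R) (s : bool), 0 < u ->
     forall X Y : field R, smooth_on setT X -> smooth_on setT Y ->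
     forall x : plane R,
       ricci (@chart_symbols R (model2 u s) tt) X Y x =
         (-1) ^+ s * (X x 0 1 * Y x 0 1)) /\
  homogeneous (model1 R) /\
  (forall (u : R) (s : bool), 0 < u -> homogeneous (model2 u s)) /\
  (forall (u : R) (s : bool), 0 < u -> ~ equivalent (model1 R) (model2 u s)) /\
  (forall (u u' : R) (s s' : bool), 0 < u -> 0 < u' ->
     equivalent (model2 u s) (model2 u' s') -> u = u' /\ s = s').
Proof.
have double_neq0 (u : R) : 0 < u -> 2 * u != 0 by move=> u0; rewrite mulf_neq0// gt_eqF.
split; [|split; [|split; [|split; [|split; [|split]]]]].
- move=> M cM sym tM par; have [beta r] := exists_ratio_at tM.
  have local := ratio_at_everywhere sym par cM r.
  have [b0|b0] := eqVneq beta 0; [left|right].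
    (* The flat model is the member u = 1, e = 0 of the family covered by [local_model]. *)
    have -> : model1 R = plane_model 1 (2 * 1) 0 by rewrite mulr1.
    split; first exact: plane_model_homogeneous.
    move=> p; have [i rp] := local p; apply: (local_model sym par rp) => //.
    by rewrite b0 mul0r.
  (* The equation beta u^2 = (-1)^s with u > 0 forces u = |beta|^(-1/2) and makes [s] the test for
     beta < 0. *)
  exists (Num.sqrt `|beta|)^-1, (beta < 0).
  have u0 : 0 < (Num.sqrt `|beta|)^-1 by rewrite invr_gt0 sqrtr_gt0 normr_gt0.
  split => //; split; first exact: plane_model_homogeneous.
  move=> p; have [i rp] := local p; apply: (local_model sym par rp u0).
  by rewrite -invfM -expr2 sqr_sqrtr// {1}[beta]numEsign mulfK ?normr_eq0.
- by move=> X Y sX sY x; rewrite [LHS](plane_model_ricci 1 2 0 x sX sY) mulr0 mul0r.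
- move=> u s _ X Y sX sY x.
  by rewrite [LHS](plane_model_ricci 1 (2 * u) ((-1) ^+ s) x sX sY) mul1r.
- exact: plane_model_homogeneous.
- by move=> u s _; exact: plane_model_homogeneous.
- move=> u s u0 E; have n2 : 2 != 0 :> R by rewrite pnatr_eq0.
  have /esym/eqP := plane_model_ratio_invariant n2 E.
  rewrite mul1r mulr0 mul0r mulf_eq0 signr_eq0 invr_eq0 mulf_eq0 orbb.
  by rewrite (negPf (double_neq0 u u0)).
- move=> u u' s s' u0 u0' E; apply: sign_ratio_inj => //.
  by have := plane_model_ratio_invariant (double_neq0 u u0) E; rewrite !mul1r.
Qed.
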